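(* Let $R$ be an indecomposable tame hereditary artin algebra. There is a bijective correspondence between equivalence classes of Baer $R$-modules and isomorphism classes of preprojective $R$-modules.
   Context: Modules are right $R$-modules. $\mathbf{p}$ and $\mathbf{t}$ are representative sets of all indecomposable finitely generated preprojective, respectively regular, modules. A module $M$ is Baer if $\mathrm{Ext}^1_R(M,T)=0$ for all $T\in\mathrm{Gen}\,\mathbf{t}$, where $\mathrm{Gen}\,\mathbf{t}$ is the class of all epimorphic images of direct sums of modules from $\mathbf{t}$. $\mathcal{L}$ is the class of all modules $M$ with $\mathrm{Hom}_R(M,P)=0$ for all $P\in\mathbf{p}$. It is a torsion class; for a module $M$, $l(M)$ denotes the corresponding torsion submodule of $M$ (the largest submodule of $M$ belonging to $\mathcal{L}$). The corresponding torsion-free class is $\mathcal{P}=\{X\mid\mathrm{Hom}_R(Y,X)=0\text{ for all }Y\in\mathcal{L}\}$, and its (possibly infinitely generated) members are called preprojective modules. Two Baer modules $B_1$ and $B_2$ are called equivalent if $B_1/l(B_1)\cong B_2/l(B_2)$. *)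

(* Defs.v *)
(* [lmodType S] is the type of left S-modules, so right R-modules are
   [lmodType R^c], where R^c is the opposite ring.  The general notions below
   are stated for left modules over a ring or algebra S; they are used with
   S := R^c. *)
From HB Require Import structures.
From mathcomp Require Import all_boot all_algebra generic_quotient ring_quotient.
From mathcomp Require Import boolp classical_sets functions cardinality.
From mathcomp Require Import freeg.

Set Implicit Arguments.
Unset Strict Implicit.
Unset Printing Implicit Defensive.

Import GRing.Theory.
Local Open Scope classical_set_scope.
Local Open Scope ring_scope.

Section OppositeAlgebra.
Variables (k : comNzRingType) (R : algType k).

Let conv_scale (a : k) (u : R^c) : R^c := a *: (u : R).
Let conv_scaleA a b u : conv_scale a (conv_scale b u) = conv_scale (a * b) u.
Proof. exact: scalerA. Qed.
Let conv_scale1 : left_id 1 conv_scale.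
Proof. exact: scale1r. Qed.
Let conv_scaleDr : right_distributive conv_scale +%R.
Proof. exact: scalerDr. Qed.
Let conv_scaleDl u : {morph conv_scale^~ u : a b / a + b}.
Proof. by move=> a b; exact: scalerDl. Qed.
HB.instance Definition _ := GRing.Zmodule_isLmodule.Build k R^c
  conv_scaleA conv_scale1 conv_scaleDr conv_scaleDl.

Let conv_scaleAl (a : k) (u v : R^c) : a *: (u * v) = (a *: u) * v.
Proof. exact: (@scalerAr k R a v u). Qed.

Let conv_scaleAr (a : k) (u v : R^c) : a *: (u * v) = u * (a *: v).
Proof. exact: (@scalerAl k R a v u). Qed.

HB.instance Definition _ :=
  GRing.LSemiModule_isLSemiAlgebra.Build k R^c conv_scaleAl.
HB.instance Definition _ :=
  GRing.LSemiAlgebra_isSemiAlgebra.Build k R^c conv_scaleAr.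

End OppositeAlgebra.

(* Submodules of M are the bundled predicates [submodClosed M]. *)

Section Submodules.
Variables (S : nzRingType) (M : lmodType S).

Definition submod (N : submodClosed M) := {x : M | x \in N}.

Section SubmodInstances.
Variable N : submodClosed M.
HB.instance Definition _ := [isSub of submod N for @sval M _].
HB.instance Definition _ := [Choice of submod N by <:].
HB.instance Definition _ := [SubChoice_isSubLmodule of submod N by <:].
End SubmodInstances.

Definition fullb : {pred M} := predT.
Lemma fullb_closed : submod_closed fullb. Proof. by []. Qed.
HB.instance Definition _ := GRing.isSubmodClosed.Build S M fullb fullb_closed.
Definition fullm : submodClosed M := fullb.

Definition zerob : {pred M} := pred1 0.
Lemma zerob_closed : submod_closed zerob.
Proof.
split; first exact: eqxx.
by move=> a x y /eqP -> /eqP ->; rewrite scaler0 addr0; apply/eqP.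
Qed.
HB.instance Definition _ := GRing.isSubmodClosed.Build S M zerob zerob_closed.
Definition zerom : submodClosed M := zerob.

End Submodules.

Section Kernel.
Variables (S : nzRingType) (M N : lmodType S) (f : {linear M -> N}).

Definition kerb : {pred M} := [pred x | f x == 0].
Lemma kerb_closed : submod_closed kerb.
Proof.
split; first by rewrite inE linear0.
move=> a x y /eqP fx /eqP fy; rewrite inE linearP.
by rewrite fx fy scaler0 addr0.
Qed.
HB.instance Definition _ := GRing.isSubmodClosed.Build S M kerb kerb_closed.
Definition kerm : submodClosed M := kerb.

End Kernel.

(* [Quotient.quot] only carries an additive group structure. *)
Section QuotientModule.
Variables (S : nzRingType) (M : lmodType S) (N : submodClosed M).
Local Open Scope quotient_scope.

Definition subz : {pred M} := [pred x | x \in N].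
Lemma subz_closed : zmod_closed subz.
Proof.
split; first by rewrite inE rpred0.
move=> x y; rewrite !inE => xN yN.
by rewrite -scaleN1r rpredD // rpredZ.
Qed.
HB.instance Definition _ := GRing.isZmodClosed.Build M subz subz_closed.

Definition quotm := Quotient.quot subz.
HB.instance Definition _ := GRing.Zmodule.on quotm.

Definition quotm_pi (x : M) : quotm := \pi_(Quotient.quot subz) x.
Definition quotm_scale (a : S) (u : quotm) : quotm :=
  quotm_pi (a *: repr (u : Quotient.quot subz)).

Lemma quotm_pi_eq x y : quotm_pi x = quotm_pi y <-> x - y \in N.
Proof.
have <- : (x - y \in subz) = (x - y \in N) by [].
by rewrite Quotient.idealrBE; split=> [/eqP|/eqP].
Qed.

Lemma quotm_piZ a x : quotm_scale a (quotm_pi x) = quotm_pi (a *: x).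
Proof.
apply/quotm_pi_eq; rewrite -scalerBr rpredZ //.
by apply/quotm_pi_eq; rewrite /quotm_pi reprK.
Qed.

Lemma quotm_piD x y : quotm_pi (x + y) = quotm_pi x + quotm_pi y.
Proof. exact: raddfD. Qed.

Lemma quotm_ex u : exists x, u = quotm_pi x.
Proof. by exists (repr (u : Quotient.quot subz)); rewrite /quotm_pi reprK. Qed.

Let scaleA a b u : quotm_scale a (quotm_scale b u) = quotm_scale (a * b) u.
Proof. by have [x ->] := quotm_ex u; rewrite !quotm_piZ scalerA. Qed.
Let scale1 : left_id 1 quotm_scale.
Proof. by move=> u; have [x ->] := quotm_ex u; rewrite quotm_piZ scale1r. Qed.
Let scaleDr : right_distributive quotm_scale +%R.
Proof.
move=> a u v; have [x ->] := quotm_ex u; have [y ->] := quotm_ex v.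
by rewrite -quotm_piD !quotm_piZ scalerDr quotm_piD.
Qed.
Let scaleDl v : {morph quotm_scale^~ v : a b / a + b}.
Proof.
move=> a b; have [x ->] := quotm_ex v.
by rewrite !quotm_piZ scalerDl quotm_piD.
Qed.
HB.instance Definition _ :=
  GRing.Zmodule_isLmodule.Build S quotm scaleA scale1 scaleDr scaleDl.

Let quotm_pi_linear : linear quotm_pi.
Proof. by move=> a x y; rewrite quotm_piD -quotm_piZ. Qed.
HB.instance Definition _ :=
  GRing.isLinear.Build S M quotm *:%R quotm_pi quotm_pi_linear.

End QuotientModule.

Section DirectSum.
Variables (S : nzRingType) (I : Type) (F : I -> lmodType S).

Definition dprod := forall i, F i.
HB.instance Definition _ := Choice.copy dprod (forall i, F i).

Let dp_add (f g : dprod) : dprod := fun i => f i + g i.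
Let dp_zero : dprod := fun i => 0.
Let dp_opp (f : dprod) : dprod := fun i => - f i.
Let dp_scale (a : S) (f : dprod) : dprod := fun i => a *: f i.

Let dp_addA : associative dp_add.
Proof. by move=> f g h; apply: functional_extensionality_dep => i; exact: addrA. Qed.
Let dp_addC : commutative dp_add.
Proof. by move=> f g; apply: functional_extensionality_dep => i; exact: addrC. Qed.
Let dp_add0 : left_id dp_zero dp_add.
Proof. by move=> f; apply: functional_extensionality_dep => i; exact: add0r. Qed.
Let dp_addN : left_inverse dp_zero dp_opp dp_add.
Proof. by move=> f; apply: functional_extensionality_dep => i; exact: addNr. Qed.
HB.instance Definition _ :=
  GRing.isZmodule.Build dprod dp_addA dp_addC dp_add0 dp_addN.

Let dp_scaleA a b f : dp_scale a (dp_scale b f) = dp_scale (a * b) f.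
Proof. by apply: functional_extensionality_dep => i; exact: scalerA. Qed.
Let dp_scale1 : left_id 1 dp_scale.
Proof. by move=> f; apply: functional_extensionality_dep => i; exact: scale1r. Qed.
Let dp_scaleDr : right_distributive dp_scale +%R.
Proof. by move=> a f g; apply: functional_extensionality_dep => i; exact: scalerDr. Qed.
Let dp_scaleDl f : {morph dp_scale^~ f : a b / a + b}.
Proof. by move=> a b; apply: functional_extensionality_dep => i; exact: scalerDl. Qed.
HB.instance Definition _ :=
  GRing.Zmodule_isLmodule.Build S dprod dp_scaleA dp_scale1 dp_scaleDr dp_scaleDl.

Definition dsumb : {pred dprod} :=
  [pred f : dprod | `[< finite_set [set i | f i != 0] >]].
Lemma dsumb_closed : submod_closed dsumb.
Proof.
split.
  apply/asboolP; have -> : [set i | (0 : dprod) i != 0] = set0.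
    by apply/seteqP; split=> i //=; rewrite eqxx.
  exact: finite_set0.
move=> a f g /asboolP ff /asboolP fg; apply/asboolP.
have fU : finite_set ([set i | f i != 0] `|` [set i | g i != 0]).
  by rewrite finite_setU.
apply: sub_finite_set fU => i /= ; apply: contraPP.
move=> /not_orP[/negP/negPn/eqP fi /negP/negPn/eqP gi]; apply/negP/negPn/eqP.
by rewrite /GRing.add /= /dp_add /GRing.scale /= /dp_scale fi gi scaler0 addr0.
Qed.
HB.instance Definition _ := GRing.isSubmodClosed.Build S dprod dsumb dsumb_closed.

Definition dsum := submod (dsumb : submodClosed dprod).
HB.instance Definition _ := GRing.Lmodule.on dsum.

End DirectSum.

Section ModuleNotions.
Variable S : nzRingType.
Implicit Types M N P Q X Y : lmodType S.

Definition isom M N := exists f : {linear M -> N}, bijective f.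

Definition is_surj M N (f : {linear M -> N}) := forall y, exists x, f x = y.

Definition trivialm M := forall x : M, x = 0.

Definition fin_gen M :=
  exists (n : nat) (g : 'I_n -> M),
    forall x, exists c : 'I_n -> S, x = \sum_(i < n) c i *: g i.

Definition indecomposable_mod M :=
  ~ trivialm M /\
  forall A B : lmodType S, isom M (A * B)%type -> trivialm A \/ trivialm B.

Definition simple_mod M :=
  ~ trivialm M /\
  forall N : submodClosed M, N =i zerom M \/ N =i fullm M.

Definition projective_mod P :=
  forall M N (g : {linear M -> N}) (f : {linear P -> N}),
    is_surj g -> exists h : {linear P -> M}, forall x, g (h x) = f x.

Definition injective_mod Q :=
  forall M N (g : {linear M -> N}) (f : {linear M -> Q}),
    injective g -> exists h : {linear N -> Q}, forall x, h (g x) = f x.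

Definition artinian_mod M :=
  forall N : nat -> submodClosed M,
    (forall n, {subset N n.+1 <= N n}) ->
    exists m, forall n, (m <= n)%N -> N n =i N m.

(* M has a composition series with n factors. *)
Definition has_length M (n : nat) :=
  exists N : nat -> submodClosed M,
    [/\ N 0%N =i zerom M, N n =i fullm M &
      forall i, (i < n)%N ->
        [/\ {subset N i <= N i.+1}, ~ (N i =i N i.+1) &
          forall L : submodClosed M,
            {subset N i <= L} -> {subset L <= N i.+1} ->
            L =i N i \/ L =i N i.+1]].

Definition essential_epi P M (f : {linear P -> M}) :=
  is_surj f /\
  forall N : submodClosed P,
    (forall x, exists2 y, y \in N & f y = f x) -> N =i fullm P.

(* p is a representative set of the isomorphism-closed class C. *)
Definition representative_set (C p : lmodType S -> Prop) :=
  [/\ forall X, p X -> C X,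
      forall X, C X -> exists2 Y, p Y & isom X Y &
      forall X Y, p X -> p Y -> isom X Y -> X = Y].

Definition Gen (t : lmodType S -> Prop) (T : lmodType S) : Prop :=
  exists (I : Type) (F : I -> lmodType S),
     (forall i, t (F i)) /\ exists f : {linear dsum F -> T}, is_surj f.

Definition Hom_zero M P := forall (f : {linear M -> P}) x, f x = 0.

End ModuleNotions.

Definition indecomposable_ring (R : nzRingType) :=
  forall (A B : nzRingType) (f : {rmorphism R -> A * B}), ~ bijective f.

(* Every left ideal is projective. *)
Definition left_hereditary (S : nzRingType) :=
  forall I : submodClosed (S^o : lmodType S), projective_mod (submod I).

Definition hereditary (R : nzRingType) :=
  left_hereditary R /\ left_hereditary R^c.

Definition artin_algebra (k : comNzRingType) (R : algType k) :=
  artinian_mod (k^o : lmodType k) /\ fin_gen (R : lmodType k).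

Section FreePresentation.
Variables (S : nzRingType) (M : lmodType S).

(* The free module on the underlying set of M, and its canonical map to M. *)
Definition free_cover : {freeg M / S} -> M := fglift (fun x : M => x).

Let free_cover_linear : linear free_cover.
Proof.
move=> a D1 D2.
have addB := lift_is_additive (fun x : M => x) : additive free_cover.
pose fA := GRing.isZmodMorphism.Build _ _ free_cover addB.
pose f : {additive {freeg M / S} -> M} := HB.pack free_cover fA.
have -> : free_cover = f by [].
rewrite raddfD; congr (_ + _).
have -> : a *: D1 = \sum_(x <- dom D1) << a * coeff x D1 *g x >> by [].
rewrite raddf_sum -[in RHS](freeg_sumE D1) raddf_sum scaler_sumr.
by apply: eq_bigr => x _; rewrite /= /free_cover !liftU scalerA.
Qed.
HB.instance Definition _ :=
  GRing.isLinear.Build S {freeg M / S} M *:%R free_cover free_cover_linear.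

Definition syzygy := submod (kerm free_cover).
HB.instance Definition _ := GRing.Lmodule.on syzygy.

End FreePresentation.

Section HomExt.
Variables (k : comNzRingType) (S : algType k).

(* M as a k-module, by restriction of scalars along k -> S. *)
Definition resk (M : lmodType S) : Type := M.

Section ResInstances.
Variable M : lmodType S.
HB.instance Definition _ := GRing.Zmodule.copy (resk M) M.
Let rscale (c : k) (x : resk M) : resk M := (c%:A : S) *: (x : M).
Let rscaleA a b x : rscale a (rscale b x) = rscale (a * b) x.
Proof. by rewrite /rscale scalerA -scalerAl mul1r scalerA. Qed.
Let rscale1 : left_id 1 rscale.
Proof. by move=> x; rewrite /rscale !scale1r. Qed.
Let rscaleDr : right_distributive rscale +%R.
Proof. by move=> a x y; exact: scalerDr. Qed.
Let rscaleDl x : {morph rscale^~ x : a b / a + b}.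
Proof. by move=> a b; rewrite /rscale scalerDl [LHS]scalerDl. Qed.
HB.instance Definition _ := GRing.Zmodule_isLmodule.Build k (resk M)
  rscaleA rscale1 rscaleDr rscaleDl.
Lemma resk_scaleE (c : k) (x : M) : c *: (x : resk M) = (c%:A : S) *: x.
Proof. by []. Qed.
End ResInstances.

Section Hom.
Variables X Y : lmodType S.

Definition homb : {pred (X -> resk Y)} :=
  [pred f : X -> resk Y | `[< linear (f : X -> Y) >]].
Lemma homb_closed : submod_closed homb.
Proof.
split.
  by apply/asboolP => a x y; rewrite [LHS]/= [RHS]/= scaler0 addr0.
move=> c f g /asboolP lf /asboolP lg; apply/asboolP => a x y.
have E z : (c *: f + g) z = (c%:A : S) *: (f z : Y) + (g z : Y) :> Y by [].
rewrite !E lf lg scalerDr [a *: (_ + _)]scalerDr !scalerA.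
by rewrite -scalerAl mul1r -scalerAr mulr1 addrACA.
Qed.
HB.instance Definition _ :=
  GRing.isSubmodClosed.Build k (X -> resk Y) homb homb_closed.

(* The k-module Hom_S(X, Y). *)
Definition Hom := submod (homb : submodClosed (X -> resk Y)).
HB.instance Definition _ := GRing.Lmodule.on Hom.

End Hom.

(* Ext^1_S(X, Y) := coker (Hom(F, Y) -> Hom(K, Y)), computed from the canonical
   free presentation 0 -> K -> F -> X -> 0. *)
Section Ext.
Variables X Y : lmodType S.

Definition restrb : {pred Hom (syzygy X) Y} :=
  [pred f : Hom (syzygy X) Y |
    `[< exists g : {linear {freeg X / S} -> Y},
          forall z : syzygy X, \val f z = g (\val z) >]].
Lemma restrb_closed : submod_closed restrb.
Proof.
split.
  by apply/asboolP; exists \0 => z.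
move=> c f1 f2 /asboolP[g1 e1] /asboolP[g2 e2]; apply/asboolP.
pose g (x : {freeg X / S}) : Y := (c%:A : S) *: g1 x + g2 x.
have lg : linear g.
  move=> a x y; rewrite /g !linearP scalerDr [a *: (_ + _)]scalerDr !scalerA.
  by rewrite -scalerAl mul1r -scalerAr mulr1 addrACA.
pose gl := GRing.isLinear.Build _ _ _ _ g lg.
pose gL : {linear {freeg X / S} -> Y} := HB.pack g gl.
by exists gL => z; rewrite /= /g -e1 -e2.
Qed.
HB.instance Definition _ :=
  GRing.isSubmodClosed.Build k (Hom (syzygy X) Y) restrb restrb_closed.

Definition Ext1 := quotm (restrb : submodClosed (Hom (syzygy X) Y)).
HB.instance Definition _ := GRing.Lmodule.on Ext1.

End Ext.

Definition is_euler X Y (z : int) :=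
  exists h e : nat,
    [/\ has_length (Hom X Y) h, has_length (Ext1 X Y) e & z = h%:Z - e%:Z].

(* For a hereditary artin algebra S, the Grothendieck group K_0 is free on the
   simple modules T_0, ..., T_(n-1), and the homological quadratic form is
   q(x) = <x, x>, where <[X],[Y]> = length_k Hom(X,Y) - length_k Ext^1(X,Y).
   S is tame if q is positive semidefinite but not positive definite. *)
Definition tame :=
  exists (n : nat) (T : 'I_n -> lmodType S) (E : 'M[int]_n),
    [/\ (forall i, simple_mod (T i)),
        (forall X, simple_mod X -> exists i, isom X (T i)),
        (forall i j, isom (T i) (T j) -> i = j),
        (forall i j, is_euler (T i) (T j) (E i j)) &
        let q (x : 'I_n -> int) := \sum_i \sum_j x i * E i j * x j in
        (forall x, 0 <= q x) /\ (exists2 x, (exists i, x i != 0) & q x = 0)].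

End HomExt.

Section ArtinDuality.
Variable k : comNzRingType.

Definition maximal_ideal (m : submodClosed (k^o : lmodType k)) :=
  1 \notin m /\
  forall n : submodClosed (k^o : lmodType k),
    {subset m <= n} -> n =i m \/ 1 \in n.

(* J is an injective envelope of k / rad k. *)
Definition inj_env_top (J : lmodType k) :=
  injective_mod J /\
  exists i : {linear k^o -> J},
    (forall a : k, i a = 0 <->
       forall m : submodClosed (k^o : lmodType k), maximal_ideal m -> a \in m) /\
    (forall L : submodClosed J,
       (forall a : k, i a \in L -> i a = 0) -> L =i zerom J).

Variables S S' : algType k.

(* In [is_dual] and [is_transpose], op is the identity map from S to its opposite
   ring S' (so S, S' are R, R^c or R^c, R): M is a left S-module and N, as a
   left S'-module, is a right S-module. *)
Variable op : S -> S'.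

(* N is isomorphic to D M = Hom_k(M, J), with (n s)(m) = n (s m). *)
Definition is_dual (M : lmodType S) (N : lmodType S') :=
  exists (J : lmodType k) (th : N -> {linear resk M -> J}),
    [/\ inj_env_top J,
        (forall n n' m, th (n + n') m = th n m + th n' m),
        (forall s n (m : M), th (op s *: n) m = th n (s *: m)),
        (forall n n', (forall m, th n m = th n' m) -> n = n') &
        (forall g : {linear resk M -> J}, exists n, forall m, th n m = g m)].

(* N is isomorphic to Tr M: for a minimal projective presentation
   P1 -d-> P0 -e-> M -> 0, the map pi exhibits N as the cokernel of
   Hom_S(P0, S) -> Hom_S(P1, S), where (f s)(x) = f(x) s. *)
Definition is_transpose (M : lmodType S) (N : lmodType S') :=
  exists (P0 P1 : lmodType S) (e : {linear P0 -> M}) (d : {linear P1 -> P0})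
         (pi : {linear P1 -> S^o} -> N),
    [/\ [/\ projective_mod P0, projective_mod P1, essential_epi e,
            (forall x, e x = 0 <-> exists y, d y = x) &
            (forall L : submodClosed P1,
               (forall x, exists2 y, y \in L & d y = d x) -> L =i fullm P1)],
        (forall f g h : {linear P1 -> S^o},
           (forall x, h x = f x + g x) -> pi h = pi f + pi g),
        (forall (s : S) (f h : {linear P1 -> S^o}),
           (forall x, h x = (f x : S) * s) -> pi h = op s *: pi f),
        (forall f : {linear P1 -> S^o}, pi f = 0 <->
           exists g : {linear P0 -> S^o}, forall x, f x = g (d x)) &
        (forall n, exists f, pi f = n)].

End ArtinDuality.

Section ARTranslate.
Variables (k : comNzRingType) (R : algType k).
Local Notation rmod := (lmodType R^c).
Let to_op (r : R) : R^c := r.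
Let of_op (r : R^c) : R := r.

Definition is_DTr (X Y : rmod) :=
  exists N : lmodType R, is_transpose of_op X N /\ is_dual to_op N Y.

Definition is_TrD (X Y : rmod) :=
  exists N : lmodType R, is_dual of_op X N /\ is_transpose to_op N Y.

Fixpoint iter_rel (T : Type) (r : T -> T -> Prop) (n : nat) (X Y : T) : Prop :=
  if n is n'.+1 then exists2 Z, r X Z & iter_rel r n' Z Y else X = Y.

Definition fg_indec (X : rmod) : Prop :=
   fin_gen X /\ indecomposable_mod X.

Definition fg_preprojective (X : rmod) : Prop :=
   fg_indec X /\
     exists n Y, iter_rel is_DTr n X Y /\ projective_mod Y.

Definition fg_preinjective (X : rmod) : Prop :=
   fg_indec X /\
     exists n Y, iter_rel is_TrD n X Y /\ injective_mod Y.

Definition fg_regular (X : rmod) : Prop :=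
   [/\ fg_indec X, ~ fg_preprojective X & ~ fg_preinjective X].

End ARTranslate.

Section TorsionPair.
Variables (S : nzRingType) (p : lmodType S -> Prop).
Implicit Types M X Y : lmodType S.

Definition classL M := forall P, p P -> Hom_zero M P.

Definition classP X := forall Y, classL Y -> Hom_zero Y X.

Section TorsionPart.
Variable M : lmodType S.

(* l(M) is the union of the submodules of M that belong to L; it is the
   largest one of these by [l_torsion] and [l_largest]. *)
Definition lb : {pred M} :=
  [pred x | `[< exists2 N : submodClosed M, classL (submod N) & x \in N >]].

Section SumSubmod.
Variables N1 N2 : submodClosed M.
Definition sumb : {pred M} :=
  [pred x | `[< exists2 y, y \in N1 & x - y \in N2 >]].
Lemma sumb_closed : submod_closed sumb.
Proof.
split; first by apply/asboolP; exists 0; rewrite ?subr0 rpred0.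
move=> a x y /asboolP[x1 x1N xN] /asboolP[y1 y1N yN]; apply/asboolP.
exists (a *: x1 + y1); first by rewrite rpredD ?rpredZ.
by rewrite opprD addrACA -scalerBr rpredD ?rpredZ.
Qed.
HB.instance Definition _ := GRing.isSubmodClosed.Build S M sumb sumb_closed.
Definition summ : submodClosed M := sumb.
End SumSubmod.

Lemma classL_restrict (N N' : submodClosed M) (P : lmodType S)
    (f : {linear submod N' -> P}) :
  classL (submod N) -> p P -> {subset N <= N'} ->
  forall u : submod N', \val u \in N -> f u = 0.
Proof.
move=> LN pP sN u uN.
pose g (v : submod N) : P := f (Sub (\val v) (sN _ (valP v))).
have lg : linear g.
  move=> a v w; rewrite /g -linearP; congr (f _).
  apply: val_inj; rewrite [RHS]linearP.
  exact: (linearP (\val : submod N -> M)).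
pose gl := GRing.isLinear.Build _ _ _ _ g lg.
pose gL : {linear submod N -> P} := HB.pack g gl.
have := LN P pP gL (Sub (\val u) uN).
by rewrite /= /g => <-; congr (f _); apply: val_inj.
Qed.

Lemma classL_sum N1 N2 :
  classL (submod N1) -> classL (submod N2) -> classL (submod (summ N1 N2)).
Proof.
move=> L1 L2 P pP f u.
have s1 : {subset N1 <= summ N1 N2}.
  by move=> x xN; apply/asboolP; exists x; rewrite ?subrr ?rpred0.
have s2 : {subset N2 <= summ N1 N2}.
  by move=> x xN; apply/asboolP; exists 0; rewrite ?subr0 ?rpred0.
have /asboolP[y yN1 uyN2] := valP u.
pose u1 : submod (summ N1 N2) := Sub y (s1 _ yN1).
pose u2 : submod (summ N1 N2) := Sub (\val u - y) (s2 _ uyN2).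
have -> : u = u1 + u2.
  apply: val_inj; rewrite [RHS]raddfD.
  by change (\val u = y + (\val u - y)); rewrite addrC subrK.
rewrite linearD (classL_restrict f L1 pP s1 (u := u1) yN1).
by rewrite (classL_restrict f L2 pP s2 (u := u2) uyN2) addr0.
Qed.

Lemma lb_closed : submod_closed lb.
Proof.
split.
  apply/asboolP; exists (zerom M); last by rewrite inE.
  move=> P pP f u; have -> : u = 0.
    by apply: val_inj; have /eqP := valP u.
  exact: linear0.
move=> a x y /asboolP[N1 L1 xN] /asboolP[N2 L2 yN]; apply/asboolP.
exists (summ N1 N2); first exact: classL_sum.
by apply/asboolP; exists (a *: x); rewrite ?rpredZ // addrC addKr.
Qed.
HB.instance Definition _ := GRing.isSubmodClosed.Build S M lb lb_closed.
Definition l : submodClosed M := lb.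

Lemma l_torsion : classL (submod l).
Proof.
move=> P pP f u; have /asboolP[N LN uN] := valP u.
apply: (classL_restrict f LN pP) => // x xN.
by apply/asboolP; exists N.
Qed.

Lemma l_largest (N : submodClosed M) :
  classL (submod N) -> {subset N <= l}.
Proof. by move=> LN x xN; apply/asboolP; exists N. Qed.

End TorsionPart.
End TorsionPair.

Section Baer.
Variables (k : comNzRingType) (S : algType k) (p t : lmodType S -> Prop).

Definition Baer (M : lmodType S) :=
  forall T, Gen t T -> forall e : Ext1 M T, e = 0.

Definition torsion_free_quotient (M : lmodType S) : lmodType S := quotm (l p M).

Definition Baer_equiv (B1 B2 : lmodType S) :=
  isom (torsion_free_quotient B1) (torsion_free_quotient B2).

Definition Baer_eq_class (B : lmodType S) (X : lmodType S) : Prop :=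
  Baer X /\ Baer_equiv B X.

Definition preproj_iso_class (P : lmodType S) (X : lmodType S) : Prop :=
  classP p X /\ isom P X.

End Baer.

(* [set_bij], restated because [set (lmodType S)] violates the universe
   constraints of the library: classes of modules are plain predicates. *)
Definition class_bij (T U : Type) (A : T -> Prop) (B : U -> Prop) (f : T -> U) :=
  [/\ forall x, A x -> B (f x),
      forall x y, A x -> A y -> f x = f y -> x = y &
      forall y, B y -> exists2 x, A x & f x = y].

(* Main.v *)
From HB Require Import structures.
From mathcomp Require Import all_boot all_algebra.
From mathcomp Require Import boolp classical_sets functions cardinality.
From mathcomp Require Import freeg.
Require Import Defs.

(** Sending the class of [B] to the class of [B / l(B)] is well defined and
    injective because equivalence of Baer modules is isomorphism of these
    quotients, and its values are preprojective because [l] is a radical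
    ([classP_torsion_free]).  The content is surjectivity ([baer_preimage]):
    every preprojective module [P], however large, is isomorphic to [B / l(B)]
    for some Baer module [B].

    Write [S] for [R^c].  [Ext^1] enters only through its vanishing, in the form
    [ext0 X M]: maps from [X] lift along surjections with kernel [M] ([BaerP]).
    As [S] is hereditary, submodules of projective modules are projective
    ([submod_proj]), so [ext0 X M] passes to quotients of [M] and to submodules
    of [X] ([ext0_surj], [ext0_sub]).  In particular submodules of Baer modules
    are Baer.

    Precover.  There is a surjection [C -> P] from a Baer module whose kernel is
    orthogonal to all finitely generated Baer modules [X], in the sense that
    [Ext^1(X, -)] vanishes on it ([precov_ext0], [precov_ker_extends]).  Instead
    of a transfinite sequence of extensions, [C] is presented in one stroke by
    generators and relations.  The generators form an inductive type, and maps
    from [C] are lifted by recursion over it.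

    Splitting.  Let [K] be the kernel of [C / l(C) -> P].  It is torsion free,
    and it is a quotient of the kernel of [C -> P], hence still orthogonal to the
    finitely generated Baer modules.  Such modules are injective
    ([baer_orth_injective]), so [C / l(C)] is the direct sum of [K] and a copy of
    [P].  The preimage [B] in [C] of that copy is a submodule of a Baer module,
    and it contains [l(C)] with quotient [P]; hence it is Baer with [l(B) = l(C)].

    Injectivity.  Unions of chains of injective submodules are injective over a
    noetherian ring, so by Zorn's lemma it is enough to find a nonzero injective
    submodule in every nonzero torsion-free [V] orthogonal to the finitely
    generated Baer modules ([baer_orth_injective_sub]).  The tool is the
    Auslander-Reiten formula: [Ext^1(X, M) = 0] if and only if
    [Hom(M, DTr X) = 0] ([AR_ext0], [AR_hom_zero]).
    - If a finitely generated indecomposable module has a nonzero map to a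
      finitely generated preprojective module, it is preprojective
      ([preproj_pred]).  Hence the latter have no nonzero maps from regular
      modules, and they are Baer ([preproj_ext0]).
    - Let [W] be finitely generated indecomposable, with all its indecomposable
      predecessors preprojective.  Either [W] is injective and no longer than
      [R], or it is [DTr X] for some finitely generated [X]
      ([tau_inv_or_injective]).  In the second case [Hom(T, W) = 0] for [T] in
      [t] makes [X] Baer; if [W] were orthogonal to [X], then [Hom(W, W) = 0],
      which is absurd.  So orthogonality forces the first case
      ([baer_orth_indec_injective]).
    - The image of a nonzero map from [V] to a module of [p] yields a quotient
      [I] of [V] of this kind.  Take [I] of maximal length.  If [V -> I] did not
      split, its kernel would have a nonzero map [f] to [DTr I].  Dividing [V] by
      the kernel of [f] gives an extension of [I] by the image of [f], which
      splits by maximality of [I].  So the image of [f] is a quotient of [V],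
      hence [Ext^1(I, -)] vanishes on it, against the Auslander-Reiten formula.

    The formula is proved by a direct computation with a presentation
    [0 -> P1 -> P0 -> X -> 0]: the elements of [DTr X] are the functionals on
    [Hom(P1, S)] that vanish on [Hom(P0, S)], and [ARdata] records exactly this.
    The duality is [Hom_k(-, J)] with [J] the injective envelope of [k / rad k];
    [J] exists and preserves length because essential extensions of [k / rad k]
    are no longer than [k] ([ess_len], [inj_env_top_ex], [kdual_len]). *)

Set Implicit Arguments.
Unset Strict Implicit.
Unset Printing Implicit Defensive.

Import GRing.Theory.
Local Open Scope ring_scope.

(** * Linear maps, submodules and free modules *)

Section Linear.
Variable S : nzRingType.
Implicit Types M N P Q X Y Z : lmodType S.

Definition mklin M N (f : M -> N) (lf : linear f) : {linear M -> N} :=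
  HB.pack f (GRing.isLinear.Build _ _ _ _ f lf).

Lemma mklinE M N (f : M -> N) (lf : linear f) x : mklin lf x = f x.
Proof. by []. Qed.

Definition lcomp M N P (f : {linear N -> P}) (g : {linear M -> N}) :
  {linear M -> P} := f \o g.
Lemma lcompE M N P (f : {linear N -> P}) (g : {linear M -> N}) x :
  lcomp f g x = f (g x).
Proof. by []. Qed.
Arguments lcomp : simpl never.

Definition sincl M (N : submodClosed M) : {linear submod N -> M} :=
  (\val : submod N -> M).
Arguments sincl : simpl never.
Arguments sincl {M N}.

Lemma sincl_inj M (N : submodClosed M) : injective (@sincl M N).
Proof. exact: val_inj. Qed.

Lemma sinclP M (N : submodClosed M) (u : submod N) : sincl u \in N.
Proof. exact: valP. Qed.

Lemma sincl_ex M (N : submodClosed M) x : x \in N -> exists u : submod N, sincl u = x.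
Proof. by move=> xN; exists (Sub x xN); exact: SubK. Qed.

Lemma lin_inj0 M N (f : {linear M -> N}) :
  (forall x, f x = 0 -> x = 0) -> injective f.
Proof.
move=> f0 x y fxy; apply/eqP; rewrite -subr_eq0; apply/eqP/f0.
by rewrite linearB fxy subrr.
Qed.

Lemma submodB M (L : submodClosed M) x y : x \in L -> y \in L -> x - y \in L.
Proof. by move=> xL yL; rewrite -scaleN1r rpredD // rpredZ. Qed.

Section Predicates.
Variables (M : lmodType S) (A : M -> Prop).
Hypothesis A0 : A 0.
Hypothesis AL : forall a x y, A x -> A y -> A (a *: x + y).

Let predb : {pred M} := [pred x | `[< A x >]].
Let predb_closed : submod_closed predb.
Proof.
split; first exact/asboolP.
by move=> a x y /asboolP Ax /asboolP Ay; apply/asboolP/AL.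
Qed.
(** Opaque, so that simplification never unfolds membership in [mksub]. *)
Fact mksub_ex : {N : submodClosed M | forall x, (x \in N) = `[< A x >]}.
Proof.
pose N : submodClosed M := HB.pack predb (GRing.isSubmodClosed.Build S M predb predb_closed).
by exists N.
Qed.
Definition mksub : submodClosed M := sval mksub_ex.
Lemma mksubP x : reflect (A x) (x \in mksub).
Proof. by rewrite (svalP mksub_ex); exact: asboolP. Qed.
End Predicates.

Lemma factor_surj M Y Z (g : {linear M -> Y}) (f : {linear M -> Z}) :
  is_surj g -> (forall x, g x = 0 -> f x = 0) ->
  exists h : {linear Y -> Z}, forall x, h (g x) = f x.
Proof.
move=> gs fg; pose s y := projT1 (cid (gs y)).
have sK y : g (s y) = y by rewrite /s; case: cid.
have E x x' : g x = g x' -> f x = f x'.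
  move=> gx; apply/eqP; rewrite -subr_eq0 -linearB; apply/eqP/fg.
  by rewrite linearB gx subrr.
have lh : linear (fun y => f (s y)).
  by move=> a x y; rewrite -linearP; apply: E; rewrite linearP !sK.
by exists (mklin lh) => x; apply: E; rewrite sK.
Qed.

Lemma factor_inj M X Z (i : {linear M -> Z}) (f : {linear X -> Z}) :
  injective i -> (forall x, exists m, i m = f x) ->
  exists h : {linear X -> M}, forall x, i (h x) = f x.
Proof.
move=> ii fi; pose s x := projT1 (cid (fi x)).
have sK x : i (s x) = f x by rewrite /s; case: cid.
have lh : linear s by move=> a x y; apply: ii; rewrite linearP !sK linearP.
by exists (mklin lh).
Qed.

Lemma bij_inv M N (f : {linear M -> N}) : injective f -> is_surj f ->
  exists g : {linear N -> M}, cancel f g /\ cancel g f.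
Proof.
move=> fi fs; have [h hE] := factor_inj (i := f) (f := (idfun : {linear N -> N})) fi fs.
by exists h; split=> [x|//]; apply: fi; rewrite hE.
Qed.

Lemma isom_of M N (f : {linear M -> N}) : injective f -> is_surj f -> isom M N.
Proof. by move=> fi fs; have [g [fK gK]] := bij_inv fi fs; exists f, g. Qed.
Lemma bij_surj M N (f : {linear M -> N}) : bijective f -> is_surj f.
Proof. by case=> g _ gK y; exists (g y). Qed.

Lemma isom_sym M N : isom M N -> isom N M.
Proof.
case=> f fb; have [g [fK gK]] := bij_inv (bij_inj fb) (bij_surj fb).
by exists g, f.
Qed.

Lemma isom_trans N M P : isom M N -> isom N P -> isom M P.
Proof.
move=> [f fb] [g gb].
exists (lcomp g f); exact: bij_comp gb fb.
Qed.

Lemma isom_refl M : isom M M.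
Proof. by exists (idfun : {linear M -> M}), idfun. Qed.

Fact imm0 M N (f : {linear M -> N}) : exists x, f x = 0.
Proof. by exists 0; rewrite linear0. Qed.
Fact immL M N (f : {linear M -> N}) a y y' :
  (exists x, f x = y) -> (exists x, f x = y') -> exists x, f x = a *: y + y'.
Proof. by move=> [x <-] [x' <-]; exists (a *: x + x'); rewrite linearP. Qed.
Definition imm M N (f : {linear M -> N}) : submodClosed N :=
  mksub (imm0 f) (@immL _ _ f).
Lemma immP M N (f : {linear M -> N}) y : reflect (exists x, f x = y) (y \in imm f).
Proof. exact: mksubP. Qed.
Lemma imm_f M N (f : {linear M -> N}) x : f x \in imm f.
Proof. by apply/immP; exists x. Qed.

Fact mpreim0 M N (f : {linear M -> N}) (L : submodClosed N) : f 0 \in L.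
Proof. by rewrite linear0 rpred0. Qed.
Fact mpreimL M N (f : {linear M -> N}) (L : submodClosed N) a x y :
  f x \in L -> f y \in L -> f (a *: x + y) \in L.
Proof. by move=> xL yL; rewrite linearP rpredD ?rpredZ. Qed.
Definition mpreim M N (f : {linear M -> N}) (L : submodClosed N) :=
  mksub (mpreim0 f L) (@mpreimL _ _ f L).
Lemma mpreimP M N (f : {linear M -> N}) L x : (x \in mpreim f L) = (f x \in L).
Proof. by apply/mksubP/idP. Qed.

Fact toimm_linear M N (f : {linear M -> N}) : linear (fun x => Sub (f x) (imm_f f x) : submod (imm f)).
Proof.
move=> a x y; apply: val_inj; rewrite [RHS](linearP (@sincl _ _)).
  by rewrite SubK linearP.
Qed.
Definition toimm M N (f : {linear M -> N}) : {linear M -> submod (imm f)} :=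
  mklin (toimm_linear f).
Arguments toimm : simpl never.
Lemma toimmE M N (f : {linear M -> N}) x : sincl (toimm f x) = f x.
Proof. by []. Qed.
Lemma toimm_surj M N (f : {linear M -> N}) : is_surj (toimm f).
Proof.
move=> u; have /immP[x fx] := sinclP u.
by exists x; apply: sincl_inj; rewrite toimmE.
Qed.

Fact linr_linear X Y Z (f : {linear X -> Z}) (g : {linear Y -> Z}) :
  linear (fun u : X * Y => f u.1 + g u.2).
Proof.
by move=> a u v; rewrite !linearP /= scalerDr addrACA.
Qed.
Definition linr X Y Z (f : {linear X -> Z}) (g : {linear Y -> Z})
  : {linear (X * Y)%type -> Z} :=
  mklin (linr_linear f g).
Arguments linr : simpl never.

Fact inl_linear X Y : linear (fun x : X => (x, 0 : Y)).
Proof.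
by move=> a x y; apply: injective_projections => /=; rewrite ?scaler0 ?addr0.
Qed.
Definition inl_lin X Y : {linear X -> (X * Y)%type} :=
  mklin (@inl_linear X Y).
Fact inr_linear X Y : linear (fun y : Y => (0 : X, y)).
Proof.
by move=> a x y; apply: injective_projections => /=; rewrite ?scaler0 ?addr0.
Qed.
Definition inr_lin X Y : {linear Y -> (X * Y)%type} :=
  mklin (@inr_linear X Y).
Fact fst_linear X Y : linear (fun u : X * Y => u.1).
Proof.
by [].
Qed.
Definition fst_lin X Y : {linear (X * Y)%type -> X} :=
  mklin (@fst_linear X Y).
Fact snd_linear X Y : linear (fun u : X * Y => u.2).
Proof.
by [].
Qed.
Definition snd_lin X Y : {linear (X * Y)%type -> Y} :=
  mklin (@snd_linear X Y).

Definition pi_lin M (N : submodClosed M) : {linear M -> quotm N} := @quotm_pi S M N.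
Lemma pi_surj M (N : submodClosed M) : is_surj (pi_lin N).
Proof. by move=> u; have [x ->] := quotm_ex u; exists x. Qed.
Lemma pi_eq0 M (N : submodClosed M) x : pi_lin N x = 0 <-> x \in N.
Proof.
rewrite -[X in X \in N]subr0 -quotm_pi_eq.
by rewrite -/(pi_lin N x) -/(pi_lin N 0) linear0.
Qed.

Definition in_mspan M (A : M -> Prop) (x : M) :=
  forall L : submodClosed M, (forall y, A y -> y \in L) -> x \in L.
Fact mspan0 M (A : M -> Prop) : in_mspan A 0.
Proof. by move=> L _; rewrite rpred0. Qed.
Fact mspanL M (A : M -> Prop) a x y :
  in_mspan A x -> in_mspan A y -> in_mspan A (a *: x + y).
Proof. by move=> hx hy L AL; rewrite rpredD ?rpredZ ?hx ?hy. Qed.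
Definition mspan M (A : M -> Prop) : submodClosed M := mksub (@mspan0 M A) (@mspanL M A).
Lemma mspan_sub M (A : M -> Prop) (L : submodClosed M) :
  (forall y, A y -> y \in L) -> {subset mspan A <= L}.
Proof. by move=> AL x /mksubP; apply. Qed.
Lemma mspan_mem M (A : M -> Prop) x : A x -> x \in mspan A.
Proof. by move=> Ax; apply/mksubP => L; apply. Qed.

Fact comb_linear M n (g : 'I_n -> M) : linear (fun v : 'rV[S]_n => \sum_i v 0 i *: g i).
Proof.
move=> a x y; rewrite scaler_sumr -big_split; apply: eq_bigr => i _.
  by rewrite !mxE scalerDl scalerA.
Qed.
(** The linear map with prescribed values on the unit vectors; all finite
    linear combinations below are written with it. *)
Definition comb M n (g : 'I_n -> M) : {linear 'rV[S]_n -> M} :=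
  mklin (comb_linear g).
Arguments comb : simpl never.
Lemma combE M n (g : 'I_n -> M) v : comb g v = \sum_i v 0 i *: g i.
Proof. by []. Qed.

Lemma comb_delta M n (g : 'I_n -> M) i : comb g (delta_mx 0 i) = g i.
Proof.
rewrite combE (bigD1 i) //= mxE !eqxx scale1r big1 ?addr0 // => j /negbTE ji.
by rewrite mxE ji andbF scale0r.
Qed.

Lemma lin_rV M n (f : {linear 'rV[S]_n -> M}) v :
  f v = \sum_i v 0 i *: f (delta_mx 0 i).
Proof.
rewrite {1}[v]row_sum_delta linear_sum; apply: eq_bigr => i _.
by rewrite linearZ.
Qed.

Lemma rV_ext M n (f g : {linear 'rV[S]_n -> M}) :
  (forall i, f (delta_mx 0 i) = g (delta_mx 0 i)) -> forall v, f v = g v.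
Proof. by move=> fg v; rewrite !lin_rV; apply: eq_bigr => i _; rewrite fg. Qed.

Lemma fin_gen_surj M : fin_gen M <-> exists n (f : {linear 'rV[S]_n -> M}), is_surj f.
Proof.
split=> [[n [g gP]]|[n [f fs]]].
  exists n, (comb g) => x; have [c ->] := gP x.
  exists (\row_i c i); rewrite combE; apply: eq_bigr => i _; by rewrite mxE.
exists n, (fun i => f (delta_mx 0 i)) => x; have [v <-] := fs x.
by exists (fun i => v 0 i); rewrite -lin_rV.
Qed.

Section Free.
Variable K : choiceType.
Fact flift_linear M (f : K -> M) : linear (fglift f : {freeg K / S} -> M).
Proof.
  have addB := lift_is_additive f.
  pose fA := GRing.isZmodMorphism.Build _ _ (fglift f) addB.
  pose h : {additive {freeg K / S} -> M} := HB.pack (fglift f) fA.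
  have -> : fglift f = h by [].
  move=> a D1 D2.
  rewrite raddfD; congr (_ + _).
  have -> : a *: D1 = \sum_(x <- dom D1) << a * coeff x D1 *g x >> by [].
  rewrite raddf_sum -[in RHS](freeg_sumE D1) raddf_sum scaler_sumr.
  by apply: eq_bigr => x _; rewrite /= !liftU scalerA.
Qed.
Definition flift M (f : K -> M) : {linear {freeg K / S} -> M} :=
  mklin (flift_linear f).
Arguments flift : simpl never.
Lemma fliftU M (f : K -> M) x : flift f << x >> = f x.
Proof. by rewrite [LHS]liftU scale1r. Qed.

Lemma freegZ (a : S) x : << a *g x >> = a *: << x >> :> {freeg K / S}.
Proof. by apply/eqP/freeg_eqP => y; rewrite coeffZ !coeffU mul1r. Qed.

Lemma freeE (D : {freeg K / S}) : D = \sum_(z <- dom D) coeff z D *: << z >>.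
Proof.
rewrite -[LHS]freeg_sumE; apply: eq_bigr => z _; exact: freegZ.
Qed.

Lemma free_ext M (f g : {linear {freeg K / S} -> M}) :
  (forall x, f << x >> = g << x >>) -> forall D, f D = g D.
Proof.
move=> fg D; rewrite (freeE D) !linear_sum; apply: eq_bigr => x _.
by rewrite !linearZ fg.
Qed.

Fact coeffl_linear (z : K) : linear (coeff z : {freeg K / S} -> S^o).
Proof.
by move=> a x y; rewrite coeffD coeffZ.
Qed.
Definition coeffl (z : K) : {linear {freeg K / S} -> S^o} :=
  mklin (coeffl_linear z).
Arguments coeffl : simpl never.

Lemma free_proj : projective_mod ({freeg K / S} : lmodType S).
Proof.
move=> M N g f gs; have /choice[h hE] : forall x, exists y, g y = f << x >>.
  by move=> x; exact: gs.
exists (flift h) => D.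
by apply: (free_ext (f := lcomp g (flift h))) => x; rewrite lcompE fliftU.
Qed.
End Free.

Lemma rV_proj n : projective_mod ('rV[S]_n : lmodType S).
Proof.
move=> M N g f gs; have /choice[h hE] : forall i, exists y, g y = f (delta_mx 0 i).
  by move=> x; exact: gs.
exists (comb h) => v.
apply: (rV_ext (f := lcomp g (comb h))) => i.
by rewrite lcompE comb_delta.
Qed.

Lemma proj_retract P Q (i : {linear P -> Q}) (r : {linear Q -> P}) :
  cancel i r -> projective_mod Q -> projective_mod P.
Proof.
move=> ir Qp M N g f gs.
have [h hE] := Qp _ _ g (lcomp f (r)) gs.
by exists (lcomp h i) => x; rewrite lcompE hE lcompE ir.
Qed.

Lemma proj_isom P Q : isom P Q -> projective_mod Q -> projective_mod P.
Proof. by move=> [f [g]]; move=> fK gK; case: (bij_inv (can_inj fK) (fun y => ex_intro _ (g y) (gK y))) => h [hK _]; apply: proj_retract hK. Qed.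

Lemma proj_section P M (g : {linear M -> P}) : projective_mod P -> is_surj g ->
  exists s : {linear P -> M}, cancel s g.
Proof. by move=> Pp gs; exact: (Pp _ _ g (idfun : {linear P -> P}) gs). Qed.

Lemma free_cover_surj M : is_surj (@free_cover S M : {linear _ -> _}).
Proof. by move=> x; exists << x >>; rewrite [LHS]liftU scale1r. Qed.

Definition dual_basis P := exists r (p : 'I_r -> P) (g : 'I_r -> {linear P -> S^o}),
  forall x, x = \sum_i (g i x : S) *: p i.

Fact coordl_linear n (i : 'I_n) : linear (fun v : 'rV[S]_n => v 0 i : S^o).
Proof.
by move=> a x y; rewrite !mxE.
Qed.
Definition coordl n (i : 'I_n) : {linear 'rV[S]_n -> S^o} :=
  mklin (coordl_linear i).
Arguments coordl : simpl never.

Lemma fgproj_dual_basis P : projective_mod P -> fin_gen P -> dual_basis P.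
Proof.
move=> Pp /fin_gen_surj[n [f fs]]; have [s sK] := proj_section Pp fs.
exists n, (fun i => f (delta_mx 0 i)), (fun i => lcomp (coordl i) s).
by move=> x; rewrite -{1}[x]sK lin_rV.
Qed.

End Linear.
Arguments sincl {S M N}.

(** * Lifting along chains; submodules of projective modules *)

Section ZornLift.
Variables (S : nzRingType) (U : Type) (X Y Z : lmodType S).
Variables (D : set U -> X -> Prop) (g : {linear Z -> Y}) (f : {linear X -> Y}).

(** Lifts of [f] along [g] defined on the part of [X] reached by the indices
    in [J].  They are total functions of which only the values on [D J] matter, so
    that partial maps with different domains live in one type. *)
Definition partial_lift (J : set U) (h : X -> Z) :=
  (forall a x y, D J x -> D J y -> h (a *: x + y) = a *: h x + h y) /\
  (forall x, D J x -> g (h x) = f x).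

Hypothesis D0 : forall x, D set0 x -> x = 0.
Hypothesis DL : forall J a x y, D J x -> D J y -> D J (a *: x + y).
Hypothesis D_mono : forall J J' x, (J `<=` J')%classic -> D J x -> D J' x.
Hypothesis D_cup : forall (F : set (set U)) x, (F !=set0)%classic ->
  (forall J J', F J -> F J' -> (J `<=` J' \/ J' `<=` J)%classic) ->
  D (\bigcup_(J in F) J)%classic x -> exists2 J, F J & D J x.
Hypothesis D_top : forall x, D setT x.
Hypothesis step : forall J u h, ~ J u -> partial_lift J h ->
  exists2 h', partial_lift (J `|` [set u])%classic h' &
    forall x, D J x -> h' x = h x.

(** Maximal partial lifts exist because [D] commutes with unions of chains,
    and by [step] they are defined everywhere.  The lemma serves two arguments:
    lifting from submodules of free modules, and testing injectivity on ideals. *)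
Lemma zorn_lift : exists h : {linear X -> Z}, forall x, g (h x) = f x.
Proof.
pose T := {p : set U * (X -> Z) | partial_lift p.1 p.2}.
pose le (p q : T) := ((sval p).1 `<=` (sval q).1)%classic /\
   forall x, D (sval p).1 x -> (sval q).2 x = (sval p).2 x.
have g0 : partial_lift set0 (fun=> 0).
  split=> [a x y _ _|x /D0 ->]; first by rewrite scaler0 addr0.
  by rewrite !linear0.
pose t0 : T := exist _ (set0, fun=> 0) g0.
have [| | |[[J h] Jh] Jmax] := ZL_preorder t0 (R := fun p q => `[< le p q >]).
- by move=> p; apply/asboolP; split=> //.
- move=> q p r /asboolP[pq1 pq2] /asboolP[qr1 qr2]; apply/asboolP; split.
    exact: subset_trans pq1 qr1.
  by move=> x px; rewrite qr2 ?pq2 //; apply: D_mono px.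
- move=> A Atot.
  have [[q0 Aq0]|A0] := pselect (exists q, A q); last first.
    by exists t0 => s As; case: A0; exists s.
  pose F : set (set U) := [set J | exists2 q : T, A q & (sval q).1 = J]%classic.
  pose Js := (\bigcup_(J in F) J)%classic.
  have cupx x : D Js x -> exists2 q, A q & D (sval q).1 x.
    move=> /D_cup[||J [q Aq <-] qx]; [| |by exists q].
      by exists (sval q0).1, q0.
    move=> J J' [q Aq <-] [q' Aq' <-].
    by have [/asboolP[]|/asboolP[]] := Atot _ _ Aq Aq'; [left|right].
  pose hs x := if pselect (exists2 q, A q & D (sval q).1 x) is left e
               then (sval (projT1 (cid2 e))).2 x else 0.
  have hsE q x : A q -> D (sval q).1 x -> hs x = (sval q).2 x.
    move=> Aq qx; rewrite /hs; case: pselect => [e|[]]; last by exists q.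
    case: cid2 => q' Aq' q'x /=.
    have [/asboolP[_ ->]|/asboolP[_ ->]] // := Atot _ _ Aq Aq'.
  have gs : partial_lift Js hs.
    split=> [a x y /cupx[q Aq qx] /cupx[q' Aq' q'y]|x /cupx[q Aq qx]]; last first.
      by rewrite (hsE q) //; case: (svalP q) => _; apply.
    wlog: q q' Aq Aq' qx q'y / le q q' => [H|[le1 _]].
      have [/asboolP H1|/asboolP [H1 _]] := Atot _ _ Aq Aq'; first exact: H Aq Aq' _ _ _.
      have q'y' := D_mono H1 q'y.
      rewrite !(hsE q) //; last exact: (DL).
      by case: (svalP q) => + _; apply.
    have qx' := D_mono le1 qx.
    rewrite !(hsE q') //; last exact: (DL).
    by case: (svalP q') => + _; apply.
  exists (exist _ (Js, hs) gs : T) => q Aq; apply/asboolP; split=> /=.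
    by move=> u qu; exists (sval q).1 => //; exists q.
  by move=> x qx; rewrite (hsE q).
have JT : J = setT.
  apply/seteqP; split=> // u _; apply: contrapT => Ju.
  have [h' h'g h'E] := step Ju Jh.
  pose s1 : T := exist _ ((J `|` [set u])%classic, h') h'g.
  have le1 : `[< le (exist _ (J, h) Jh) s1 >].
    by apply/asboolP; split=> //=; exact: subsetUl.
  have /asboolP[/(_ u) H _] := Jmax s1 le1.
  by apply: Ju; apply: H; right.
case: {Jmax} Jh => /=; rewrite JT => hl hg.
have lh : linear h by move=> a x y; exact: hl.
by exists (mklin lh) => x; exact: hg.
Qed.
End ZornLift.

Section Hereditary.
Variable S : nzRingType.
Hypothesis hered : left_hereditary S.

(** Kaplansky's argument, with the well-ordering of the basis replaced by
    Zorn's lemma.  When a basis element [u] is added, the elements of [N]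
    supported on [J] and [u] are those supported on [J] plus a copy of the left
    ideal of their coefficients at [u]; that ideal is projective. *)
Lemma submod_free_proj (K : choiceType) (N : submodClosed ({freeg K / S} : lmodType S)) :
  projective_mod (submod N).
Proof.
move=> Z Y g f gs.
pose X : lmodType S := submod N.
pose D (J : set K) (x : X) := forall b, ~ J b -> coeff b (sincl x) = 0.
have DL J a x y : D J x -> D J y -> D J (a *: x + y).
  by move=> Dx Dy b Jb; rewrite linearP coeffD coeffZ Dx // Dy // mulr0 addr0.
have D0 J : D J 0 by move=> b _; rewrite linear0 coeff0.
apply: (zorn_lift (D := D)) => //.
- move=> x Dx; apply: sincl_inj; apply/eqP/freeg_eqP => b.
  by rewrite linear0 coeff0 Dx.
- by move=> J J' x JJ' Dx b J'b; apply: Dx => /JJ'.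
- move=> F x [J0 FJ0] Ftot Dx.
  suff [J FJ dJ] : exists2 J, F J & forall b, b \in dom (sincl x) -> J b.
    exists J => // b Jb; apply: contrapT => /eqP; rewrite -mem_dom => /dJ; exact.
  have : forall b, b \in dom (sincl x) -> exists2 J, F J & J b.
    move=> b; rewrite mem_dom => xb; apply: contrapT => nJ; case/negP: xb.
    by apply/eqP/Dx => -[J FJ Jb]; apply: nJ; exists J.
  elim: (dom _) => [|b s IH] sF; first by exists J0.
  have [|J FJ Js] := IH; first by move=> b' b's; apply: sF; rewrite inE b's orbT.
  have [|J' FJ' J'b] := sF b; first by rewrite inE eqxx.
  have [H|H] := Ftot _ _ FJ FJ'; [exists J'|exists J] => // c; rewrite inE.
    by case/orP=> [/eqP->//|/Js/H].
  by case/orP=> [/eqP->|/Js//]; exact: H.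
- by move=> x b [].
move=> J u h Ju [hl hg].
pose Ju' := (J `|` [set u])%classic.
pose Xu := mksub (D0 Ju') (@DL Ju').
(* the ideal of coefficients at [u] *)
pose A s := exists2 x : X, D Ju' x & coeff u (sincl x) = s.
have A0 : A 0 by exists 0; rewrite ?linear0 ?coeff0.
have AL (a s t : S) : A s -> A t -> A (a * s + t).
  move=> [x Dx <-] [y Dy <-]; exists (a *: x + y); first exact: (DL).
  by rewrite linearP coeffD coeffZ.
pose I : submodClosed (S^o : lmodType S) := @mksub S S^o A A0 AL.
pose q := lcomp (coeffl S u) (lcomp (@sincl _ _ N) (@sincl _ X Xu)).
have qI x : exists m : submod I, sincl m = q x.
  apply: sincl_ex; apply/(@mksubP S S^o A A0 AL); exists (sincl x) => //.
  by have /mksubP := sinclP x.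
have [c cE] := factor_inj (@sincl_inj _ _ I) qI.
have cs : is_surj c.
  move=> s; have /(@mksubP S S^o A A0 AL)[x Dx xs] := sinclP s.
  have [x' x'E] : exists x' : submod Xu, sincl x' = x by apply: sincl_ex; apply/mksubP.
  by exists x'; apply: sincl_inj; rewrite cE !lcompE x'E.
have [sg sgK] := proj_section (@hered I) cs.
have [la laE] := @hered I _ _ g (lcomp f (lcomp (@sincl _ X Xu) sg)) gs.
pose h' (x : X) := if pselect (D Ju' x) is left p then
   let v : submod Xu := Sub x (introT (mksubP _ _ _) p) in
   h (x - sincl (sg (c v))) + la (c v) else 0.
have h'E (v : submod Xu) : h' (sincl v) = h (sincl v - sincl (sg (c v))) + la (c v).
  rewrite /h'; case: pselect => [p|[]]; last by have /mksubP := sinclP v.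
  by have -> : Sub (sincl v) (introT (mksubP (D0 Ju') (DL Ju') (sincl v)) p) = v :> submod Xu
    by apply: sincl_inj.
have cu (v : submod Xu) : sincl (c v) = coeff u (sincl (sincl v)) by rewrite cE.
have DJ (v : submod Xu) : D J (sincl v - sincl (sg (c v))).
  move=> b Jb; rewrite linearB coeffB.
  have [->|/eqP bu] := eqVneq b u; first by rewrite -!cu sgK subrr.
  have Db (w : submod Xu) : coeff b (sincl (sincl w)) = 0.
    by have /mksubP := sinclP w; apply; case.
  by rewrite !Db subr0.
exists h'.
  split=> [a x y Dx Dy|x Dx].
    have [vx <-] : exists v : submod Xu, sincl v = x by apply/sincl_ex/mksubP.
    have [vy <-] : exists v : submod Xu, sincl v = y by apply/sincl_ex/mksubP.
    rewrite -linearP !h'E (linearP c) (linearP sg) (linearP la) !(linearP (@sincl _ X Xu)).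
    rewrite opprD addrACA -scalerBr hl //.
    by rewrite scalerDr addrACA.
  have [v <-] : exists v : submod Xu, sincl v = x by apply/sincl_ex/mksubP.
  by rewrite h'E linearD hg // laE !lcompE -linearD subrK.
move=> x Dx.
have Dx' : D Ju' x by move=> b Jb; apply: Dx => Jb'; apply: Jb; left.
have [v vx] : exists v : submod Xu, sincl v = x by apply/sincl_ex/mksubP.
have cv0 : c v = 0 by apply: sincl_inj; rewrite linear0 cu vx Dx.
by rewrite -vx h'E cv0 !linear0 !addr0.
Qed.

Lemma submod_proj (P : lmodType S) (N : submodClosed P) :
  projective_mod P -> projective_mod (submod N).
Proof.
move=> Pp.
have [s sK] := proj_section Pp (@free_cover_surj S P).
pose i := lcomp s (@sincl _ _ N).
have ii : injective i by apply: inj_comp (can_inj sK) (@sincl_inj _ _ N).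
apply: (proj_isom (Q := submod (imm i))); last exact: submod_free_proj.
apply: (isom_of (f := toimm i)); last exact: toimm_surj.
by move=> x y /(congr1 sincl); rewrite !toimmE => /ii.
Qed.
End Hereditary.

(** * Vanishing of Ext *)

Section ExtVanish.
Variable S : nzRingType.
Implicit Types M N P Q X Y Z : lmodType S.

Definition short_exact M Z Y (i : {linear M -> Z}) (g : {linear Z -> Y}) :=
  [/\ injective i, is_surj g & forall z, g z = 0 <-> exists m, i m = z].

(** Vanishing of [Ext^1(X, M)]: a map from [X] to [Y] lifts to [Z] when the
    pullback of the extension along it splits, and conversely every extension of
    [X] by [M] is a case of this with [Y = X]. *)
Definition ext0 X M := forall Z Y (i : {linear M -> Z}) (g : {linear Z -> Y}),
  short_exact i g -> forall f : {linear X -> Y},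
  exists h : {linear X -> Z}, forall x, g (h x) = f x.

(** For a projective presentation [d] of [X], this says that the cokernel of
    [Hom(P0, M) -> Hom(P1, M)], that is [Ext^1(X, M)], is zero. *)
Definition extends P1 P0 (d : {linear P1 -> P0}) M :=
  forall v : {linear P1 -> M}, exists u : {linear P0 -> M}, forall x, u (d x) = v x.

Lemma pushout P1 P0 X (d : {linear P1 -> P0}) (e : {linear P0 -> X}) M
    (v : {linear P1 -> M}) : short_exact d e ->
  exists (Z : lmodType S) (i : {linear M -> Z}) (w : {linear P0 -> Z}) (g : {linear Z -> X}),
    [/\ short_exact i g, forall x, i (v x) = w (d x) & forall x, g (w x) = e x].
Proof.
move=> [di es ex]; pose h (x : P1) : (M * P0)%type := (v x, - d x).
have hl : linear h.
  move=> a x y; rewrite /h (linearP v) (linearP d); apply: injective_projections => //=.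
  by rewrite scalerN opprD.
pose L := imm (mklin hl).
pose i := lcomp (pi_lin L) (inl_lin M P0); pose w := lcomp (pi_lin L) (inr_lin M P0).
have [g gE] : exists g : {linear quotm L -> X},
    forall u, g (pi_lin L u) = lcomp e (snd_lin M P0) u.
  apply: factor_surj; first exact: pi_surj.
  move=> u /pi_eq0/immP[x <-]; rewrite lcompE /= linearN.
  by have /ex -> : exists y, d y = d x; [exists x | rewrite oppr0].
have iv x : i (v x) = w (d x).
  apply/eqP; rewrite -subr_eq0 !lcompE -linearB; apply/eqP/pi_eq0/immP; exists x.
  by apply: injective_projections; rewrite /= ?subr0 ?sub0r.
have gw x : g (w x) = e x by rewrite gE.
exists (quotm L), i, w, g; split=> //; split.
- apply: lin_inj0 => m; rewrite lcompE => /pi_eq0/immP[x [vx dx]].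
  rewrite -vx; have -> : x = 0; last by rewrite linear0.
  by apply: di; rewrite linear0; apply/eqP; rewrite -oppr_eq0; apply/eqP.
- by move=> x; have [q <-] := es x; exists (w q).
move=> z; split=> [|[m <-]]; last by rewrite [i m]lcompE gE lcompE linear0.
have [[m q] <-] := pi_surj z; rewrite gE => /ex[y yq].
exists (m + v y); rewrite linearD iv yq !lcompE -linearD; congr (pi_lin L _).
by apply: injective_projections; rewrite /= ?addr0 ?add0r.
Qed.

Lemma ext0_extends P1 P0 X (d : {linear P1 -> P0}) (e : {linear P0 -> X}) M :
  short_exact d e -> ext0 X M -> extends d M.
Proof.
move=> se XM v; have [Z [i [w [g [[ii gs gex] iv gw]]]]] := pushout v se.
have [s sK] := XM _ _ i g (And3 ii gs gex) (idfun : {linear X -> X}).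
have [r rE] : exists r : {linear P0 -> M}, forall x, i (r x) = (w \- lcomp s e) x.
  by apply: factor_inj => // x; apply/gex; rewrite /= linearB sK gw subrr.
exists r => x; apply: ii; rewrite rE /= iv.
have [_ _ ex] := se; have -> : e (d x) = 0 by apply/ex; exists x.
by rewrite linear0 subr0.
Qed.

Lemma extends_ext0 P1 P0 X (d : {linear P1 -> P0}) (e : {linear P0 -> X}) M :
  projective_mod P0 -> short_exact d e -> extends d M -> ext0 X M.
Proof.
move=> P0p [di es ex] dM Z Y i g [ii gs gex] f.
have [f0 f0E] := P0p _ _ g (lcomp f e) gs.
have [v vE] : exists v : {linear P1 -> M}, forall x, i (v x) = lcomp f0 d x.
  apply: factor_inj => // x; apply/gex; rewrite lcompE f0E lcompE.
  by rewrite (_ : e (d x) = 0) ?linear0 //; apply/ex; exists x.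
have [u uE] := dM v.
pose w := f0 \- lcomp i u : {linear P0 -> Z}.
have [h hE] : exists h : {linear X -> Z}, forall p, h (e p) = w p.
  apply: factor_surj => // p /ex[x <-].
  by rewrite /w /= uE vE ?lcompE subrr.
exists h => x; have [p <-] := es x; rewrite hE /w /= linearB f0E ?lcompE.
have -> : g (i (u p)) = 0 by apply/gex; exists (u p).
by rewrite subr0.
Qed.

Lemma ext0_isom X M M' : isom M M' -> ext0 X M -> ext0 X M'.
Proof.
move=> [f fb] XM Z Y i g [ii gs gex] h.
apply: (XM Z Y (lcomp i f) g) => //; split=> //.
  exact: inj_comp ii (bij_inj fb).
move=> z; rewrite gex; split=> [[m <-]|[m <-]]; last by exists (f m).
by have [m' <-] := bij_surj fb m; exists m'.
Qed.
Lemma proj_ext0 P M : projective_mod P -> ext0 P M.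
Proof. by move=> Pp Z Y i g [_ gs _] f; apply: Pp. Qed.
Lemma ext0_split X M Z (i : {linear M -> Z}) (g : {linear Z -> X}) :
  short_exact i g -> ext0 X M -> exists s : {linear X -> Z}, cancel s g.
Proof. by move=> se XM; exact: (XM _ _ i g se (idfun : {linear X -> X})). Qed.

Lemma kerm_short_exact P X (e : {linear P -> X}) :
  is_surj e -> short_exact (@sincl _ _ (kerm e)) e.
Proof.
move=> es; split; [exact: sincl_inj|exact: es|move=> z]; split=> [ez|[m <-]].
  by have [|u uz] := @sincl_ex _ _ (kerm e) z; [exact/eqP | exists u].
by have /eqP := sinclP m.
Qed.

Lemma quotm_short_exact Z (L : submodClosed Z) :
  short_exact (@sincl _ _ L) (pi_lin L).
Proof.
split; [exact: sincl_inj|exact: pi_surj|] => z; rewrite pi_eq0.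
by split=> [/sincl_ex//|[m <-]]; exact: sinclP.
Qed.

Section Hered.
Hypothesis hered : left_hereditary S.

Lemma free_pres X : exists (P1 P0 : lmodType S) (d : {linear P1 -> P0})
  (e : {linear P0 -> X}), [/\ projective_mod P1, projective_mod P0 & short_exact d e].
Proof.
pose e : {linear {freeg X / S} -> X} := @free_cover S X.
exists (submod (kerm e)), {freeg X / S}, (@sincl _ _ (kerm e)), e; split.
- exact: submod_free_proj.
- exact: free_proj.
- exact/kerm_short_exact/free_cover_surj.
Qed.

(** [Ext^1(X, -)] is right exact when the first syzygy is projective. *)
Lemma extends_surj P1 P0 (d : {linear P1 -> P0}) M N (q : {linear M -> N}) :
  projective_mod P1 -> is_surj q -> extends d M -> extends d N.
Proof.
move=> P1p qs dM v; have [w wE] := P1p _ _ q v qs.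
have [u uE] := dM w; exists (lcomp q u) => x.
by rewrite lcompE uE wE.
Qed.

Lemma ext0_surj X M N (q : {linear M -> N}) : is_surj q -> ext0 X M -> ext0 X N.
Proof.
move=> qs XM; have [P1 [P0 [d [e [P1p P0p se]]]]] := free_pres X.
apply: (extends_ext0 P0p se); apply: (extends_surj P1p qs).
exact: ext0_extends se XM.
Qed.

(** [Ext^1(-, M)] turns injections into surjections when [Ext^2] vanishes.  In
    terms of presentations: the preimage of [X'] in the free cover of [X] is
    projective, and it has the same kernel over [X'] as the cover over [X]. *)
Lemma ext0_sub X X' M (j : {linear X' -> X}) : injective j -> ext0 X M -> ext0 X' M.
Proof.
move=> ji XM.
pose e : {linear {freeg X / S} -> X} := @free_cover S X.
have es : is_surj e := @free_cover_surj _ _.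
pose F' := mpreim e (imm j).
have e'im (x : submod F') : exists m, j m = lcomp e (@sincl _ _ F') x.
  by have := sinclP x; rewrite mpreimP => /immP.
have [e' e'E] := factor_inj ji e'im.
have ses := kerm_short_exact es.
have KF' (x : submod (kerm e)) : exists m : submod F', sincl m = sincl x.
  apply: sincl_ex; rewrite mpreimP (_ : e (sincl x) = 0) ?rpred0 //.
  exact/eqP/(sinclP x).
have [d' d'E] := factor_inj (@sincl_inj _ _ F') KF'.
apply: (extends_ext0 (P1 := submod (kerm e)) (d := d') (e := e')).
- exact: submod_free_proj.
- split.
  + by move=> x y /(congr1 sincl); rewrite !d'E => /sincl_inj.
  + move=> x; have [D De] := es (j x).
    have [D' D'E] : exists D' : submod F', sincl D' = D.
      by apply: sincl_ex; rewrite mpreimP De imm_f.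
    by exists D'; apply: ji; rewrite e'E lcompE D'E.
  move=> z; split=> [ez|[m <-]].
    have ez0 : e (sincl z) = 0 by have := e'E z; rewrite ez linear0 lcompE.
    have [|m mE] := @sincl_ex _ _ (kerm e) (sincl z); first exact/eqP.
    by exists m; apply: sincl_inj; rewrite d'E.
  apply: ji; rewrite linear0 e'E lcompE d'E; exact/eqP/(sinclP m).
move=> v; have [u uE] := ext0_extends ses XM v.
exists (lcomp u (@sincl _ _ F')) => x.
by rewrite lcompE d'E uE.
Qed.
End Hered.

(** Baer's test: every map from a left ideal is a right multiplication. *)
Definition ideal_test Q := forall (I : submodClosed (S^o : lmodType S))
  (f : {linear submod I -> Q}), exists q : Q, forall s, f s = (sincl s : S) *: q.

End ExtVanish.

(** [Ext1] is computed from the free presentation by [free_cover], for which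
    its vanishing is literally [extends]. *)
Lemma BaerP (k : comNzRingType) (S : algType k) (t : lmodType S -> Prop) (M : lmodType S) :
  Baer t M <-> forall T, Gen t T -> ext0 M T.
Proof.
pose e : {linear {freeg M / S} -> M} := @free_cover S M.
pose d : {linear syzygy M -> {freeg M / S}} := @sincl _ _ (kerm e).
have ses : short_exact d e := kerm_short_exact (@free_cover_surj _ _).
split=> B T tT; last first.
  move=> c; have [f ->] := quotm_ex c.
  apply/pi_eq0/asboolP.
  have /asboolP lf := valP f.
  pose v : {linear syzygy M -> T} := @mklin S (syzygy M) T (\val f) lf.
  have [u uE] := @ext0_extends S (syzygy M) _ M d e T ses (B T tT) v.
  by exists u => z; rewrite -[LHS]/(v z) -uE.
apply: (@extends_ext0 S (syzygy M) _ M d e T _ ses); first exact: free_proj.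
move=> v; have vl : (v : syzygy M -> resk T) \in @homb k S (syzygy M) T.
  by apply/asboolP; exact: linearP.
have /(@pi_eq0 _ _ _)/asboolP[g gE] := B T tT (pi_lin _ (Sub (v : syzygy M -> resk T) vl)).
by exists g => z; rewrite -gE.
Qed.

(** * Injective modules *)

Section BaerCriterion.
Variable S : nzRingType.
Implicit Types M N Q X Y Z : lmodType S.

(** Injectivity as vanishing of [Ext^1(-, Q)].  Unlike [injective_mod] it is
    stated in the vocabulary of lifts, in which it is inherited by quotients over
    a hereditary ring ([ext0_surj]). *)
Definition ext_injective Q := forall X, ext0 X Q.

(** A partial lift defined on the span of [J] extends to [u] by choosing the
    value at [u]: any preimage [z0] of [f u] is off by a map from the ideal
    [{s | s u in span J}] to [Q], and the test corrects it. *)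
Lemma baer_criterion Q : ideal_test Q -> ext_injective Q.
Proof.
move=> Qt X Z Y i g [ii gs gex] f.
pose D (J : set X) x := x \in mspan J.
apply: (zorn_lift (D := D)).
- by move=> x /(@mspan_sub _ _ _ (zerom X) (fun y (Hy : set0 y) => False_ind _ Hy))/eqP.
- by move=> J a x y Dx Dy; rewrite /D rpredD ?rpredZ.
- by move=> J J' x JJ'; apply: mspan_sub => y /JJ'; exact: mspan_mem.
- move=> F x [J0 FJ0] Ftot Dx.
  pose A (x : X) := exists2 J, F J & D J x.
  have A0 : A 0 by exists J0; rewrite // /D rpred0.
  have AL a y z : A y -> A z -> A (a *: y + z).
    have mono J J' w : (J `<=` J')%classic -> D J w -> D J' w.
      by move=> JJ'; apply: mspan_sub => v /JJ'; exact: mspan_mem.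
    move=> [J FJ Jy] [J' FJ' J'z]; have [H|H] := Ftot _ _ FJ FJ'.
      by exists J'; rewrite // /D rpredD ?rpredZ //; exact: mono Jy.
    by exists J; rewrite // /D rpredD ?rpredZ //; exact: mono J'z.
  have /mksubP // : x \in mksub A0 AL.
  apply: mspan_sub Dx => y [J FJ Jy]; apply/mksubP; exists J => //; exact: mspan_mem.
- by move=> x; apply: mspan_mem.
move=> J u h Ju [hl hg].
have [z0 z0u] := gs (f u).
pose A (s : S) := s *: u \in mspan J.
have A0 : A 0 by rewrite /A scale0r rpred0.
have AL (a s t : S) : A s -> A t -> A (a * s + t).
  by move=> As At; rewrite /A scalerDl -scalerA rpredD ?(rpredZ a As).
pose I : submodClosed (S^o : lmodType S) := @mksub S S^o A A0 AL.
have IP (s : submod I) : (sincl s : S) *: u \in mspan J.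
  by have /(@mksubP S S^o A A0 AL) := sinclP s.
have h0 : h 0 = 0.
  have := hl 1 0 0 (rpred0 _) (rpred0 _); rewrite !scale1r addr0 => /esym/eqP.
  by rewrite -subr_eq0 addrK => /eqP.
pose w (s : submod I) : Z := h ((sincl s : S) *: u) - (sincl s : S) *: z0.
have wl : linear w.
  move=> a s t; rewrite /w (linearP (@sincl _ _ I)) !scalerDl.
  rewrite -[(a *: sincl s) *: u]scalerA -[(a *: sincl s) *: z0]scalerA hl; [|exact: IP s|exact: IP t].
  by rewrite opprD addrACA scalerBr.
have [ph phE] : exists ph : {linear submod I -> Q}, forall s, i (ph s) = w s.
  apply: (factor_inj (f := mklin wl)) ii _ => s; apply/gex.
  rewrite mklinE /w linearB hg; last exact: IP.
  by rewrite (linearZ_LR g) (linearZ_LR f) z0u subrr.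
have [q qE] := Qt I ph; have [z1 z1E] : exists z1, z1 = z0 + i q by exists (z0 + i q).
pose dec x (ys : X * S) := ys.1 \in mspan J /\ x = ys.1 + ys.2 *: u.
have decP x : D (J `|` [set u])%classic x -> exists ys, dec x ys.
  pose B x := exists ys, dec x ys.
  have B0 : B 0 by exists (0, 0); split; rewrite ?rpred0 // scale0r addr0.
  have BL a y z : B y -> B z -> B (a *: y + z).
    move=> [[y1 s] [/= y1J ->]] [[z1' t] [/= z1J ->]].
    exists (a *: y1 + z1', a * s + t); split=> /=; first by rewrite rpredD ?rpredZ.
    by rewrite scalerDr scalerA addrACA -scalerDl.
  suff: {subset mspan (J `|` [set u])%classic <= mksub B0 BL} by move=> H /H/mksubP.
  apply: mspan_sub => y [Jy|->]; apply/mksubP.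
    by exists (y, 0); split; rewrite ?mspan_mem //= scale0r addr0.
  by exists (0, 1); split; rewrite ?rpred0 //= scale1r add0r.
(* the value does not depend on the decomposition, by [hs] below *)
pose h' x := if pselect (exists ys, dec x ys) is left e then
  let ys := projT1 (cid e) in h ys.1 + ys.2 *: z1 else 0.
have h'E x y s : y \in mspan J -> x = y + s *: u -> h' x = h y + s *: z1.
  move=> yJ xE; rewrite /h'; case: pselect => [e|[]]; last by exists (y, s).
  case: cid => -[y' s'] [/= y'J xE'].
  have E : y' - y = (s - s') *: u.
    apply/eqP; rewrite scalerBl subr_eq addrAC eq_sym subr_eq -xE'.
    by rewrite addrC -xE.
  have As : A (s - s') by rewrite /A -E submodB.
  have [st stE] : exists st : submod I, sincl st = s - s'.
    by apply: sincl_ex; apply/(@mksubP S S^o A A0 AL).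
  have hs : h ((s - s') *: u) = (s - s') *: z1.
    have := phE st; rewrite qE /w stE (linearZ_LR i) => /eqP; rewrite eq_sym subr_eq => /eqP ->.
    by rewrite z1E [RHS]scalerDr addrC.
  have -> : y' = 1 *: (y' - y) + y by rewrite scale1r subrK.
  rewrite hl //; last exact: submodB.
  rewrite scale1r E hs addrAC -scalerDl.
  by rewrite subrK addrC.
exists h'.
  split=> [a x y /decP[[x1 s] [/= x1J xE]] /decP[[y1 t] [/= y1J yE]]|x /decP[[x1 s] [/= x1J xE]]].
    rewrite (h'E x x1 s) // (h'E y y1 t) // (h'E _ (a *: x1 + y1) (a * s + t)).
    - by rewrite hl // scalerDr scalerDl scalerA addrACA.
    - by rewrite rpredD ?rpredZ.
    by rewrite xE yE scalerDr scalerDl scalerA addrACA.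
  rewrite (h'E x x1 s) // linearD (linearZ_LR g) hg // z1E linearD z0u.
  have -> : g (i q) = 0 by apply/gex; exists q.
  by rewrite addr0 xE linearD (linearZ_LR f).
move=> x xJ; rewrite (h'E x x 0) //; first by rewrite scale0r addr0.
by rewrite scale0r addr0.
Qed.

Lemma ext_injective_ideal_test Q : ext_injective Q -> ideal_test Q.
Proof.
move=> Qi I f.
have [u uE] := ext0_extends (quotm_short_exact I) (Qi _) f.
exists (u 1) => s; rewrite -uE -linearZ_LR; congr (u _).
by rewrite [RHS]/GRing.scale /= mulr1.
Qed.

Lemma ext_injective_mod Q : ext_injective Q -> injective_mod Q.
Proof.
move=> Qi M N g f gi.
have se : short_exact g (pi_lin (imm g)).
  split=> //; first exact: pi_surj.
  by move=> z; rewrite pi_eq0; split=> [/immP//|H]; exact/immP.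
exact: ext0_extends se (Qi _) f.
Qed.

Lemma ext_injective_isom Q Q' : isom Q Q' -> ext_injective Q -> ext_injective Q'.
Proof. by move=> QQ' Qi X; exact: ext0_isom QQ' (Qi X). Qed.

End BaerCriterion.

(** * Length *)

Section Length.
Variable S : nzRingType.
Implicit Types M N : lmodType S.

Definition jump M (C : nat -> submodClosed M) i : bool :=
  `[< exists2 x, x \in C i.+1 & x \notin C i >].

(** Length at most [n], as a bound on the number of strict steps of ascending
    chains.  With this form the additivity needed below ([lenle_exact]) is a
    comparison of steps, and composition series never have to be refined. *)
Definition lenle n M := forall C : nat -> submodClosed M,
  (forall i, {subset C i <= C i.+1}) -> forall L, (\sum_(i < L) jump C i <= n)%N.

Definition finlen M := exists n, lenle n M.

Lemma lenle_leq m n M : (m <= n)%N -> lenle m M -> lenle n M.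
Proof. by move=> mn Mm C Cm L; apply: leq_trans mn; apply: Mm. Qed.

Lemma lenle_triv M : trivialm M -> lenle 0 M.
Proof.
move=> M0 C Cm L; rewrite leqn0 sum_nat_eq0; apply/forallP => i.
rewrite implyTb eqb0; apply/negP => /asboolP[x _]; rewrite (M0 x) rpred0 //.
Qed.

Definition pushm M N (g : {linear M -> N}) (L : submodClosed M) : submodClosed N :=
  imm (lcomp g (@sincl _ _ L)).
Lemma pushmP M N (g : {linear M -> N}) (L : submodClosed M) y :
  reflect (exists2 x, x \in L & g x = y) (y \in pushm g L).
Proof.
apply: (iffP (immP _ _)) => [[u <-]|[x /sincl_ex[u <-] <-]].
  by exists (sincl u) => //; exact: sinclP.
by exists u.
Qed.

(** A strict step of a chain in [M] is strict in the image in [M''] or in the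
    preimage in [M']. *)
Lemma lenle_exact a b M' M M'' (f : {linear M' -> M}) (g : {linear M -> M''}) :
  (forall x, g x = 0 -> exists y, f y = x) ->
  lenle a M' -> lenle b M'' -> lenle (a + b) M.
Proof.
move=> ex Ma Mb C Cm L.
pose C' i := mpreim f (C i); pose C'' i := pushm g (C i).
have C'm i : {subset C' i <= C' i.+1} by move=> x; rewrite !mpreimP; exact: Cm.
have C''m i : {subset C'' i <= C'' i.+1}.
  by move=> y /pushmP[x xC <-]; apply/pushmP; exists x => //; exact: Cm.
apply: leq_trans (leq_add (Ma C' C'm L) (Mb C'' C''m L)).
rewrite -big_split /=; apply: leq_sum => i _.
case H: (jump C i) => //; move/asboolP: H => [x xC xnC].
case: (boolP (g x \in C'' i)) => [/pushmP[c cC gc]|gx]; last first.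
  have -> : jump C'' i; last by rewrite addn1.
  by apply/asboolP; exists (g x) => //; apply/pushmP; exists x.
have [y yE] : exists y, f y = x - c by apply: ex; rewrite linearB gc subrr.
have -> // : jump C' i; apply/asboolP; exists y; rewrite mpreimP yE.
  by apply: submodB => //; exact: Cm.
apply: contra xnC => xc; have -> : x = x - c + c by rewrite subrK.
by rewrite rpredD.
Qed.

Lemma lenle_inj n M N (f : {linear M -> N}) : injective f -> lenle n N -> lenle n M.
Proof.
move=> fi Nn; pose z : {linear submod (zerom M) -> M} := sincl.
have Z0 : lenle 0 (submod (zerom M)).
  apply: lenle_triv => x; apply: sincl_inj; have /eqP -> := sinclP x.
  by rewrite linear0.
apply: (lenle_exact (f := z) (g := f)) Z0 Nn => x fx.
by exists 0; rewrite linear0; apply: fi; rewrite fx linear0.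
Qed.

Lemma lenle_surj n M N (f : {linear M -> N}) : is_surj f -> lenle n M -> lenle n N.
Proof.
move=> fs Mn; pose z : {linear N -> submod (zerom N)} := \0.
have Z0 : lenle 0 (submod (zerom N)).
  apply: lenle_triv => x; apply: sincl_inj; have /eqP -> := sinclP x.
  by rewrite linear0.
by rewrite -[n]addn0; apply: (lenle_exact (f := f) (g := z)) Mn Z0 => x _; exact: fs.
Qed.

Lemma lenle_isom n M N : isom M N -> lenle n M -> lenle n N.
Proof. by move=> [f fb]; apply: lenle_surj (bij_surj fb). Qed.

(** The full module can be added on top of any chain in a proper
    submodule. *)
Lemma lenle_proper n M N (f : {linear M -> N}) y :
  (forall x, f x <> y) -> injective f -> lenle n N -> (0 < n)%N /\ lenle n.-1 M.
Proof.
move=> fy fi Nn.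
suff H (C : nat -> submodClosed M) (Cm : forall i, {subset C i <= C i.+1}) L :
    ((\sum_(i < L) @jump M C i).+1 <= n)%N.
  have n0 : (0 < n)%N := leq_ltn_trans (leq0n _) (H (fun=> zerom M) (fun i x => id) 0%N).
  by split=> // C Cm L; rewrite -ltnS prednK //; apply: H.
pose D i := if (i <= L)%N then pushm f (C i) else fullm N.
have Dm i : {subset D i <= D i.+1}.
  move=> x; rewrite /D; case: (ltnP i L) => iL; last by [].
  by rewrite ltnW // => /pushmP[u uC <-]; apply/pushmP; exists u => //; exact: Cm.
apply: leq_trans (Nn D Dm L.+1).
rewrite big_ord_recr /= -addn1 leq_add //; last first.
  rewrite lt0b; apply/asboolP; exists y; rewrite /D ?ltnn // leqnn.
  by apply/negP => /pushmP[x _ /fy].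
apply: leq_sum => i _; case H: (jump C i) => //; move/asboolP: H => [x xC xnC].
have -> // : jump D i; apply/asboolP; exists (f x); rewrite /D ?ltn_ord ?(ltnW (ltn_ord i)).
  by apply/pushmP; exists x.
by apply: contra xnC => /pushmP[u uC /fi <-].
Qed.

Lemma lenle_quot_proper n M N (f : {linear M -> N}) x :
  x <> 0 -> f x = 0 -> is_surj f -> lenle n M -> (0 < n)%N /\ lenle n.-1 N.
Proof.
move=> x0 fx fs Mn.
suff H (C : nat -> submodClosed N) (Cm : forall i, {subset C i <= C i.+1}) L :
    ((\sum_(i < L) @jump N C i).+1 <= n)%N.
  have n0 : (0 < n)%N := leq_ltn_trans (leq0n _) (H (fun=> zerom N) (fun i x => id) 0%N).
  by split=> // C Cm L; rewrite -ltnS prednK //; apply: H.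
pose D i := if i is i'.+1 then mpreim f (C i') else zerom M.
have Dm i : {subset D i <= D i.+1}.
  by case: i => [|i] y /=; [move/eqP->; rewrite rpred0|rewrite !mpreimP; exact: Cm].
apply: leq_trans (Mn D Dm L.+1).
rewrite big_ord_recl /= -add1n leq_add //.
  rewrite lt0b; apply/asboolP; exists x => /=; first by rewrite mpreimP fx rpred0.
  by apply/negP => /eqP.
apply: leq_sum => i _; case H: (jump C i) => //; move/asboolP: H => [y yC ynC].
have [z zy] := fs y; have -> // : jump D i.+1; apply/asboolP; exists z; rewrite /= ?mpreimP zy //.
Qed.

Lemma lenle0 M : lenle 0 M -> trivialm M.
Proof.
move=> M0 x; apply: contrapT => x0.
have [|//] := lenle_quot_proper (f := \0 : {linear M -> submod (zerom M)}) x0 erefl _ M0.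
move=> y; exists 0; apply: sincl_inj; have /eqP -> := sinclP y.
by rewrite linear0.
Qed.

Lemma fin_gen_ext M' M M'' (f : {linear M' -> M}) (g : {linear M -> M''}) :
  (forall x, g x = 0 -> exists y, f y = x) -> is_surj g ->
  fin_gen M' -> fin_gen M'' -> fin_gen M.
Proof.
move=> ex gs /fin_gen_surj[a [u us]] /fin_gen_surj[b [v vs]]; apply/fin_gen_surj.
have [h hE] := @rV_proj S b _ _ g v gs.
pose w (x : 'rV[S]_(a + b)) := f (u (lsubmx x)) + h (rsubmx x).
have wl : linear w.
  move=> c x y; rewrite /w (_ : lsubmx (c *: x + y) = c *: lsubmx x + lsubmx y); last first.
    by apply/matrixP => i j; rewrite !mxE.
  rewrite (_ : rsubmx (c *: x + y) = c *: rsubmx x + rsubmx y); last first.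
    by apply/matrixP => i j; rewrite !mxE.
  by rewrite (linearP u) (linearP f) (linearP h) addrACA -scalerDr.
exists (a + b)%N, (mklin wl) => x.
have [vx vxE] := vs (g x).
have [y yE] : exists y, f y = x - h vx by apply: ex; rewrite linearB hE vxE subrr.
have [ux uxE] := us y; exists (row_mx ux vx).
by rewrite mklinE /w row_mxKl row_mxKr uxE yE subrK.
Qed.

Lemma fin_gen_triv M : trivialm M -> fin_gen M.
Proof. by move=> M0; exists 0%N, (fun=> 0) => x; exists (fun=> 0); rewrite big_ord0; exact: M0. Qed.

Lemma finlen_fin_gen M : finlen M -> fin_gen M.
Proof.
case=> n; elim: n M => [|n IH] M Mn; first exact/fin_gen_triv/lenle0.
have [M0|/existsNP[x x0]] := pselect (trivialm M); first exact: fin_gen_triv.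
pose f : {linear 'rV[S]_1 -> M} := comb (fun=> x).
have fx : f (delta_mx 0 0) = x by rewrite comb_delta.
have [|||_ Qn] := @lenle_quot_proper n.+1 M _ (pi_lin (imm f)) x x0.
- by apply/pi_eq0/immP; exists (delta_mx 0 0).
- exact: pi_surj.
- by [].
apply: (fin_gen_ext (f := f) (g := pi_lin (imm f))).
- by move=> y /pi_eq0/immP.
- exact: pi_surj.
- by apply/fin_gen_surj; exists 1%N, (idfun : {linear 'rV[S]_1 -> 'rV[S]_1}) => y; exists y.
exact: IH.
Qed.

Lemma finlen_min M : finlen M -> exists2 n, lenle n M & forall m, lenle m M -> (n <= m)%N.
Proof.
move=> [n Mn]; have ex : exists n, `[< lenle n M >] by exists n; exact/asboolP.
case: (ex_minnP ex) => m /asboolP Mm mmin; exists m => // q Mq.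
by apply: mmin; exact/asboolP.
Qed.

(** Induction on [n] along the exact sequences [S^n -> S^(n+1) -> S]. *)
Lemma rV_exact_ind (Q : lmodType S -> Prop) n :
  (forall M, trivialm M -> Q M) ->
  (forall M' M M'' (f : {linear M' -> M}) (g : {linear M -> M''}),
     (forall x, g x = 0 -> exists y, f y = x) -> Q M' -> Q M'' -> Q M) ->
  Q (S^o : lmodType S) -> Q ('rV[S]_n : lmodType S).
Proof.
move=> Q0 Qex QS; elim: n => [|n IH].
  by apply: Q0 => x; exact: (thinmx0 (x : 'rV[S]_0)).
have lf : linear (row_mx 0 : 'rV[S]_n -> 'rV[S]_(1 + n)).
  move=> c x y; apply/matrixP => i j; rewrite !mxE.
  by case: (fintype.split j) => k; rewrite !mxE // mulr0 addr0.
apply: (Qex _ _ _ (mklin lf) (coordl S ord0)) => // v v0.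
exists (rsubmx (v : 'rV[S]_(1 + n))); rewrite mklinE -[RHS](@hsubmxK _ 1 1 n); congr row_mx.
apply/matrixP => i j; rewrite !mxE !ord1 -[LHS]v0 [in LHS]/coordl /=; congr (v _ _).
exact: val_inj.
Qed.

Lemma finlen_rV n : finlen (S^o : lmodType S) -> finlen ('rV[S]_n : lmodType S).
Proof.
apply: rV_exact_ind => [M M0|M' M M'' f g ex [a Ma] [b Mb]].
  by exists 0%N; exact: lenle_triv.
by exists (a + b)%N; exact: lenle_exact ex Ma Mb.
Qed.

(** Decompositions into indecomposable summands terminate because proper
    summands are strictly shorter. *)
Lemma decomp_ind (Q : lmodType S -> Prop) :
  (forall M, trivialm M -> Q M) -> (forall M, indecomposable_mod M -> Q M) ->
  (forall M A B : lmodType S, isom M (A * B)%type -> Q A -> Q B -> Q M) ->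
  forall M, finlen M -> Q M.
Proof.
move=> Qt Qi Qp M [n]; elim/ltn_ind: n M => n IH M Mn.
have [M0|Mnt] := pselect (trivialm M); first exact: Qt.
have [Mi|Mni] := pselect (indecomposable_mod M); first exact: Qi.
have [A [B [iso [An Bn]]]] : exists A B : lmodType S,
    isom M (A * B)%type /\ ~ trivialm A /\ ~ trivialm B.
  apply: contrapT => H; apply: Mni; split=> // A B iso.
  apply: contrapT => /not_orP H2; apply: H; by exists A, B.
have ABn := lenle_isom iso Mn.
move: An Bn => /existsNP[a a0] /existsNP[b b0].
have [||n0 An] := @lenle_proper n _ _ (inl_lin A B) (0, b) _ _ ABn.
- by move=> x /(congr1 snd) /= b0'; apply: b0.
- by move=> x y /(congr1 fst).
have [||_ Bn] := @lenle_proper n _ _ (inr_lin A B) (a, 0) _ _ ABn.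
- by move=> x /(congr1 fst) /= a0'; apply: a0.
- by move=> x y /(congr1 snd).
by apply: Qp iso _ _; apply: (IH n.-1); rewrite ?prednK.
Qed.

End Length.

(** * A precover by generators and relations *)

Section Precover.
Variables (S : nzRingType) (P : lmodType S).
Variable adm : forall n, submodClosed ('rV[S]_n : lmodType S) -> Prop.

(** Generators of the precover.  [gbase x] is sent to [x] in [P].  For every
    map [c] from a relation module [N] to a free module whose generators are sent
    to the generators [b], there is one new generator [gnew c b j] for each unit
    vector of the free module containing [N]; these give an extension of the map
    [N -> C] so described.  All of them are sent to zero in [P]. *)
Inductive gen : Type :=
| gbase (x : P)
| gnew n (N : submodClosed ('rV[S]_n : lmodType S)) r
    (c : {linear submod N -> 'rV[S]_r}) (b : 'I_r -> gen) (j : 'I_n).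

(** Choice on the type of generators, as required by [freeg], is classical. *)
Definition genfree : lmodType S := {freeg {classic gen} / S}.
Definition genU (x : gen) : genfree := << (x : {classic gen}) >>.

Definition gen_to_P (x : gen) : P := if x is gbase y then y else 0.
Definition genfree_to_P : {linear genfree -> P} :=
  flift (gen_to_P : {classic gen} -> P).

(** The relations are imposed only when the map from [N] has its image in the
    kernel of the map to [P]; otherwise the map to [P] would not respect them. *)
Definition gvalid n (N : submodClosed ('rV[S]_n : lmodType S)) r
    (c : {linear submod N -> 'rV[S]_r}) (b : 'I_r -> gen) :=
  adm N /\ forall z, comb (gen_to_P \o b) (c z) = 0.

Definition relator (y : genfree) := exists n (N : submodClosed ('rV[S]_n : lmodType S)) r
   (c : {linear submod N -> 'rV[S]_r}) (b : 'I_r -> gen) (z : submod N),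
   gvalid c b /\
   y = comb (genU \o gnew c b) (sincl z) - comb (genU \o b) (c z).

Definition precov : lmodType S := quotm (mspan relator).
Definition precov_pi : {linear genfree -> precov} := pi_lin (mspan relator).

Lemma genfree_to_PE x : genfree_to_P (genU x) = gen_to_P x.
Proof. exact: fliftU. Qed.

Lemma comb_comp (M N : lmodType S) (h : {linear M -> N}) n (g : 'I_n -> M) v :
  h (comb g v) = comb (h \o g) v.
Proof. by rewrite !combE linear_sum; apply: eq_bigr => i _; rewrite linearZ. Qed.

Lemma eq_comb (M : lmodType S) n (g g' : 'I_n -> M) v : g =1 g' -> comb g v = comb g' v.
Proof. by move=> gg'; rewrite !combE; apply: eq_bigr => i _; rewrite gg'. Qed.

(** The relators die in [P]: new generators are sent to zero, and so is the
    value of [c] by [gvalid]. *)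
Lemma precov_to_P_ex : exists h : {linear precov -> P},
  forall x, h (precov_pi x) = genfree_to_P x.
Proof.
apply: factor_surj; first exact: pi_surj.
move=> x /pi_eq0 xR; suff: x \in kerm genfree_to_P by move/eqP.
apply: mspan_sub xR => _ [n [N [r [c [b [z [[_ bP] ->]]]]]]].
apply/eqP; rewrite linearB !(comb_comp genfree_to_P).
rewrite (eq_comb (g := genfree_to_P \o (genU \o b)) _ (g' := gen_to_P \o b)); last first.
  by move=> a; exact: genfree_to_PE.
by rewrite bP subr0 combE big1 // => j _; rewrite [X in _ *: X]genfree_to_PE scaler0.
Qed.
Definition precov_to_P := projT1 (cid precov_to_P_ex).
Lemma precov_to_PE x : precov_to_P (precov_pi x) = genfree_to_P x.
Proof. by rewrite /precov_to_P; case: cid. Qed.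

Lemma precov_surj : is_surj precov_to_P.
Proof. by move=> x; exists (precov_pi (genU (gbase x))); rewrite precov_to_PE genfree_to_PE. Qed.

Lemma precov_rel n (N : submodClosed ('rV[S]_n : lmodType S)) r
  (c : {linear submod N -> 'rV[S]_r}) (b : 'I_r -> gen) z : gvalid c b ->
  comb (precov_pi \o genU \o gnew c b) (sincl z) = comb (precov_pi \o genU \o b) (c z).
Proof.
move=> cb; apply/eqP; rewrite -subr_eq0; apply/eqP.
rewrite -!(comb_comp precov_pi (_ \o _)) -linearB; apply/pi_eq0.
by apply: mspan_mem; exists n, N, r, c, b, z.
Qed.

(** A lift [Y -> Z] is chosen on the generators by recursion.  For a base
    generator any preimage will do.  For the generators [gnew c b j] the lifts of
    [b] are known; arbitrary preimages satisfy the relation up to a map [N -> T],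
    and extending that map to the free module corrects them. *)
Lemma precov_ext0 T :
  (forall n (N : submodClosed ('rV[S]_n : lmodType S)), adm N -> extends (@sincl _ _ N) T) ->
  ext0 precov T.
Proof.
move=> cT Z Y i g [ii gs gex] f.
pose q (x : gen) : Y := f (precov_pi (genU x)).
pose sec (y : Y) : Z := projT1 (cid (gs y)).
have secK y : g (sec y) = y by rewrite /sec; case: cid.
pose good n (N : submodClosed ('rV[S]_n : lmodType S)) r
    (c : {linear submod N -> 'rV[S]_r}) (b : 'I_r -> gen) (w : 'I_r -> Z) (u : 'I_n -> Z) :=
  (gvalid c b -> forall z, comb u (sincl z) = comb w (c z)) /\
  (forall j, g (u j) = q (gnew c b j)).
have goodP n (N : submodClosed ('rV[S]_n : lmodType S)) r
    (c : {linear submod N -> 'rV[S]_r}) (b : 'I_r -> gen) (w : 'I_r -> Z) :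
  (forall a, g (w a) = q (b a)) -> exists u, good n N r c b w u.
  move=> wq; pose u0 j := sec (q (gnew c b j)).
  have [v|nv] := pselect (gvalid c b); last by exists u0; split=> // j; exact: secK.
  pose d := lcomp (comb u0) (@sincl _ _ N) \- lcomp (comb w) c : {linear submod N -> Z}.
  have [t tE] : exists t : {linear submod N -> T}, forall z, i (t z) = d z.
    apply: factor_inj => // z; apply/gex; rewrite /d /= ?lcompE linearB !(comb_comp g).
    rewrite (eq_comb _ (g' := q \o gnew c b)); last by move=> j; exact: secK.
    rewrite (eq_comb (g := g \o w) _ (g' := q \o b)); last exact: wq.
    rewrite -(comb_comp f (precov_pi \o genU \o gnew c b)).
    rewrite -(comb_comp f (precov_pi \o genU \o b)).
    by rewrite precov_rel // subrr.
  have [t' t'E] := cT _ _ (proj1 v) t.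
  exists (fun j => u0 j - i (t' (delta_mx 0 j))); split=> [_ z|j].
    rewrite combE; under eq_bigr do rewrite scalerBr.
    rewrite sumrB -combE.
    have -> : \sum_(j < n) sincl z 0 j *: i (t' (delta_mx 0 j)) = i (t' (sincl z)).
      by rewrite (lin_rV t') linear_sum; apply: eq_bigr => j _; rewrite linearZ.
    by rewrite t'E tE /d /= ?lcompE opprB addrC subrK.
  rewrite linearB secK (_ : g (i _) = 0) ?subr0 //.
  by apply/gex; exists (t' (delta_mx 0 j)).
(* [good] is decided classically for each set of new generators; [goodP] shows
that the default branch is never taken. *)
pose lift := fix lift (x : gen) : Z := match x with
  | gbase y => sec (q x)
  | @gnew n N r c b j =>
     (if pselect (exists u, good n N r c b (fun a => lift (b a)) u) is left e
      then projT1 (cid e) else (fun=> 0)) j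
  end.
have liftP x : g (lift x) = q x.
  elim: x => [y|n N r c b IH j] /=; first exact: secK.
  case: pselect => [e|ne]; last by case: ne; apply: goodP.
  by case: cid => u [_ uq] /=.
have liftR n (N : submodClosed ('rV[S]_n : lmodType S)) r
    (c : {linear submod N -> 'rV[S]_r}) (b : 'I_r -> gen) z : gvalid c b ->
  comb (lift \o gnew c b) (sincl z) = comb (lift \o b) (c z).
  move=> v; rewrite /comp /=.
  case: pselect => [e|ne]; last by case: ne; apply: goodP => a; exact: liftP.
  by case: cid => u [uR uq]; apply: etrans (uR v z); apply: eq_comb.
pose l : {linear genfree -> Z} := flift (lift : {classic gen} -> Z).
have lE x : l (genU x) = lift x by exact: fliftU.
have [h hE] : exists h : {linear precov -> Z}, forall x, h (precov_pi x) = l x.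
  apply: factor_surj; first exact: pi_surj.
  move=> x /pi_eq0 xR; suff: x \in kerm l by move/eqP.
  apply: mspan_sub xR => _ [n [N [r [c [b [z [v ->]]]]]]].
  apply/eqP; rewrite linearB !(comb_comp l).
  rewrite (eq_comb (g := l \o (genU \o b)) _ (g' := lift \o b)); last by move=> a; exact: lE.
  rewrite (eq_comb _ (g' := lift \o gnew c b)); last by move=> a; exact: lE.
  by rewrite liftR // subrr.
exists h => x; have [D <-] := pi_surj x; rewrite -/precov_pi hE -[RHS]/(lcomp f precov_pi D).
by apply: (free_ext (f := lcomp g l)) => y; rewrite !lcompE -/(genU y) lE liftP.
Qed.

(** As [N] is projective, a map to the kernel lifts to the free module on the
    generators, and as [N] is finitely generated, finitely many generators [b]
    occur.  The new generators attached to this lift provide the extension. *)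
Lemma precov_ker_extends n (N : submodClosed ('rV[S]_n : lmodType S)) :
  adm N -> projective_mod (submod N) -> fin_gen (submod N) ->
  extends (@sincl _ _ N) (submod (kerm precov_to_P)).
Proof.
move=> Nc Np [m [z zE]] v.
have [w wE] := Np _ _ precov_pi (lcomp sincl v) (@pi_surj _ _ _).
(* the generators that occur in the lifts of the generators of [N] *)
pose s : seq {classic gen} := flatten [seq dom (w (z i)) | i : 'I_m].
pose r := size (undup s).
pose b (a : 'I_r) : gen := tnth (in_tuple (undup s)) a.
have cf0 x y : y \notin undup s -> coeff y (w x) = 0.
  move=> ys; have [a ->] := zE x.
  rewrite -[LHS]/(coeffl S y _) linear_sum (linear_sum (coeffl S y)) big1 // => i _.
  rewrite linearZ (linearZ_LR (coeffl S y)) (_ : coeffl S y _ = 0) ?scaler0 //.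
  apply: coeff_outdom; apply: contra ys; rewrite mem_undup => yi.
  by apply/flatten_imageP; exists i.
have lc : linear (fun x => \row_(a < r) coeff (b a : {classic gen}) (w x)).
  by move=> a x y; apply/rowP => j; rewrite !mxE linearP coeffD coeffZ.
have wc x : comb (genU \o b) (mklin lc x) = w x.
  apply/eqP/freeg_eqP => y; rewrite -[LHS]/(coeffl S y _) combE linear_sum.
  have E i : coeffl S y (mklin lc x 0 i *: (genU \o b) i)
     = coeff (b i : {classic gen}) (w x) * ((b i : {classic gen}) == y)%:R.
    by rewrite (linearZ_LR (coeffl S y)) mklinE mxE [X in _ *: X]coeffU mul1r.
  rewrite (eq_bigr _ (fun i _ => E i)).
  have [ys|ys] := boolP (y \in undup s); last first.
    rewrite cf0 // big1 // => i _; case: eqP => [biy|_]; last by rewrite mulr0.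
    by rewrite biy cf0 // mul0r.
  have [i yi] : exists i, y = tnth (in_tuple (undup s)) i by apply/tnthP.
   rewrite (bigD1 i) //= -[b i]yi eqxx mulr1 big1 ?addr0 //.
  move=> j ji; case: eqP => [bjy|_]; last by rewrite mulr0.
  case/eqP: ji; apply: val_inj; apply/eqP.
  rewrite -(nth_uniq y (ltn_ord j) (ltn_ord i) (undup_uniq s)).
  by move: bjy yi; rewrite /b !(tnth_nth y) /= => -> <-.
have bv : gvalid (mklin lc) b.
  split=> // x; have := congr1 genfree_to_P (wc x).
  rewrite comb_comp (eq_comb _ (g' := gen_to_P \o b)); last first.
    by move=> a; exact: genfree_to_PE.
  by move=> ->; rewrite -precov_to_PE wE; apply/eqP/(sinclP (v x)).
have [u uE] : exists u : {linear 'rV[S]_n -> submod (kerm precov_to_P)},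
    forall x, sincl (u x) = comb (precov_pi \o genU \o gnew (mklin lc) b) x.
  apply: factor_inj; first exact: sincl_inj.
  move=> x; apply: sincl_ex; apply/eqP.
  rewrite (comb_comp precov_to_P) combE big1 // => i _.
  by rewrite [X in _ *: X]precov_to_PE genfree_to_PE scaler0.
exists u => x; apply: sincl_inj; rewrite uE precov_rel //.
by rewrite -(comb_comp precov_pi (_ \o _)) wc wE.
Qed.
End Precover.

(** * Chain conditions and commutative artinian rings *)

Section Chains.
Variables (S : nzRingType) (M : lmodType S).
Implicit Type N : submodClosed M.

(** Dependent choice: without a minimal element there is a strictly descending
    sequence. *)
Lemma artin_min (Q : submodClosed M -> Prop) : artinian_mod M ->
  (exists N, Q N) -> exists N, Q N /\ forall N', Q N' -> {subset N' <= N} -> {subset N <= N'}.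
Proof.
move=> Ma [N0 QN0]; apply: contrapT => H.
have next (N : {N | Q N}) : exists N' : {N | Q N},
    {subset sval N' <= sval N} /\ exists2 x, x \in sval N & x \notin sval N'.
  apply: contrapT => H2; apply: H; exists (sval N); split; first exact: svalP.
  move=> N' QN' sub x xN; apply/negPn/negP => xN'.
  by apply: H2; exists (exist _ N' QN'); split=> //; exists x.
have /choice[f fP] := next.
pose C := fix C n : {N | Q N} := if n is n'.+1 then f (C n') else exist _ N0 QN0.
have [n nP] := Ma (fun n => sval (C n)) (fun n => proj1 (fP (C n))).
have [_ [x xn xn1]] := fP (C n).
by move: xn1; rewrite -/(C n.+1) (nP n.+1) ?xn.
Qed.

Lemma zorn_submod (Q : submodClosed M -> Prop) N0 : Q N0 ->
  (forall (F : submodClosed M -> Prop) (U : submodClosed M),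
     (exists N, F N) -> (forall N, F N -> Q N) ->
     (forall N N', F N -> F N' -> {subset N <= N'} \/ {subset N' <= N}) ->
     (forall x, x \in U <-> exists2 N, F N & x \in N) -> Q U) ->
  exists N, Q N /\ forall N', Q N' -> {subset N <= N'} -> {subset N' <= N}.
Proof.
move=> QN0 Qcup; pose T := {N | Q N}.
pose le (p q : T) := {subset sval p <= sval q}.
have [| | |[N QN] Nmax] := ZL_preorder (exist _ N0 QN0 : T) (R := fun p q => `[< le p q >]).
- by move=> p; apply/asboolP => x.
- by move=> q p r /asboolP pq /asboolP qr; apply/asboolP => x /pq/qr.
- move=> A Atot.
  have [[q0 Aq0]|A0] := pselect (exists q, A q); last first.
    by exists (exist _ N0 QN0) => s As; case: A0; exists s.
  pose F N := exists2 q, A q & sval q = N.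
  pose inU x := exists2 N, F N & x \in N.
  have Ftot N N' : F N -> F N' -> {subset N <= N'} \/ {subset N' <= N}.
    by move=> [q Aq <-] [q' Aq' <-]; case: (Atot _ _ Aq Aq') => /asboolP; [left|right].
  have U0 : inU 0 by exists (sval q0); rewrite ?rpred0 //; exists q0.
  have UL a x y : inU x -> inU y -> inU (a *: x + y).
    move=> [N FN xN] [N' FN' yN'].
    have [H|H] := Ftot _ _ FN FN'; first by exists N'; rewrite ?rpredD // rpredZ // H.
    by exists N; rewrite ?rpredD // ?rpredZ // H.
  have QU : Q (mksub U0 UL).
    apply: (Qcup F) => //; first by exists (sval q0), q0.
      by move=> _ [q Aq <-]; exact: svalP.
    by move=> x; split=> [/mksubP//|H]; exact/mksubP.
  exists (exist _ _ QU) => s As; apply/asboolP => x xs; apply/(mksubP U0 UL).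
  by exists (sval s) => //; exists s.
exists N; split=> // N' QN' NN'.
by have /asboolP := Nmax (exist _ N' QN') (asboolT (P := le (exist _ N QN) (exist _ N' QN')) NN').
Qed.

End Chains.

Section Length1.
Variable S : nzRingType.
Implicit Type M : lmodType S.

(** The hypothesis is that every nonzero element generates [M]. *)
Lemma lenle1 M : (forall x y : M, x <> 0 -> exists c : S, y = c *: x) -> lenle 1 M.
Proof.
move=> M1 C Cm L.
suff : (\sum_(i < L) jump C i <= 1)%N /\
       ((0 < \sum_(i < L) jump C i)%N -> forall y, y \in C L) by case.
elim: L => [|L [IH1 IH2]]; first by rewrite big_ord0.
rewrite big_ord_recr /=; have [s0|s0] := posnP (\sum_(i < L) jump C i)%N; last first.
  have -> : jump C L = false.
    by apply/asboolPn => -[x _]; rewrite (IH2 s0).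
  by rewrite addn0; split=> // _ y; apply: Cm; exact: IH2.
rewrite s0 add0n; split; first by case: jump.
case H: (jump C L) => // _ y; move/asboolP: H => [x xC xnC].
have [|c ->] := M1 x y; last by rewrite rpredZ.
by move=> x0; rewrite x0 rpred0 in xnC.
Qed.

(** A nonzero element that generates a simple submodule, found by induction on
    the length. *)
Lemma lenle_simple_ex n M : lenle n M -> ~ trivialm M ->
  exists2 x : M, x <> 0 & forall c : S, c *: x <> 0 -> exists r : S, x = r *: (c *: x).
Proof.
elim: n M => [|n IH] M Mn Mt; first by case: Mt; exact: lenle0.
have /existsNP[x x0] := Mt.
have [H|] := pselect (forall c : S, c *: x <> 0 -> exists r : S, x = r *: (c *: x)).
  by exists x.
move=> /existsNP[c /not_implyP[cx H]].
pose f : {linear 'rV[S]_1 -> M} := comb (fun=> c *: x).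
have fE v : f v = v 0 0 *: (c *: x) by rewrite /f combE big_ord1.
have [||_ Ln] := @lenle_proper S n.+1 _ _ (@sincl _ _ (imm f)) x _ _ Mn.
- move=> u ux; apply: H; have /immP[v vE] := sinclP u.
  by exists (v 0 0); rewrite -fE vE ux.
- exact: sincl_inj.
have [|y y0 yP] := IH _ Ln.
  have [u uE] : exists u : submod (imm f), sincl u = c *: x.
    by apply: sincl_ex; apply/immP; exists (delta_mx 0 0); rewrite fE mxE eqxx scale1r.
  by move=> /(_ u) u0; apply: cx; rewrite -uE u0 linear0.
exists (sincl y).
  by move=> yy0; apply: y0; apply: sincl_inj; rewrite yy0 linear0.
move=> d dy; have [|r rE] := yP d.
  by move=> d0; apply: dy; rewrite -linearZ_LR d0 linear0.
by exists r; rewrite -!linearZ_LR -rE.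
Qed.
End Length1.

Section MulBy.
Variable S : nzRingType.

Fact mulby_linear (M : lmodType S) (x : M) : linear (fun c : S^o => (c : S) *: x).
Proof. by move=> a c d; rewrite scalerDl -scalerA. Qed.
Definition mulby (M : lmodType S) (x : M) : {linear S^o -> M} := mklin (mulby_linear x).
Lemma mulbyE (M : lmodType S) (x : M) (c : S) : mulby x c = c *: x.
Proof. by []. Qed.
End MulBy.
Arguments mulby : simpl never.

Section CommArtinian.
Variable k : comNzRingType.
Local Notation K := (k^o : lmodType k).

Lemma regE (c x : k) : c *: (x : K) = c * x. Proof. by []. Qed.

(** Take an ideal [a] minimal among those of infinite length.  A scalar either
    kills [a] or maps it onto itself, since its kernel and image on [a] cannot
    both be proper; in the second case it is invertible on [a] by the descending
    chain of its powers.  So [a] is a vector space over a field, and it is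
    infinite dimensional, hence has a hyperplane: a proper submodule, so of
    finite length, with a simple quotient. *)
Lemma artin_finlen : artinian_mod K -> finlen K.
Proof.
move=> ka; apply: contrapT => knf.
have [a [af amin]] : exists N : submodClosed K, ~ finlen (submod N) /\
    forall N' : submodClosed K, ~ finlen (submod N') -> {subset N' <= N} -> {subset N <= N'}.
  apply: (artin_min ka); exists (fullm K) => -[n fn]; apply: knf; exists n.
  by apply: (lenle_surj (f := @sincl _ _ (fullm K))) fn => x; exact: sincl_ex.
have propf (N : submodClosed K) x : {subset N <= a} -> x \in a -> x \notin N -> finlen (submod N).
  by move=> sub xa xN; apply: contrapT => /amin/(_ sub)/(_ x xa); apply/negP.
(* every scalar kills [a] or maps it onto itself *)
have act c : (forall x, x \in a -> c * x = 0) \/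
             (forall x, x \in a -> exists2 y, y \in a & c * y = x).
  pose f : {linear submod a -> K} := lcomp (mulby (c : K)) sincl.
  have fE u : f u = c * sincl u by rewrite /f lcompE mulbyE mulrC.
  have [H|/existsNP[x /not_implyP[xa nx]]] :=
    pselect (forall x, x \in a -> exists2 y, y \in a & c * y = x); [by right|left].
  have fa : {subset imm f <= a}.
    move=> y /immP[u <-]; rewrite fE -regE rpredZ //; exact: sinclP.
  have [i fi] : finlen (submod (imm f)).
    apply: (propf _ x) => //; apply/negP => /immP[u uE]; apply: nx.
    by exists (sincl u); rewrite ?sinclP // -fE.
  move=> y ya; apply: contrapT => cy; apply: af.
  pose Kf := pushm sincl (kerm f).
  have [j kj] : finlen (submod Kf).
    apply: (propf _ y) => //.
      by move=> z /pushmP[u _ <-]; exact: sinclP.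
    apply/negP => /pushmP[u /eqP fu uy]; apply: cy.
    by rewrite -uy -fE fu.
  have [g gE] : exists g : {linear submod Kf -> submod a}, forall x, sincl (g x) = sincl x.
    apply: factor_inj; first exact: sincl_inj.
    by move=> z; have /pushmP[u _ <-] := sinclP z; exists u.
  exists (j + i)%N; apply: (lenle_exact (f := g) (g := toimm f)) => // z.
  move=> /(congr1 sincl); rewrite toimmE linear0 => fz.
  have [w wE] : exists w : submod Kf, sincl w = sincl z.
    by apply: sincl_ex; apply/pushmP; exists z => //; apply/eqP.
  by exists w; apply: sincl_inj; rewrite gE.
have inv c : ~ (forall x, x \in a -> c * x = 0) ->
    exists r, forall x, x \in a -> r * (c * x) = x.
  move=> ca; have [//|sa] := act c.
  pose C n : submodClosed K := imm (mulby (c ^+ n : K)).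
  have CP n x : reflect (exists r, r * c ^+ n = x) (x \in C n).
    by apply: (iffP (immP _ _)) => -[r <-]; exists r; rewrite mulbyE.
  have [|n nP] := ka C.
    move=> n x /CP[r <-]; apply/CP; exists (r * c); by rewrite exprS mulrA.
  have [r rE] : exists r, r * c ^+ n.+1 = c ^+ n.
    by apply/CP; rewrite nP //; apply/CP; exists 1; rewrite mul1r.
  have pow m x : x \in a -> exists2 y, y \in a & c ^+ m * y = x.
    elim: m x => [|m IH] x xa; first by exists x; rewrite ?mul1r.
    have [y ya <-] := IH x xa; have [z za <-] := sa y ya.
    by exists z; rewrite // exprSr mulrA.
  exists r => x xa; have [y ya <-] := pow n x xa.
  by rewrite !mulrA -[r * c * _]mulrA -exprS rE.
have [x0 x0a x00] : exists2 x, x \in a & x <> 0.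
  apply: contrapT => H; apply: af; exists 0%N; apply: lenle_triv => u.
  apply: sincl_inj; rewrite linear0; apply: contrapT => u0; apply: H.
  by exists (sincl u) => //; exact: sinclP.
(* a hyperplane [b] of [a] that avoids [x0] *)
have [b [[ba x0b] bmax]] : exists N : submodClosed K,
    ({subset N <= a} /\ x0 \notin N) /\
    forall N' : submodClosed K, ({subset N' <= a} /\ x0 \notin N') ->
      {subset N <= N'} -> {subset N' <= N}.
  apply: (zorn_submod (N0 := zerom K)).
    by split; [move=> y /eqP->; rewrite rpred0 | apply/negP => /eqP].
  move=> F U _ FQ _ UP; split.
    by move=> y /UP[N FN yN]; have [sub _] := FQ _ FN; apply: sub.
  by apply/negP => /UP[N FN]; have [_ /negP] := FQ _ FN.
have [n bn] := propf b x0 ba x0a x0b.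
have span_x0 u : u \in a -> exists r, u - r * x0 \in b.
  move=> ua; have [ub|ub] := boolP (u \in b); first by exists 0; rewrite mul0r subr0.
  have [v vb [c vE]] : exists2 v, v \in b & exists c, x0 = v + c * u.
    apply: contrapT => H; case/negP: ub.
    pose A (x : K) := exists2 v, v \in b & exists c : k, x = v + c * u.
    have A0 : A 0 by exists 0; rewrite ?rpred0 //; exists 0; rewrite mul0r addr0.
    have AL (s : k) x y : A x -> A y -> A (s *: x + y).
      move=> [v vb [c ->]] [w wb [d ->]]; exists (s *: v + w).
        by rewrite rpredD ?rpredZ.
      by exists (s * c + d); rewrite regE mulrDr mulrDl addrACA mulrA.
    apply: (bmax (mksub A0 AL)).
    - split; last by apply/negP => /mksubP[v vb [c cE]]; apply: H; exists v => //; exists c.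
      move=> x /mksubP[v vb [c ->]]; by rewrite rpredD //; [exact: ba|rewrite -regE rpredZ].
    - by move=> v vb; apply/mksubP; exists v => //; exists 0; rewrite mul0r addr0.
    by apply/mksubP; exists 0; rewrite ?rpred0 //; exists 1; rewrite mul1r add0r.
  have [|r rP] := inv c.
    by move=> /(_ u ua) cu; move: x0b; rewrite vE cu addr0 vb.
  exists r; rewrite vE mulrDr rP // opprD addrCA subrr addr0.
  by rewrite -mulrN -regE rpredZ // -scaleN1r rpredZ.
apply: af; exists (n + 1)%N.
have [f fE] : exists f : {linear submod b -> submod a}, forall x, sincl (f x) = sincl x.
  apply: factor_inj; first exact: sincl_inj.
  by move=> z; apply: sincl_ex; apply: ba; exact: sinclP.
pose g : {linear submod a -> quotm b} := lcomp (pi_lin b) sincl.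
apply: (lenle_exact (f := f) (g := toimm g)) => //.
  move=> z /(congr1 sincl); rewrite toimmE linear0 => /pi_eq0 zb.
  have [w wE] := sincl_ex zb.
  by exists w; apply: sincl_inj; rewrite fE.
apply: lenle1 => y z y0.
have [u uy] := toimm_surj y; have [w wz] := toimm_surj z.
have gsp (v : submod a) r : sincl v - r * x0 \in b -> g v = r *: pi_lin b x0.
  move=> vb; apply/eqP; rewrite -subr_eq0 -linearZ_LR /g lcompE -linearB.
  exact/eqP/pi_eq0.
have [r /gsp gu] := span_x0 _ (sinclP u).
have [s /gsp gw] := span_x0 _ (sinclP w).
have [|t tP] := inv r.
  move=> rx; apply: y0; rewrite -uy; apply: sincl_inj; rewrite toimmE gu linear0.
  by rewrite -linearZ_LR (_ : r *: (x0 : K) = 0) ?linear0 //; exact: rx.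
exists (s * t); apply: sincl_inj.
rewrite linearZ_LR -wz -uy !toimmE gu gw scalerA -mulrA -!linearZ_LR; congr (pi_lin b _).
by rewrite !regE -!mulrA tP.
Qed.
End CommArtinian.

(** * Matlis duality over a commutative artinian ring *)

Section Matlis.
Variable k : comNzRingType.
Local Notation K := (k^o : lmodType k).
Hypothesis k_art : artinian_mod K.
Implicit Types (M N E : lmodType k) (m : submodClosed K).

Lemma ideal_mulr m a c : a \in m -> c * a \in m.
Proof. by move=> am; rewrite -regE rpredZ. Qed.

Lemma max_inv m c : maximal_ideal m -> c \notin m -> exists r, 1 - r * c \in m.
Proof.
move=> [m1 mmax] cm; pose A (x : K) := exists r, x - r * c \in m.
have A0 : A 0 by exists 0; rewrite mul0r subr0 rpred0.
have AL (s : k) x y : A x -> A y -> A (s *: x + y).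
  move=> [r xr] [t yt]; exists (s * r + t).
  have -> : s *: x + y - (s * r + t) * c = s * (x - r * c) + (y - t * c).
    by rewrite [s *: x]regE mulrBr mulrDl opprD addrACA mulrA.
  by rewrite rpredD // ideal_mulr.
have mA : {subset m <= mksub A0 AL}.
  by move=> x xm; apply/mksubP; exists 0; rewrite mul0r subr0.
case: (mmax _ mA) => [H|/mksubP[r rP]]; last by exists r.
case/negP: cm; rewrite -H; apply/mksubP; exists 1.
by rewrite mul1r subrr rpred0.
Qed.

Lemma max_prime m a b : maximal_ideal m -> a * b \in m -> a \notin m -> b \in m.
Proof.
move=> mm ab am; have [r rP] := max_inv mm am.
have -> : b = b * (1 - r * a) + r * (a * b).
  by rewrite mulrBr mulr1 [r * (a * b)]mulrA [b * _]mulrC subrK.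
by rewrite rpredD // ideal_mulr.
Qed.

Definition is_rad (a : K) := forall m, maximal_ideal m -> a \in m.

Lemma rad0 : is_rad 0. Proof. by move=> m _; exact: (@rpred0 K m). Qed.
Lemma radL (s : k) (x y : K) : is_rad x -> is_rad y -> is_rad (s *: x + y).
Proof. by move=> xr yr m mm; rewrite rpredD //; [rewrite rpredZ //; exact: xr|exact: yr]. Qed.
Definition radk : submodClosed K := mksub rad0 radL.

(** An ideal minimal among those not contained in [m] lies in all other maximal
    ideals; any of its elements outside [m] will do. *)
Lemma coprime_elt m : maximal_ideal m ->
  exists2 c, c \notin m & forall s, s \in m -> is_rad (s * c).
Proof.
move=> mm; have [N [[c cN cm] Nmin]] := artin_min (Q := fun L : submodClosed K =>
  exists2 x, x \in L & x \notin m) k_art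
  (ex_intro _ (fullm K) (ex_intro2 _ _ 1 (erefl true) (introN idP (fun H => negP (proj1 mm) H)))).
exists c => // s sm m' mm'.
have [<-//|mm'E] := pselect (m = m'); first by rewrite mulrC ideal_mulr.
have [H|/existsNP[d /not_implyP[dm' /negP dm]]] := pselect (forall d, d \in m' -> d \in m).
  case: (proj2 mm' m H) => E; first by rewrite -E mulrC ideal_mulr.
  by case/negP: (proj1 mm).
apply: ideal_mulr.
pose I := mpreim (@sincl _ _ N) m'.
pose N' := pushm (@sincl _ _ N) I.
suff : c \in N' by move=> /pushmP[u uI <-]; move: uI; rewrite mpreimP.
apply: (Nmin N') => //.
  exists (d * c).
    have [u uc] := sincl_ex cN; apply/pushmP; exists (d *: u).
      by rewrite mpreimP linearZ_LR regE mulrC ideal_mulr.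
    by rewrite linearZ_LR uc.
  by apply: contra cm => dcm; exact: max_prime mm dcm dm.
by move=> x /pushmP[u _ <-]; exact: sinclP.
Qed.

(** [E] is an essential extension of [k / rad k]. *)
Definition ess_top E (i : {linear K -> E}) :=
  (forall a : k, i a = 0 <-> is_rad a) /\
  (forall L : submodClosed E, (forall a : k, i a \in L -> i a = 0) -> L =i zerom E).

(** The part of [E] killed by a maximal ideal [m] lies in the image of
    [k / rad k] by essentiality, where it is the residue field at [m]. *)
Lemma socle_line E (i : {linear K -> E}) m (x y : E) : ess_top i -> maximal_ideal m ->
  (forall s, s \in m -> s *: x = 0) -> (forall s, s \in m -> s *: y = 0) ->
  x <> 0 -> exists c : k, y = c *: x.
Proof.
move=> [irad iess] mm xm ym x0.
have lift z : (forall s, s \in m -> s *: z = 0) -> z <> 0 -> exists a : k, z = i a.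
  move=> zm z0; have [a az ia] : exists2 a : k, i a \in imm (mulby z) & i a <> 0.
    apply: contrapT => H; apply: z0; apply/eqP.
    have -> : (z == 0) = (z \in zerom E) by [].
    rewrite -(iess (imm (mulby z))); first by apply/immP; exists 1; rewrite mulbyE scale1r.
    by move=> a az; apply: contrapT => ia; apply: H; exists a.
  have /immP[c cE] := az; rewrite mulbyE in cE.
  have [|r rP] := @max_inv m c mm.
    by apply/negP => /zm cz; apply: ia; rewrite -cE cz.
  exists (r * a); rewrite -regE linearZ_LR -cE scalerA.
  by apply/eqP; rewrite -subr_eq0 -{1}[z]scale1r -scalerBl zm.
have [->|/eqP y0] := eqVneq y 0; first by exists 0; rewrite scale0r.
have [a xa] := lift x xm x0; have [b yb] := lift y ym y0.
have arad s : s \in m -> is_rad (s * a).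
  by move=> sm; apply/irad; rewrite -regE linearZ_LR -xa xm.
have am : a \notin m.
  apply/negP => am; apply: x0; rewrite xa; apply/irad => m' mm'.
  apply/negPn/negP => am'; have aa := arad a am m' mm'.
  by case/negP: am'; apply/negPn/negP => am'; have := max_prime mm' aa am'; rewrite (negbTE am').
have [r rP] := max_inv mm am.
exists (r * b); rewrite xa -linearZ_LR regE yb.
apply/eqP; rewrite -subr_eq0 -linearB; apply/eqP.
have -> : b - r * b * a = (1 - r * a) *: (b : K).
  by rewrite regE mulrBl mul1r mulrAC.
by rewrite linearZ_LR -yb ym.
Qed.

Fact klin0 M E : linear (0 : M -> E).
Proof. by move=> a x y; rewrite [LHS]/= scaler0 addr0. Qed.
Fact klinL M E (c : k) (f g : M -> E) : linear f -> linear g -> linear (c *: f + g).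
Proof.
move=> lf lg a x y.
have e z : (c *: f + g) z = c *: f z + g z by [].
by rewrite !e lf lg !scalerDr !scalerA mulrC addrACA.
Qed.
(** [Hom_k(M, E)] as a [k]-module. *)
Definition kdual M E : lmodType k :=
  submod (@mksub k (M -> E) (fun f => linear f) (@klin0 M E) (@klinL M E)).

Definition kdual_fun M E (u : kdual M E) : {linear M -> E} :=
  mklin (elimT (@mksubP k (M -> E) _ (@klin0 M E) (@klinL M E) _) (sinclP u)).
Arguments kdual_fun : simpl never.

Lemma kdual_funE M E (u : kdual M E) x : kdual_fun u x = (sincl u : M -> E) x.
Proof. by []. Qed.

Lemma kdual_fun_linear M E a (u v : kdual M E) x : kdual_fun (a *: u + v) x = a *: kdual_fun u x + kdual_fun v x.
Proof. by rewrite !kdual_funE linearP. Qed.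

Lemma kdual_fun_inj M E (u v : kdual M E) : (forall x, kdual_fun u x = kdual_fun v x) -> u = v.
Proof. by move=> uv; apply: sincl_inj; apply: funext => x; rewrite -!kdual_funE. Qed.

Lemma kdual_fun_ex M E (f : {linear M -> E}) : exists u : kdual M E, forall x, kdual_fun u x = f x.
Proof.
have [u uE] : exists u : kdual M E, sincl u = (f : M -> E).
  by apply: sincl_ex; apply/(@mksubP k (M -> E)); exact: linearP.
by exists u => x; rewrite kdual_funE uE.
Qed.

Lemma kdual_fun0 M E x : kdual_fun (0 : kdual M E) x = 0.
Proof. by rewrite kdual_funE linear0. Qed.

Fact kev_linear M E (x : M) : linear (fun u : kdual M E => kdual_fun u x).
Proof. by move=> a u v; rewrite kdual_fun_linear. Qed.
Definition kdual_eval M E (x : M) : {linear kdual M E -> E} := mklin (kev_linear x).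

Lemma kdual_map_ex M N E (f : {linear M -> N}) : exists h : {linear kdual N E -> kdual M E},
  forall u x, kdual_fun (h u) x = kdual_fun u (f x).
Proof.
have /choice[h hE] : forall u : kdual N E, exists v : kdual M E, forall x, kdual_fun v x = kdual_fun u (f x).
  by move=> u; have [v vE] := kdual_fun_ex (lcomp (kdual_fun u) f); exists v => x; rewrite vE.
have lh : linear h.
  by move=> a u v; apply: kdual_fun_inj => x; rewrite kdual_fun_linear !hE kdual_fun_linear.
by exists (mklin lh) => u x; exact: hE.
Qed.

(** Induction on the length: if [x] spans a simple submodule of [M], then the
    functionals vanishing at [x] come from [M / k x], and the values at [x] are
    killed by a maximal ideal, so they lie on a line ([socle_line]). *)
Lemma kdual_len E (i : {linear K -> E}) n M : ess_top i -> lenle n M -> lenle n (kdual M E).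
Proof.
move=> ei; elim: n M => [|n IH] M Mn.
  apply: lenle_triv => u; apply: kdual_fun_inj => x.
  by rewrite kdual_fun0 (lenle0 Mn x) linear0.
have [M0|Mt] := pselect (trivialm M).
  apply: lenle_leq (leq0n _) _; apply: lenle_triv => u; apply: kdual_fun_inj => x.
  by rewrite kdual_fun0 (M0 x) linear0.
have [x x0 xs] := lenle_simple_ex Mn Mt.
pose m := kerm (mulby x).
have mP s : (s \in m) = (s *: x == 0) by [].
have mm : maximal_ideal m.
  split; first by rewrite mP scale1r; apply/eqP.
  move=> a ma; have [H|/existsNP[c /not_implyP[ca cm]]] := pselect (forall c, c \in a -> c \in m).
    by left=> c; apply/idP/idP; [exact: H|exact: ma].
  right; have [|r rE] := xs c; first by move=> cx; apply: cm; rewrite mP cx.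
  have -> : 1 = (1 - r * c) + r * c by rewrite subrK.
  rewrite rpredD ?ideal_mulr //; apply: ma; rewrite mP scalerBl scale1r -scalerA -rE.
  by rewrite subrr.
have [f fE] := @kdual_map_ex M _ E (pi_lin (imm (mulby x))).
rewrite -[n.+1]addn1; apply: (lenle_exact (f := f) (g := toimm (kdual_eval E x))).
- move=> u /(congr1 sincl); rewrite toimmE linear0 => ux.
  have [h hE] : exists h : {linear quotm (imm (mulby x)) -> E}, forall y, h (pi_lin _ y) = kdual_fun u y.
    apply: factor_surj; first exact: pi_surj.
    move=> y /pi_eq0/immP[c <-]; rewrite mulbyE linearZ_LR.
    by rewrite [kdual_fun u x]ux scaler0.
  have [v vE] := kdual_fun_ex h; exists v; apply: kdual_fun_inj => y; by rewrite fE vE hE.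
- apply: IH; have [||//] := @lenle_quot_proper _ n.+1 _ _ (pi_lin (imm (mulby x))) x x0 _ _ Mn.
    by apply/pi_eq0/immP; exists 1; rewrite mulbyE scale1r.
  exact: pi_surj.
apply: lenle1 => y z y0.
have [u uy] := toimm_surj y; have [v vz] := toimm_surj z.
have km w s : s \in m -> s *: kdual_eval E x w = 0.
  by rewrite mP => /eqP sx; rewrite -[LHS](linearZ_LR (kdual_fun w)) sx linear0.
have [|c cE] := socle_line ei mm (km u) (km v).
  by move=> ux; apply: y0; rewrite -uy; apply: sincl_inj; rewrite toimmE linear0.
by exists c; rewrite -uy -vz; apply: sincl_inj; rewrite linearZ_LR !toimmE cE.
Qed.

(** [E] embeds into [Hom_k(k, E)]. *)
Lemma ess_len E (i : {linear K -> E}) n : ess_top i -> lenle n K -> lenle n E.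
Proof.
move=> ei kn; have /choice[h hE] : forall x : E, exists u : kdual K E, forall c, kdual_fun u c = (c : k) *: x.
  by move=> x; have [u uE] := kdual_fun_ex (mulby x); exists u => c; rewrite uE.
have lh : linear h.
  by move=> a x y; apply: kdual_fun_inj => c; rewrite kdual_fun_linear !hE scalerDr !scalerA mulrC.
apply: (lenle_inj (f := mklin lh)) (kdual_len ei kn) => x y /(congr1 (fun u => kdual_fun u 1)).
by rewrite [LHS]hE [RHS]hE !scale1r.
Qed.

Lemma inj_env_top_ess J : inj_env_top J -> exists i : {linear K -> J}, ess_top i.
Proof. by move=> [_ [i [irad iess]]]; exists i. Qed.

(** The lengths of the essential extensions of [k / rad k] are bounded by that
    of [k]; one of maximal length has no proper essential extension.  It is
    therefore a direct summand of every module containing it: divide by a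
    submodule maximal with zero intersection.  Splitting a pushout along an ideal
    then verifies Baer's test. *)
Lemma inj_env_top_ex : exists J : lmodType k, inj_env_top J.
Proof.
have [N kN] := artin_finlen k_art.
pose Q n := `[< exists E (i : {linear K -> E}), ess_top i /\
  (lenle n E /\ forall p, lenle p E -> (n <= p)%N) >].
have exQ : exists n, Q n.
  pose i : {linear K -> quotm radk} := pi_lin radk.
  have ei : ess_top i.
    split; first by move=> a; rewrite /i pi_eq0; split=> [/mksubP|H]; [|exact/mksubP].
    move=> L HL u; apply/idP/eqP=> [uL|->]; last by rewrite rpred0.
    by have [a au] := pi_surj u; rewrite -au; apply: HL; rewrite au.
  have [n En nmin] := finlen_min (ex_intro _ N (ess_len ei kN)).
  by exists n; apply/asboolP; exists (quotm radk), i.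
have ubQ n : Q n -> (n <= N)%N.
  by move=> /asboolP[E [i [ei [_ H]]]]; apply: H; exact: ess_len ei kN.
have [n /asboolP[J [i [ei [Jn Jmin]]]] nmax] := ex_maxnP exQ ubQ.
exists J; split; last by exists i.
(* [J] is a direct summand of every module that contains it *)
have retr (Z : lmodType k) (j : {linear J -> Z}) : injective j ->
    exists r : {linear Z -> J}, forall x, r (j x) = x.
  move=> ji; pose P (L : submodClosed Z) := forall x, j x \in L -> x = 0.
  have [|F U _ FP _ UP|L [LP Lmax]] := @zorn_submod _ _ P (zerom Z).
  - by move=> x /eqP jx; apply: ji; rewrite jx linear0.
  - by move=> x /UP[L FL]; apply: FP.
  pose q := lcomp (pi_lin L) j.
  have qi : injective q.
    by apply: lin_inj0 => x; rewrite lcompE => /pi_eq0; exact: LP.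
  have eq : ess_top (lcomp q i).
    split=> [a|L' HL'].
      rewrite lcompE -(proj1 ei); split=> [H|->]; last by rewrite linear0.
      by apply: qi; rewrite H linear0.
    have HL0 : mpreim q L' =i zerom J.
      apply: (proj2 ei) => a; rewrite mpreimP => /HL'; rewrite lcompE => H.
      by apply: qi; rewrite H linear0.
    move=> u; apply/idP/eqP=> [uL'|->]; last by rewrite rpred0.
    have [z zu] := pi_surj u; rewrite -zu; apply/pi_eq0.
    apply: (Lmax (mpreim (pi_lin L) L')); last by rewrite mpreimP zu.
      move=> x; rewrite mpreimP => qx; apply/eqP.
      by have := HL0 x; rewrite mpreimP qx => /esym.
    by move=> y yL; rewrite mpreimP (proj2 (pi_eq0 _ _) yL) rpred0.
  have [e Ee emin] := finlen_min (ex_intro _ N (ess_len eq kN)).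
  have en : (e <= n)%N by apply: nmax; apply/asboolP; exists (quotm L), (lcomp q i).
  have qs : is_surj q.
    move=> u; apply: contrapT => /forallNP H.
    have [e0 Je] := lenle_proper H qi Ee.
    by have := leq_trans en (Jmin _ Je); rewrite leqNgt ltn_predL e0.
  have [g [qK _]] := bij_inv qi qs.
  by exists (lcomp g (pi_lin L)) => x; rewrite lcompE -[pi_lin L _]/(q x) qK.
apply/ext_injective_mod/baer_criterion => I f.
have [Z [j [w [_ [[ji _ _] jw _]]]]] := pushout f (quotm_short_exact I).
have [r rK] := retr Z j ji.
exists (r (w 1)) => s; rewrite -[f s]rK jw -!linearZ_LR; congr (r (w _)).
by rewrite regE mulr1.
Qed.

Lemma max_ideal_ex (a : submodClosed K) : 1 \notin a ->
  exists2 m, maximal_ideal m & {subset a <= m}.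
Proof.
move=> a1; pose P (m : submodClosed K) := 1 \notin m /\ {subset a <= m}.
have [|F U [N0 FN0] FP _ UP|m [[m1 am] mmax]] := @zorn_submod _ _ P a.
- by split.
- split; first by apply/negP => /UP[N FN]; apply/negP; case: (FP _ FN).
  by move=> x xa; apply/UP; exists N0 => //; case: (FP _ FN0) => _; apply.
exists m => //; split=> // n mn; have [n1|n1] := boolP (1 \in n); [by right|left=> x].
apply/idP/idP; last exact: mn.
by apply: mmax => //; split=> // y /am/mn.
Qed.

(** [x] has a maximal ideal [m] above its annihilator.  With [c] as in
    [coprime_elt], sending [x] to the class of [c] kills the annihilator, because
    [m c] is in the radical. *)
Lemma cogenerator J E (x : E) : inj_env_top J -> x <> 0 ->
  exists phi : {linear E -> J}, phi x <> 0.
Proof.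
move=> Jtop x0; have [Ji [i [irad iess]]] := Jtop.
have [|m mm am] := @max_ideal_ex (kerm (mulby x)).
  by apply/negP => /eqP; rewrite mulbyE scale1r.
have [c cm crad] := coprime_elt mm.
pose f : {linear K -> submod (imm (mulby x))} := toimm (mulby x).
have [h hE] : exists h : {linear submod (imm (mulby x)) -> J},
    forall s, h (f s) = mulby (i c) s.
  apply: factor_surj; first exact: toimm_surj.
  move=> s /(congr1 sincl); rewrite toimmE linear0 => sx.
  rewrite mulbyE -linearZ_LR; apply/irad; rewrite regE; apply: crad.
  by apply: am; apply/eqP.
have [phi phiE] := Ji _ _ sincl h (@sincl_inj _ _ _).
exists phi; have -> : x = sincl (f 1) by rewrite toimmE mulbyE scale1r.
rewrite phiE hE mulbyE scale1r => /irad/(_ m mm); exact/negP.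
Qed.

(** If [y] ranges over all functionals on [U], then [U] embeds into the dual of
    [Y], which embeds into the bidual of [U] and so is not longer than [U]; hence
    the first embedding is onto. *)
Lemma reflexive (J U Y : lmodType k) (b : U -> Y -> J) :
  inj_env_top J -> finlen U ->
  (forall y, linear (b^~ y)) -> (forall u, linear (b u)) ->
  (forall y, (forall u, b u y = 0) -> y = 0) ->
  (forall phi : {linear U -> J}, exists y, forall u, b u y = phi u) ->
  forall psi : {linear Y -> J}, exists u, forall y, b u y = psi y.
Proof.
move=> Jtop Uf bl br sep full psi.
have [n Un nmin] := finlen_min Uf; have [i ei] := inj_env_top_ess Jtop.
have Yn : lenle n (kdual Y J).
  apply: (kdual_len ei).
  have /choice[h hE] : forall y, exists v : kdual U J, forall u, kdual_fun v u = b u y.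
    by move=> y; have [v vE] := kdual_fun_ex (mklin (bl y)); exists v => u; rewrite vE.
  have lh : linear h.
    by move=> a x y; apply: kdual_fun_inj => u; rewrite kdual_fun_linear !hE br.
  apply: (lenle_inj (f := mklin lh)) (kdual_len ei Un).
  apply: lin_inj0 => y hy; apply: sep => u; by rewrite -hE -[h y]/(mklin lh y) hy kdual_fun0.
have /choice[g gE] : forall u, exists v : kdual Y J, forall y, kdual_fun v y = b u y.
  by move=> u; have [v vE] := kdual_fun_ex (mklin (br u)); exists v => y; rewrite vE.
have lg : linear g.
  by move=> a u v; apply: kdual_fun_inj => y; rewrite kdual_fun_linear !gE bl.
have gi : injective (mklin lg).
  apply: lin_inj0 => u gu; apply: contrapT => u0.
  have [phi phiu] := cogenerator Jtop u0; have [y yE] := full phi.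
  by apply: phiu; rewrite -yE -gE -[g u]/(mklin lg u) gu kdual_fun0.
have [v vE] := kdual_fun_ex psi.
have [u uv] : exists u, mklin lg u = v.
  apply: contrapT => /forallNP H; have [n0 Un1] := lenle_proper H gi Yn.
  by have := nmin _ Un1; rewrite leqNgt ltn_predL n0.
by exists u => y; rewrite -gE -[g u]/(mklin lg u) uv vE.
Qed.

(** The same when only the functionals vanishing on the left kernel of [b] are
    values of [b]; apply [reflexive] to the quotient by that kernel. *)
Lemma reflexive_mod (J U Y : lmodType k) (b : U -> Y -> J) :
  inj_env_top J -> finlen U ->
  (forall y, linear (b^~ y)) -> (forall u, linear (b u)) ->
  (forall y, (forall u, b u y = 0) -> y = 0) ->
  (forall phi : {linear U -> J}, (forall u, (forall y, b u y = 0) -> phi u = 0) ->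
     exists y, forall u, b u y = phi u) ->
  forall psi : {linear Y -> J}, exists u, forall y, b u y = psi y.
Proof.
move=> Jtop [n Un] bl br sep full psi.
have /choice[g gE] : forall u, exists v : kdual Y J, forall y, kdual_fun v y = b u y.
  by move=> u; have [v vE] := kdual_fun_ex (mklin (br u)); exists v => y; rewrite vE.
have lg : linear g.
  by move=> a u v; apply: kdual_fun_inj => y; rewrite kdual_fun_linear !gE bl.
pose U' := quotm (kerm (mklin lg)); pose p : {linear U -> U'} := pi_lin _.
have [g' g'E] : exists g' : {linear U' -> kdual Y J}, forall u, g' (p u) = g u.
  apply: (factor_surj (f := mklin lg)); first exact: pi_surj.
  by move=> x /pi_eq0/eqP.
have b'E u y : kdual_fun (g' (p u)) y = b u y by rewrite g'E gE.
have [|||||u' u'E] := @reflexive J U' Y (fun u' y => kdual_fun (g' u') y) Jtop _ _ _ _ _ psi.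
- by exists n; apply: lenle_surj Un; exact: pi_surj.
- by move=> y a u v; rewrite linearP kdual_fun_linear.
- by move=> u; exact: linearP.
- by move=> y H; apply: sep => u; rewrite -b'E.
- move=> phi; have [|y yE] := full (lcomp phi p).
    move=> u uy; rewrite lcompE (_ : p u = 0) ?linear0 //.
    by apply/pi_eq0/eqP; apply: kdual_fun_inj => y; rewrite kdual_fun0 -[RHS](uy y); exact: gE.
  by exists y => u'; have [u <-] := pi_surj u'; rewrite b'E yE.
by have [u uu'] := pi_surj u'; exists u => y; rewrite -u'E -uu' b'E.
Qed.
End Matlis.

(** * The Auslander-Reiten formula *)

Section ScalarRestriction.
Variables (k : comNzRingType) (S : algType k).
Implicit Types M N X Y P : lmodType S.
Local Notation K := (k^o : lmodType k).

Fact reskl_linear M N (f : {linear M -> N}) : linear (f : resk M -> resk N).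
Proof. by move=> c x y; rewrite !resk_scaleE linearP. Qed.
Definition reskl M N (f : {linear M -> N}) : {linear resk M -> resk N} :=
  mklin (reskl_linear f).

Definition kfin M := finlen (resk M).

Lemma kfin_surj M N (f : {linear M -> N}) : is_surj f -> kfin M -> kfin N.
Proof. by move=> fs [n Mn]; exists n; apply: (lenle_surj (f := reskl f)). Qed.

Lemma kfin_inj M N (f : {linear M -> N}) : injective f -> kfin N -> kfin M.
Proof. by move=> fi [n Mn]; exists n; apply: (lenle_inj (f := reskl f)) Mn. Qed.
Lemma kfin_exact M' M M'' (f : {linear M' -> M}) (g : {linear M -> M''}) :
  (forall x, g x = 0 -> exists y, f y = x) -> kfin M' -> kfin M'' -> kfin M.
Proof.
move=> ex [a Ma] [b Mb]; exists (a + b)%N.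
exact: (lenle_exact (f := reskl f) (g := reskl g)).
Qed.
Lemma kfin_finlen M : kfin M -> finlen M.
Proof.
move=> [n Mn]; exists n => C Cm L.
have C0 i : (0 : resk M) \in C i by exact: (@rpred0 M (C i)).
have CL i (c : k) (x y : resk M) : x \in C i -> y \in C i -> c *: x + y \in C i.
  by move=> xC yC; rewrite resk_scaleE; apply: (@rpredD M (C i)) => //; exact: rpredZ.
pose D i : submodClosed (resk M) := @mksub k (resk M) (fun x => x \in C i) (C0 i) (CL i).
have DP i x : (x \in D i) = (x \in C i) by apply/mksubP/idP.
have Dm i : {subset D i <= D i.+1} by move=> x; rewrite !DP; exact: Cm.
apply: leq_trans (Mn D Dm L); apply: leq_sum => i _.
case H: (jump C i) => //; move/asboolP: H => [x xC xnC].
by have -> // : jump D i; apply/asboolP; exists x; rewrite DP.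
Qed.

Lemma kfin_fg M : kfin M -> fin_gen M.
Proof. by move/kfin_finlen/finlen_fin_gen. Qed.

Section Finite.
Hypothesis S_fin : kfin (S^o : lmodType S).

Lemma kfin_rV n : kfin ('rV[S]_n : lmodType S).
Proof.
apply: rV_exact_ind S_fin => [M M0|M' M M'' f g]; last exact: kfin_exact.
by exists 0%N; exact: lenle_triv.
Qed.

Lemma fg_kfin M : fin_gen M -> kfin M.
Proof. by move=> /fin_gen_surj[n [f fs]]; apply: kfin_surj fs (kfin_rV n). Qed.

Lemma fg_mono M N (f : {linear M -> N}) : injective f -> fin_gen N -> fin_gen M.
Proof. by move=> fi /fg_kfin Nf; apply: kfin_fg; exact: kfin_inj fi Nf. Qed.

Lemma fg_submod M (L : submodClosed M) : fin_gen M -> fin_gen (submod L).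
Proof. exact: fg_mono (@sincl_inj _ _ L). Qed.
End Finite.

(** The linear map underlying an element of the [k]-module [Hom X Y]. *)
Definition hom_fun X Y (u : Hom X Y) : {linear X -> Y} :=
  mklin (elimT (@asboolP _) (valP u) : linear ((\val u : X -> resk Y) : X -> Y)).
Arguments hom_fun : simpl never.
Lemma hom_funE X Y (u : Hom X Y) x : hom_fun u x = (\val u : X -> resk Y) x. Proof. by []. Qed.

Lemma hom_fun_ex X Y (f : {linear X -> Y}) : exists u : Hom X Y, forall x, hom_fun u x = f x.
Proof.
have fl : (f : X -> resk Y) \in @homb k S X Y by apply/asboolP; exact: linearP.
by exists (Sub (f : X -> resk Y) fl) => x; rewrite hom_funE SubK.
Qed.

Lemma hom_fun_linear X Y (c : k) (u v : Hom X Y) x :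
  hom_fun (c *: u + v) x = (c%:A : S) *: hom_fun u x + hom_fun v x.
Proof. by rewrite !hom_funE linearP. Qed.

Lemma hom_fun_inj X Y (u v : Hom X Y) : (forall x, hom_fun u x = hom_fun v x) -> u = v.
Proof. by move=> uv; apply: val_inj; apply: funext => x; rewrite -!hom_funE. Qed.

Lemma hom_fun0 X Y x : hom_fun (0 : Hom X Y) x = 0.
Proof. by rewrite hom_funE linear0. Qed.

(** Evaluation at the dual basis embeds [Hom(P, S)] into a power of [S]. *)
Lemma hom_finlen P : kfin (S^o : lmodType S) -> dual_basis P -> finlen (Hom P (S^o : lmodType S)).
Proof.
move=> Sf [r [p [g pg]]]; have [n rn] := kfin_rV Sf r; exists n.
pose h (u : Hom P (S^o : lmodType S)) : resk ('rV[S]_r : lmodType S) := \row_i hom_fun u (p i).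
have lh : linear h.
  by move=> c u v; rewrite resk_scaleE; apply/rowP => i; rewrite !mxE hom_fun_linear.
apply: (lenle_inj (f := mklin lh)) rn.
apply: lin_inj0 => u hu; apply: hom_fun_inj => x; rewrite hom_fun0 (pg x) linear_sum big1 // => i _.
have hi : hom_fun u (p i) = 0 by have := congr1 (fun v : 'rV[S]_r => v 0 i) hu; rewrite !mxE.
by rewrite linearZ_LR hi scaler0.
Qed.

End ScalarRestriction.
Arguments hom_fun : simpl never.

Section ARFormula.
Variables (k : comNzRingType) (S : algType k).
Implicit Types M N X Y P : lmodType S.
Local Notation K := (k^o : lmodType k).
Local Notation dl P := {linear P -> (S^o : lmodType S)}.

(** What it means for [Y] to be [DTr X], for a projective presentation of [X]:
    [beta] identifies [Y] with the [k]-dual of the cokernel of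
    [Hom(P0, S) -> Hom(P1, S)].  Linear maps with target [S] carry no module
    structure here, so linearity of [beta] in them is stated through pointwise
    equations. *)
Record ARdata X Y (J : lmodType k) := MkARdata {
  ar1 : lmodType S;
  ar0 : lmodType S;
  ard : {linear ar1 -> ar0};
  are : {linear ar0 -> X};
  beta : Y -> (dl ar1) -> J;
  ar_proj0 : projective_mod ar0;
  ar_db1 : dual_basis ar1;
  ar_db0 : dual_basis ar0;
  ar_se : short_exact ard are;
  betaD : forall y (f g h : dl ar1), (forall x, h x = f x + g x) -> beta y h = beta y f + beta y g;
  betaZ : forall (c : k) y (f h : dl ar1), (forall x, h x = (c%:A : S) * f x) ->
    beta y h = c *: beta y f;
  betaYD : forall y y' (f : dl ar1), beta (y + y') f = beta y f + beta y' f;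
  betaS : forall s y (f h : dl ar1), (forall x, h x = (f x : S) * s) -> beta (s *: y) f = beta y h;
  beta_ker : forall y (f : dl ar1) (g : dl ar0), (forall x, f x = g (ard x)) -> beta y f = 0;
  beta_sep : forall y, (forall f, beta y f = 0) -> y = 0;
  beta_full : forall phi : (dl ar1) -> J,
    (forall f g h : dl ar1, (forall x, h x = f x + g x) -> phi h = phi f + phi g) ->
    (forall (c : k) (f h : dl ar1), (forall x, h x = (c%:A : S) * f x) -> phi h = c *: phi f) ->
    (forall (f : dl ar1) (g : dl ar0), (forall x, f x = g (ard x)) -> phi f = 0) ->
    exists y, forall f, beta y f = phi f
}.

Lemma scal_comm M (c : k) (a : S) (x : M) : (c%:A : S) *: (a *: x) = a *: ((c%:A : S) *: x).
Proof. by rewrite !scalerA -scalerAl mul1r -scalerAr mulr1. Qed.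

Section Theory.
Variables (X Y : lmodType S) (J : lmodType k) (D : ARdata X Y J).
Local Notation P1 := (ar1 D).
Local Notation P0 := (ar0 D).
Local Notation d := (@ard _ _ _ D).
Local Notation b := (@beta _ _ _ D).

Lemma beta_ext y (f g : dl P1) : (forall x, f x = g x) -> b y f = b y g.
Proof.
move=> fg; pose z : dl P1 := \0.
rewrite (betaD y (f := f) (g := z) (h := f)); last by move=> x; rewrite addr0.
by rewrite (betaD y (f := f) (g := z) (h := g)) // => x; rewrite addr0 fg.
Qed.

Lemma beta0 y (f : dl P1) : (forall x, f x = 0) -> b y f = 0.
Proof.
move=> f0; apply: (beta_ker y (g := \0)) => x; exact: f0.
Qed.

Lemma beta_sum y n (F : 'I_n -> (dl P1)) (h : dl P1) : (forall x, h x = \sum_i F i x) ->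
  b y h = \sum_i b y (F i).
Proof.
elim: n F h => [|n IH] F h hF.
  by rewrite big_ord0 beta0 // => x; rewrite hF big_ord0.
pose z : dl P1 := \0.
have [h' h'E] : exists h' : dl P1, forall x, h' x = \sum_(i < n) F (fintype.lift ord0 i) x.
  have lh : linear (fun x : P1 => \sum_(i < n) F (fintype.lift ord0 i) x : S^o).
    move=> a x y'; rewrite scaler_sumr -big_split; apply: eq_bigr => i _.
    by rewrite linearP.
  by exists (mklin lh).
rewrite big_ord_recl -(IH (fun i => F (fintype.lift ord0 i)) h' h'E).
by apply: betaD => x; rewrite hF big_ord_recl h'E.
Qed.

Lemma beta_y0 (f : dl P1) : b 0 f = 0.
Proof. by have := betaYD (a := D) 0 0 f; rewrite addr0 => /(congr1 (fun z => z - b 0 f)); rewrite subrr addrK => <-. Qed.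

Lemma beta_ysum n (y : 'I_n -> Y) f : b (\sum_i y i) f = \sum_i b (y i) f.
Proof.
elim: n y => [|n IH] y; first by rewrite !big_ord0 beta_y0.
by rewrite !big_ord_recl betaYD IH.
Qed.

(** The image of [f] and [m] under [Hom(P1, S) x M -> Hom(P1, M)]. *)
Definition rmul (M : lmodType S) (f : dl P1) (m : M) : {linear P1 -> M} := lcomp (mulby m) f.
Lemma rmulE (M : lmodType S) (f : dl P1) (m : M) x : rmul f m x = (f x : S) *: m.
Proof. by []. Qed.

Lemma beta_rmul s y (f : dl P1) : b (s *: y) f = b y (rmul f (s : S^o)).
Proof. by apply: betaS => x; rewrite rmulE. Qed.

Lemma beta_db r (p : 'I_r -> P1) (g : 'I_r -> (dl P1)) :
  (forall x, x = \sum_i (g i x : S) *: p i) ->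
  forall y (f : dl P1), \sum_i b ((f (p i) : S) *: y) (g i) = b y f.
Proof.
move=> pg y f; rewrite (beta_sum y (F := fun i => rmul (g i) (f (p i)))).
  by apply: eq_bigr => i _; rewrite beta_rmul.
by move=> x; rewrite {1}(pg x) linear_sum; apply: eq_bigr => i _; rewrite linearZ_LR rmulE.
Qed.

(** A map [f : M -> Y] pairs with every [g : P1 -> S] as follows:
    [b (f m) g] depends only on the map [x => g(x) m] from [P1] to [M], and it
    vanishes on the maps that extend to [P0].  All of them do. *)
Lemma AR_hom_zero M : ext0 X M -> Hom_zero M Y.
Proof.
move=> XM f m; apply: (beta_sep (a := D)) => g.
have [u uE] := ext0_extends (ar_se D) XM (rmul g m).
have [r [p [gg pg]]] := ar_db1 D.
have [r' [q [h qh]]] := ar_db0 D.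
rewrite -(beta_db pg).
have E i : b ((g (p i) : S) *: f m) (gg i) =
    \sum_j b ((lcomp (h j) d (p i) : S) *: f (u (q j))) (gg i).
  rewrite -beta_ysum -linearZ_LR -rmulE -uE {1}(qh (d (p i))) !linear_sum.
  by congr (b _ _); apply: eq_bigr => j _; rewrite !linearZ_LR lcompE.
rewrite (eq_bigr _ (fun i _ => E i)) exchange_big big1 // => j _.
rewrite (beta_db pg); exact: (beta_ker _ (g := h j)).
Qed.

Hypothesis k_art : artinian_mod K.
Hypothesis Jtop : inj_env_top J.

(** If some [v : P1 -> M] does not extend to [P0], there is a functional [phi]
    on [Hom(P1, M)] that is nonzero at [v] and vanishes on the maps that extend.
    For fixed [m] the functional [g |-> phi (g(-) m)] on [Hom(P1, S)] is an element
    of [Y], which depends linearly on [m].  The resulting map [M -> Y] is nonzero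
    because [v] is a sum of maps of the form [g(-) m]. *)
Lemma AR_ext0 M : Hom_zero M Y -> ext0 X M.
Proof.
move=> MY; apply: (extends_ext0 (@ar_proj0 _ _ _ D) (ar_se D)) => v.
apply: contrapT => nv.
pose A (u : Hom P1 M) := exists w : {linear P0 -> M}, forall x, hom_fun u x = w (d x).
have A0 : A 0 by exists \0 => x; rewrite hom_fun0.
have AL c (u u' : Hom P1 M) : A u -> A u' -> A (c *: u + u').
  move=> [w wE] [w' w'E]; have lw : linear (fun x => (c%:A : S) *: w x + w' x).
    move=> a x y; rewrite (linearP w) (linearP w') scalerDr.
    by rewrite scal_comm addrACA -scalerDr.
  by exists (mklin lw) => x; rewrite hom_fun_linear wE w'E.
have [v' v'E] := hom_fun_ex v.
have [|phi phiv] := @cogenerator k k_art J (quotm (mksub A0 AL)) (pi_lin _ v') Jtop.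
  by move/pi_eq0/mksubP => [w wE]; apply: nv; exists w => x; rewrite -wE v'E.
have /choice[toh tohE] : forall f : {linear P1 -> M}, exists u : Hom P1 M, forall x, hom_fun u x = f x.
  by move=> f; exact: hom_fun_ex.
pose Phi f := phi (pi_lin (mksub A0 AL) (toh f)).
have PhiD (f g h : {linear P1 -> M}) : (forall x, h x = f x + g x) -> Phi h = Phi f + Phi g.
  move=> hfg; rewrite /Phi -!linearD; congr (phi (pi_lin _ _)).
  by apply: hom_fun_inj => x; rewrite -[toh f]scale1r hom_fun_linear !tohE hfg !scale1r.
have PhiZ (c : k) (f h : {linear P1 -> M}) : (forall x, h x = (c%:A : S) *: f x) -> Phi h = c *: Phi f.
  move=> hf; rewrite /Phi -!linearZ_LR; congr (phi (pi_lin _ _)).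
  by apply: hom_fun_inj => x; rewrite -[c *: _]addr0 hom_fun_linear !tohE hf hom_fun0 addr0.
have Phi_ext (f g : {linear P1 -> M}) : (forall x, f x = g x) -> Phi f = Phi g.
  by move=> fg; congr (phi (pi_lin _ _)); apply: hom_fun_inj => x; rewrite !tohE.
have PhiK (f : {linear P1 -> M}) (w : {linear P0 -> M}) : (forall x, f x = w (d x)) -> Phi f = 0.
  move=> fw; rewrite /Phi (_ : pi_lin _ _ = 0) ?linear0 //.
  by apply/pi_eq0/mksubP; exists w => x; rewrite tohE fw.
(* the map [M -> Y] adjoint to [Phi] *)
have /choice[F FE] : forall m, exists y, forall g, b y g = Phi (rmul g m).
  move=> m; apply: (beta_full (a := D)).
  - by move=> f g h hfg; apply: PhiD => x; rewrite !rmulE hfg scalerDl.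
  - by move=> c f h hf; apply: PhiZ => x; rewrite !rmulE hf scalerA.
  - by move=> f g fg; apply: (PhiK _ (lcomp (mulby m) g)) => x; rewrite rmulE fg.
have lF : linear F.
  move=> s m m'; apply/eqP; rewrite -subr_eq0; apply/eqP; apply: (beta_sep (a := D)) => g.
  have bN y : b (- y) g = - b y g.
    by apply/eqP; rewrite -addr_eq0 -betaYD addNr beta_y0.
  rewrite betaYD bN betaYD beta_rmul !FE.
  rewrite (PhiD (rmul (rmul g (s : S^o)) m) (rmul g m')) ?subrr // => x.
  by rewrite !rmulE scalerDr scalerA.
have [r [p [g pg]]] := ar_db1 D.
have PhiS n (G : 'I_n -> {linear P1 -> M}) (h : {linear P1 -> M}) :
    (forall x, h x = \sum_i G i x) -> Phi h = \sum_i Phi (G i).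
  elim: n G h => [|n IH] G h hG.
    by rewrite big_ord0; apply: (PhiK _ \0) => x; rewrite hG big_ord0.
  have [h' h'E] : exists h' : {linear P1 -> M}, forall x, h' x = \sum_(i < n) G (fintype.lift ord0 i) x.
    have lh : linear (fun x : P1 => \sum_(i < n) G (fintype.lift ord0 i) x).
      move=> a x y; rewrite scaler_sumr -big_split; apply: eq_bigr => i _.
      by rewrite linearP.
    by exists (mklin lh).
  rewrite big_ord_recl -(IH (fun i => G (fintype.lift ord0 i)) h' h'E).
  by apply: PhiD => x; rewrite hG big_ord_recl h'E.
apply: phiv; rewrite (_ : pi_lin _ v' = pi_lin _ (toh v)); last first.
  by congr (pi_lin _ _); apply: hom_fun_inj => x; rewrite tohE v'E.
rewrite -/(Phi v) (PhiS _ (fun i => rmul (g i) (v (p i)))); last first.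
  by move=> x; rewrite {1}(pg x) linear_sum; apply: eq_bigr => i _; rewrite linearZ_LR rmulE.
rewrite big1 // => i _; rewrite -FE -[F _]/(mklin lF _) MY beta_y0 //.
Qed.

Hypothesis S_fin : kfin (S^o : lmodType S).

Let bh (u : Hom P1 (S^o : lmodType S)) (y : resk Y) : J := b y (hom_fun u).

Let bh_linearl y : linear (bh^~ y).
Proof.
move=> c u v; rewrite /bh; pose z : dl P1 := \0.
have [w wE] := hom_fun_ex (hom_fun (c *: u)).
rewrite (betaD y (f := hom_fun (c *: u)) (g := hom_fun v)); last first.
  by move=> x; rewrite hom_fun_linear -[c *: u]addr0 hom_fun_linear hom_fun0 addr0.
congr (_ + _); apply: betaZ => x.
by rewrite -[c *: u]addr0 hom_fun_linear hom_fun0 addr0.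
Qed.

Let bh_linearr u : linear (bh u).
Proof.
move=> c y y'; rewrite /bh resk_scaleE betaYD; congr (_ + _).
rewrite beta_rmul; apply: betaZ => x; rewrite rmulE.
by rewrite [LHS]/GRing.scale /= -scalerAl mul1r -scalerAr mulr1.
Qed.

(** [Y] embeds into the dual of [Hom(P1, S)]. *)
Lemma AR_kfin : kfin Y.
Proof.
have [n Hn] := hom_finlen S_fin (ar_db1 D); have [i ei] := inj_env_top_ess Jtop.
exists n.
have /choice[h hE] : forall y : resk Y, exists v : kdual (Hom P1 (S^o : lmodType S)) J,
    forall u, kdual_fun v u = bh u y.
  by move=> y; have [v vE] := kdual_fun_ex (mklin (bh_linearl y)); exists v => u; rewrite vE.
have lh : linear h.
  by move=> a x y; apply: kdual_fun_inj => u; rewrite kdual_fun_linear !hE bh_linearr.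
apply: (@lenle_inj _ n (resk Y) _ (mklin lh) _ (kdual_len ei Hn)).
apply: lin_inj0 => y hy; apply: (beta_sep (a := D)) => f.
have [u uE] := hom_fun_ex f.
by rewrite -(beta_ext y uE) -[LHS]/(bh u y) -hE -[h y]/(mklin lh y) hy kdual_fun0.
Qed.

(** The [k]-linear functionals on [Y] are all evaluations, by reflexivity. *)
Lemma beta_reflexive (psi : {linear resk Y -> J}) :
  exists f : dl P1, forall y : Y, b y f = psi y.
Proof.
have [||u uE] := reflexive_mod k_art Jtop (hom_finlen S_fin (ar_db1 D))
  bh_linearl bh_linearr _ _ psi; last by exists (hom_fun u).
- move=> y H; apply: (beta_sep (a := D)) => f.
  by have [u uE] := hom_fun_ex f; rewrite -(beta_ext y uE); exact: H.
move=> phi phiK.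
have /choice[toh tohE] : forall f : dl P1, exists u : Hom P1 (S^o : lmodType S), forall x, hom_fun u x = f x.
  by move=> f; exact: hom_fun_ex.
have [|||y yE] := @beta_full _ _ _ D (fun f => phi (toh f)).
- move=> f g h hfg; rewrite -linearD; congr (phi _); apply: hom_fun_inj => x.
  by rewrite -[toh f]scale1r hom_fun_linear !tohE hfg !scale1r.
- move=> c f h hf; rewrite -linearZ_LR; congr (phi _); apply: hom_fun_inj => x.
  by rewrite -[c *: _]addr0 hom_fun_linear !tohE hf hom_fun0 addr0.
- move=> f g fg; apply: phiK => y; rewrite /bh (beta_ext y (g := f)); last exact: tohE.
  exact: beta_ker fg.
exists y => u; rewrite /bh yE; congr (phi _); apply: hom_fun_inj => x; exact: tohE.
Qed.

(** [Y] sees all of the cokernel of [Hom(P0, S) -> Hom(P1, S)], because [J]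
    is a cogenerator. *)
Lemma beta_zero_extends (f : dl P1) : (forall y, b y f = 0) ->
  exists g : dl P0, forall x, f x = g (d x).
Proof.
move=> fY; apply: contrapT => nf.
pose A (u : Hom P1 (S^o : lmodType S)) := exists w : dl P0, forall x, hom_fun u x = w (d x).
have A0 : A 0 by exists \0 => x; rewrite hom_fun0.
have AL c u u' : A u -> A u' -> A (c *: u + u').
  move=> [w wE] [w' w'E]; have lw : linear (fun x => (c%:A : S) *: w x + w' x : S^o).
    move=> a x y; rewrite (linearP w) (linearP w') scalerDr.
    by rewrite scal_comm addrACA -scalerDr.
  by exists (mklin lw) => x; rewrite hom_fun_linear wE w'E.
have [f' f'E] := hom_fun_ex f.
have [|phi phif] := @cogenerator k k_art J (quotm (mksub A0 AL)) (pi_lin _ f') Jtop.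
  by move/pi_eq0/mksubP => [w wE]; apply: nf; exists w => x; rewrite -wE f'E.
have /choice[toh tohE] : forall f : dl P1, exists u : Hom P1 (S^o : lmodType S), forall x, hom_fun u x = f x.
  by move=> g; exact: hom_fun_ex.
have [|||y yE] := @beta_full _ _ _ D (fun f => phi (pi_lin (mksub A0 AL) (toh f))).
- move=> g g' h hfg; rewrite -!linearD; congr (phi (pi_lin _ _)); apply: hom_fun_inj => x.
  by rewrite -[toh g]scale1r hom_fun_linear !tohE hfg !scale1r.
- move=> c g h hf; rewrite -!linearZ_LR; congr (phi (pi_lin _ _)); apply: hom_fun_inj => x.
  by rewrite -[c *: _]addr0 hom_fun_linear !tohE hf hom_fun0 addr0.
- move=> g w gw; rewrite (_ : pi_lin _ _ = 0) ?linear0 //.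
  by apply/pi_eq0/mksubP; exists w => x; rewrite tohE gw.
apply: phif; rewrite -(fY y) yE; congr (phi (pi_lin _ _)).
by apply: hom_fun_inj => x; rewrite f'E tohE.
Qed.

End Theory.
End ARFormula.

(** * Indecomposable modules and presentations *)

Section Indec.
Variable S : nzRingType.
Implicit Types M N P Q T X Y : lmodType S.

(** A module is the direct sum of the kernel and the image of an
    idempotent. *)
Lemma indec_idem M (a : {linear M -> M}) : indecomposable_mod M ->
  (forall x, a (a x) = a x) -> (forall x, a x = 0) \/ (forall x, a x = x).
Proof.
move=> [Mt Mi] aa.
have [f fE] : exists f : {linear M -> submod (kerm a)}, forall x, sincl (f x) = x - a x.
  apply: (factor_inj (f := (idfun : {linear M -> M}) \- a)); first exact: sincl_inj.
  by move=> x; apply: sincl_ex; apply/eqP; rewrite /= linearB aa subrr.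
have lh : linear (fun x => (f x, toimm a x)).
  by move=> c x y; rewrite !linearP.
have iso : isom M (submod (kerm a) * submod (imm a))%type.
  apply: (isom_of (f := mklin lh)).
    apply: lin_inj0 => x hx.
    have fx : f x = 0 := congr1 fst hx; have ax : toimm a x = 0 := congr1 snd hx.
    move: (congr1 sincl fx); rewrite fE -(toimmE a x) ax !linear0.
    by rewrite addr0.
  move=> [u v]; have /immP[w wv] := sinclP v.
  have au : a (sincl u) = 0 by apply/eqP; exact: (sinclP u).
  exists (sincl u + sincl v); apply: injective_projections; apply: sincl_inj.
    by rewrite [LHS]fE linearD au add0r -wv aa addrK.
  by rewrite [LHS]toimmE linearD au add0r -wv aa.
case: (Mi _ _ iso) => H; [right|left] => x.
  apply/eqP; rewrite eq_sym -subr_eq0 -fE (H (f x)); exact/eqP/linear0.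
by rewrite -toimmE (H (toimm a x)) linear0.
Qed.

Lemma indec_split_epi M N (f : {linear M -> N}) (s : {linear N -> M}) :
  indecomposable_mod M -> cancel s f -> ~ trivialm N -> cancel f s.
Proof.
move=> Mi sf Nt.
have [|H|H] := @indec_idem M (lcomp s f) Mi; first by move=> x; rewrite !lcompE sf.
  case: Nt => y; rewrite -[y]sf -[s y]/(s y) -(sf y) -[X in f X]/(lcomp s f (s y)).
  by rewrite lcompE sf -{1}[y]sf -[s (f (s y))]/(lcomp s f (s y)) H linear0.
by move=> x; rewrite -[LHS]/(lcomp s f x) H.
Qed.
Lemma not_Hom_zero M N (f : {linear M -> N}) : ~ (forall x, f x = 0) -> ~ trivialm (submod (imm f)).
Proof. by move=> f0 t; apply: f0 => x; rewrite -toimmE (t (toimm f x)) linear0. Qed.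

Section Hered.
Hypothesis hered : left_hereditary S.

(** The image of [f] is projective, so it is a direct summand of [T], hence all
    of it. *)
Lemma indec_to_proj T P (f : {linear T -> P}) : indecomposable_mod T -> projective_mod P ->
  ~ (forall x, f x = 0) -> projective_mod T.
Proof.
move=> Ti Pp f0; have ip := submod_proj hered (N := imm f) Pp.
have [s sK] := proj_section ip (@toimm_surj _ _ _ f).
have fK := indec_split_epi Ti sK (not_Hom_zero f0).
exact: proj_retract fK ip.
Qed.

Lemma nonproj_zero T P (f : {linear T -> P}) : indecomposable_mod T -> ~ projective_mod T ->
  projective_mod P -> forall x, f x = 0.
Proof.
by move=> Ti Tn Pp; apply: contrapT => f0; apply: Tn; exact: indec_to_proj f0.
Qed.

(** A map of presentations that is null-homotopic on [P1] induces a map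
    [T -> Y] that factors through the projective module [Q0]; such maps vanish
    when [T] is indecomposable and not projective. *)
Lemma stable_zero T Y P1 P0 (Q1 Q0 : lmodType S) (d : {linear P1 -> P0}) (e : {linear P0 -> T})
    (d' : {linear Q1 -> Q0}) (e' : {linear Q0 -> Y})
    (f : {linear T -> Y}) (f0 : {linear P0 -> Q0}) (f1 : {linear P1 -> Q1}) (u : {linear P0 -> Q1}) :
  short_exact d e -> short_exact d' e' -> projective_mod Q0 ->
  indecomposable_mod T -> ~ projective_mod T ->
  (forall x, e' (f0 x) = f (e x)) -> (forall x, d' (f1 x) = f0 (d x)) ->
  (forall x, u (d x) = f1 x) -> forall x, f x = 0.
Proof.
move=> [_ es ex] [_ _ ex'] Q0p Ti Tn H0 H1 ud.
pose q := f0 \- lcomp d' u : {linear P0 -> Q0}.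
have [w wE] : exists w : {linear T -> Q0}, forall x, w (e x) = q x.
  apply: factor_surj => // x /ex[y <-].
  by rewrite /q /= ?lcompE ud H1 subrr.
move=> x; have [x0 <-] := es x; rewrite -H0.
have : w (e x0) = 0 by exact: nonproj_zero.
rewrite wE /q /= => /eqP; rewrite subr_eq0 => /eqP ->.
by apply/ex'; exists (u x0).
Qed.

Lemma lift_pres T Y P1 P0 (Q1 Q0 : lmodType S) (d : {linear P1 -> P0}) (e : {linear P0 -> T})
    (d' : {linear Q1 -> Q0}) (e' : {linear Q0 -> Y}) (f : {linear T -> Y}) :
  projective_mod P0 -> short_exact d e -> short_exact d' e' ->
  exists (f0 : {linear P0 -> Q0}) (f1 : {linear P1 -> Q1}),
  (forall x, e' (f0 x) = f (e x)) /\ (forall x, d' (f1 x) = f0 (d x)).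
Proof.
move=> P0p [_ _ ex] [di' es' ex'].
have [f0 f0E] := P0p _ _ e' (lcomp f e) es'.
have [f1 f1E] : exists f1 : {linear P1 -> Q1}, forall x, d' (f1 x) = lcomp f0 d x.
  apply: factor_inj => // x; apply/ex'; rewrite lcompE f0E lcompE.
  by rewrite (_ : e (d x) = 0) ?linear0 //; apply/ex; exists x.
by exists f0, f1.
Qed.

(** By means of a dual basis of [Q], a map to [Q] extends along [d] as soon as
    all functionals composed with it do. *)
Lemma factor_of_functionals P1 P0 Q (d : {linear P1 -> P0}) (f : {linear P1 -> Q}) :
  dual_basis Q ->
  (forall g : {linear Q -> S^o}, exists h : {linear P0 -> S^o}, forall x, g (f x) = h (d x)) ->
  exists u : {linear P0 -> Q}, forall x, u (d x) = f x.
Proof.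
move=> [r [q [g qg]]] H.
have /choice[h hE] : forall i, exists h : {linear P0 -> S^o}, forall x, g i (f x) = h (d x).
  by move=> i; exact: H.
have lu : linear (fun x => \sum_i (h i x : S) *: q i).
  move=> a x y; rewrite scaler_sumr -big_split; apply: eq_bigr => i _.
  by rewrite linearP scalerDl -scalerA.
exists (mklin lu) => x; rewrite mklinE [RHS](qg (f x)).
by apply: eq_bigr => i _; rewrite hE.
Qed.

Lemma essential_fg P M (f : {linear P -> M}) :
  (forall L : submodClosed P, (forall x, exists2 y, y \in L & f y = f x) -> L =i fullm P) ->
  fin_gen (submod (imm f)) -> fin_gen P.
Proof.
move=> fess /fin_gen_surj[n [g gs]]; apply/fin_gen_surj.
have [h hE] := @rV_proj S n _ _ (toimm f) g (@toimm_surj _ _ _ f).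
exists n, h => x; suff /immP : x \in imm h by [].
rewrite fess // => y; have [v vE] := gs (toimm f y).
exists (h v); first exact: imm_f.
by rewrite -[LHS]toimmE hE vE.
Qed.

End Hered.
End Indec.

Section ARIndec.
Variables (k : comNzRingType) (S : algType k).
Implicit Types M N P Q T X Y : lmodType S.
Hypothesis k_art : artinian_mod (k^o : lmodType k).
Hypothesis S_fin : kfin (S^o : lmodType S).
Hypothesis hered : left_hereditary S.

(** A projective module of minimal length mapping onto [M]: a proper submodule
    that still maps onto [M] would be projective and shorter. *)
Lemma proj_cover M : fin_gen M -> exists (P : lmodType S) (e : {linear P -> M}),
  [/\ projective_mod P, fin_gen P & essential_epi e].
Proof.
move=> Mf.
pose Q n := `[< exists (P : lmodType S) (e : {linear P -> M}),
   [/\ projective_mod P, is_surj e & lenle n P] >].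
have exQ : exists n, Q n.
  have [n [f fs]] := proj1 (fin_gen_surj M) Mf.
  have [m nm] := kfin_finlen (kfin_rV S_fin n).
  by exists m; apply/asboolP; exists ('rV[S]_n), f; split=> //; exact: rV_proj.
have [n /asboolP[P [e [Pp es Pn]]] nmin] := ex_minnP exQ.
exists P, e; split=> //; first by apply: finlen_fin_gen; exists n.
split=> // L eL x; rewrite [RHS](_ : _ = true) //; apply/negPn/negP => xL.
have [|n0 Ln] := lenle_proper (f := @sincl _ _ L) (y := x) _ (@sincl_inj _ _ L) Pn.
  by move=> u ux; case/negP: xL; rewrite -ux; exact: sinclP.
have : Q n.-1.
  apply/asboolP; exists (submod L), (lcomp e sincl); split=> //.
    exact: submod_proj.
  move=> y; have [z <-] := es y; have [w /sincl_ex[u <-] <-] := eL z.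
  by exists u.
by move/nmin; rewrite leqNgt ltn_predL n0.
Qed.

Section TwoPres.
Variables (T T' : lmodType S) (J : lmodType k) (D : ARdata T T' J).
Hypothesis Jtop : inj_env_top J.
Hypotheses (Ti : indecomposable_mod T) (Tn : ~ projective_mod T).
Local Notation P1 := (ar1 D).
Local Notation P0 := (ar0 D).
Local Notation d := (@ard _ _ _ _ _ D).
Local Notation e := (@are _ _ _ _ _ D).
Local Notation b := (@beta _ _ _ _ _ D).

(** This is how vanishing of the pairing is turned into a homotopy, to which
    [stable_zero] applies. *)
Lemma beta_zero_factor Q (f : {linear P1 -> Q}) : dual_basis Q ->
  (forall y (g : {linear Q -> S^o}), b y (lcomp g f) = 0) ->
  exists u : {linear P0 -> Q}, forall x, u (d x) = f x.
Proof.
move=> Qd H; apply: factor_of_functionals => // g.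
by have [h hE] := beta_zero_extends k_art Jtop (fun y => H y g); exists h.
Qed.

Lemma DTr_nontrivial : ~ trivialm T'.
Proof.
move=> t; have [|u uE] := @beta_zero_factor P1 (idfun : {linear P1 -> P1}) (ar_db1 D).
  by move=> y g; rewrite (t y) beta_y0.
case: Ti => Tt _; apply: Tt => x.
exact: (@stable_zero _ hered T T P1 P0 P1 P0 d e d e (idfun : {linear T -> T})
  (idfun : {linear P0 -> P0}) (idfun : {linear P1 -> P1}) u (ar_se D) (ar_se D) (@ar_proj0 _ _ _ _ _ D)).
Qed.

(** An idempotent of [T'] induces, by duality, an endomorphism of
    [Hom(P1, S)] modulo the maps from [P0], hence one of [P1], one of [P0], and an
    endomorphism [a] of [T], idempotent by [stable_zero].  So [a] is zero or the
    identity.  Either way the endomorphism of [P1] is homotopic to zero or to the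
    identity, and the idempotent of [T'] is zero or the identity. *)
Lemma DTr_indec_idem (ep : {linear T' -> T'}) : (forall y, ep (ep y) = ep y) ->
  (forall y, ep y = 0) \/ (forall y, ep y = y).
Proof.
move=> ep2; have [r [p [g pg]]] := ar_db1 D.
have /choice[f fE] : forall i, exists f : {linear P1 -> (S^o : lmodType S)},
    forall y, b y f = b (ep y) (g i).
  move=> i; have lpsi : linear (fun y : resk T' => b (ep y) (g i)).
    move=> c y y'; rewrite resk_scaleE linearP betaYD; congr (_ + _).
    rewrite beta_rmul; apply: betaZ => x; rewrite rmulE.
    by rewrite [LHS]/GRing.scale /= -scalerAl mul1r -scalerAr mulr1.
  by have [f fE] := beta_reflexive D k_art Jtop S_fin (mklin lpsi); exists f => y; rewrite fE.
have lal : linear (fun x => \sum_i (f i x : S) *: p i).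
  move=> a x y; rewrite scaler_sumr -big_split; apply: eq_bigr => i _.
  by rewrite linearP scalerDl -scalerA.
(* the endomorphism of [P1] adjoint to [ep], by the dual basis *)
pose al : {linear P1 -> P1} := mklin lal.
have bal y h : b y (lcomp h al) = b (ep y) h.
  rewrite (beta_sum y (F := fun i => rmul (f i) (h (p i)))); last first.
    move=> x; rewrite lcompE /al mklinE linear_sum; apply: eq_bigr => i _.
    by rewrite linearZ_LR rmulE.
  rewrite -(beta_db pg); apply: eq_bigr => i _.
  by rewrite -beta_rmul fE linearZ_LR.
have [|al0 al0E] := @beta_zero_factor P0 (lcomp d al) (ar_db0 D).
  move=> y h; rewrite (beta_ext _ (g := lcomp (lcomp h d) al)) // bal.
  exact: (beta_ker _ (g := h)).
have [di es ex] := ar_se D.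
have [a aE] : exists a : {linear T -> T}, forall x, a (e x) = lcomp e al0 x.
  apply: factor_surj => // x /ex[y <-]; rewrite lcompE al0E lcompE.
  by apply/ex; exists (al y).
pose ga := lcomp al al \- al : {linear P1 -> P1}.
have [|u uE] := @beta_zero_factor P1 ga (ar_db1 D).
  move=> y h.
  have E : b y (lcomp (lcomp h al) al) = b y (lcomp h ga) + b y (lcomp h al).
    by apply: betaD => x; rewrite ?lcompE /ga /= linearB subrK.
  by move: E; rewrite !bal ep2 => /eqP; rewrite eq_sym -subr_eq0 addrK => /eqP.
have aa x : a (a x) = a x.
  apply/eqP; rewrite -subr_eq0; apply/eqP.
  apply: (@stable_zero _ hered T T P1 P0 P1 P0 d e d e (lcomp a a \- a : {linear T -> T})
    (lcomp al0 al0 \- al0 : {linear P0 -> P0}) ga u (ar_se D) (ar_se D) (@ar_proj0 _ _ _ _ _ D)) => // z.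
    by rewrite /= linearB !aE.
  by rewrite /ga /= linearB !al0E.
have [a0|a1] := indec_idem Ti aa; [left|right] => y.
  apply: (beta_sep (a := D)) => h.
  have [w wE] : exists w : {linear P0 -> P1}, forall x, d (w x) = al0 x.
    by apply: factor_inj => // x; apply/ex; rewrite -[LHS]/(lcomp e al0 x) -aE a0.
  rewrite -bal; apply: (beta_ker _ (g := lcomp h w)) => x; rewrite !lcompE; congr (h _).
  by apply: di; rewrite wE al0E.
have [w wE] : exists w : {linear P0 -> P1}, forall x, d (w x) = (al0 \- idfun : {linear P0 -> P0}) x.
  apply: factor_inj => // x; apply/ex; rewrite /= linearB.
  by rewrite -[e (al0 x)]/(lcomp e al0 x) -aE a1 subrr.
apply/eqP; rewrite -subr_eq0; apply/eqP; apply: (beta_sep (a := D)) => h.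
have bN y' : b (- y') h = - b y' h.
  by apply/eqP; rewrite -addr_eq0 -betaYD addNr beta_y0.
rewrite betaYD bN -bal; apply/eqP; rewrite subr_eq0; apply/eqP.
rewrite (betaD y (f := lcomp h (lcomp w d)) (g := h)); last first.
  move=> x; rewrite !lcompE -linearD; congr (h _); apply: di.
  by rewrite linearD wE /= subrK al0E.
rewrite (beta_ker _ (g := lcomp h w)) ?add0r // => x; by rewrite !lcompE.
Qed.

Lemma DTr_indec : indecomposable_mod T'.
Proof.
split; first exact: DTr_nontrivial.
move=> A B [f fb]; have [g [fK gK]] := bij_inv (bij_inj fb) (bij_surj fb).
pose ep := lcomp g (lcomp (inl_lin A B) (lcomp (fst_lin A B) f)).
have epE y : f (ep y) = ((f y).1, 0) by rewrite /ep !lcompE gK.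
have [|H|H] := @DTr_indec_idem ep.
- by move=> y; apply: (bij_inj fb); rewrite !epE.
- left=> a; have := congr1 f (H (g (a, 0))).
  by rewrite epE gK linear0 => /(congr1 fst).
right=> b'; have := congr1 f (H (g (0, b'))).
by rewrite epE gK => /(congr1 snd).
Qed.

End TwoPres.
End ARIndec.

(** * Dual modules, transposes and the translate *)

Section Dual.
Variables (k : comNzRingType) (A B : algType k) (o : A -> B).
Hypothesis oD : forall x y, o (x + y) = o x + o y.
Hypothesis o1 : o 1 = 1.
Hypothesis oM : forall x y, o (x * y) = o y * o x.
Variables (N : lmodType B) (J : lmodType k).

Definition dualT : Type := kdual (resk N) J.
HB.instance Definition _ := GRing.Zmodule.copy dualT (kdual (resk N) J).

Definition dualv (y : dualT) : {linear resk N -> J} := kdual_fun (y : kdual (resk N) J).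
Arguments dualv : simpl never.

Lemma dualv_inj (y y' : dualT) : (forall n, dualv y n = dualv y' n) -> y = y'.
Proof. exact: kdual_fun_inj. Qed.
Lemma dualv_ex (f : {linear resk N -> J}) : exists y : dualT, forall n, dualv y n = f n.
Proof. exact: kdual_fun_ex. Qed.
Lemma dualvD (y y' : dualT) n : dualv (y + y') n = dualv y n + dualv y' n.
Proof.
have := kdual_fun_linear 1 (y : kdual (resk N) J) (y' : kdual (resk N) J) n.
by rewrite !scale1r.
Qed.

Let act_ex (a : A) (y : dualT) : exists y', forall n : N, dualv y' n = dualv y (o a *: n).
Proof.
have lf : linear (fun n : resk N => dualv y ((o a *: (n : N)) : resk N)).
  move=> c n n'; rewrite resk_scaleE -linearP; congr (dualv y _).
  by rewrite resk_scaleE scalerDr scal_comm.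
by have [y' y'E] := dualv_ex (mklin lf); exists y' => n; rewrite y'E.
Qed.
Let act a y := projT1 (cid (act_ex a y)).
Let actE a y (n : N) : dualv (act a y) n = dualv y (o a *: n).
Proof. by rewrite /act; case: cid. Qed.

(** [Hom_k(N, J)] with the action of [A] through the antihomomorphism
    [o]. *)
Lemma dual_ex : exists (Y : lmodType A) (th : Y -> {linear resk N -> J}),
  [/\ (forall y y' n, th (y + y') n = th y n + th y' n),
      (forall a y (n : N), th (a *: y) n = th y (o a *: n)),
      (forall y y', (forall n, th y n = th y' n) -> y = y') &
      (forall g : {linear resk N -> J}, exists y, forall n, th y n = g n)].
Proof.
have aA a b y : act a (act b y) = act (a * b) y.
  by apply: dualv_inj => n; rewrite !actE oM scalerA.
have a1 : left_id 1 act by move=> y; apply: dualv_inj => n; rewrite actE o1 scale1r.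
have aDr : right_distributive act +%R.
  by move=> a y y'; apply: dualv_inj => n; rewrite !(actE, dualvD).
have aDl y : {morph act^~ y : a b / a + b}.
  move=> a b; apply: dualv_inj => n; rewrite !(actE, dualvD) oD scalerDl.
  exact: (linearD (dualv y)).
pose Y : lmodType A := HB.pack dualT (GRing.Zmodule_isLmodule.Build A dualT aA a1 aDr aDl).
exists Y, dualv; split.
- exact: dualvD.
- by move=> a y n; exact: actE.
- exact: dualv_inj.
- exact: dualv_ex.
Qed.
End Dual.

Lemma kfin_alg (k : comNzRingType) (A : algType k) :
  artinian_mod (k^o : lmodType k) -> fin_gen (A : lmodType k) -> kfin (A^o : lmodType A).
Proof.
move=> k_art /fin_gen_surj[n [f fs]].
have [m Km] := finlen_rV n (artin_finlen k_art).
have lg : linear (f : 'rV[k]_n -> resk (A^o : lmodType A)).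
  move=> c x y; rewrite linearP resk_scaleE; congr (_ + _).
  by rewrite [RHS]/GRing.scale /= -scalerAl mul1r.
exists m; apply: (@lenle_surj _ m _ (resk (A^o : lmodType A)) (mklin lg)) Km.
by move=> y; have [v vE] := fs y; exists v.
Qed.

Section ArtinHereditary.
Variables (k : comNzRingType) (R : algType k).
Hypothesis R_artin : artin_algebra R.
Hypothesis R_hered : hereditary R.
Local Notation S := (R^c).
Implicit Types X Y T : lmodType S.

Let k_art : artinian_mod (k^o : lmodType k). Proof. by case: R_artin. Qed.
Let heredS : left_hereditary S. Proof. by case: R_hered. Qed.
Let heredR : left_hereditary R. Proof. by case: R_hered. Qed.

Lemma kfin_op : kfin (S^o : lmodType S).
Proof.
apply: (kfin_alg k_art); have [n [g gP]] := proj2 R_artin.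
by exists n, g => x; have [c ->] := gP x; exists c.
Qed.

Lemma kfin_ring : kfin (R^o : lmodType R).
Proof. exact: kfin_alg k_art (proj2 R_artin). Qed.

Let of_op (r : S) : R := r.
Let to_op (r : R) : S := r.

(** Over a hereditary ring the first map of a minimal presentation is
    injective: its image is projective, so it splits off, and minimality leaves no
    complement.  The remaining clauses of [ARdata] translate the cokernel property
    of the transpose and the four properties of the dual. *)
Lemma transpose_ARdata X Y (N : lmodType R) (J : lmodType k) (th : Y -> {linear resk N -> J}) :
  fin_gen X -> is_transpose of_op X N -> 
  (forall y y' n, th (y + y') n = th y n + th y' n) ->
  (forall (s : R) y (n : N), th (to_op s *: y) n = th y (s *: n)) ->
  (forall y y', (forall n, th y n = th y' n) -> y = y') ->
  (forall g : {linear resk N -> J}, exists y, forall n, th y n = g n) ->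
  inhabited (ARdata X Y J).
Proof.
move=> Xf [P0 [P1 [e [d [pi [[P0p P1p [es eess] ex dess] piD piS piK pis]]]]]] thD thS thI thF.
have P0f : fin_gen P0.
  by apply: (essential_fg eess); apply: (fg_submod kfin_op).
have [s sK] := proj_section (submod_proj heredS (N := imm d) P0p) (@toimm_surj _ _ _ d).
have dall : imm s =i fullm P1.
  apply: dess => x; exists (s (toimm d x)); first exact: imm_f.
  by rewrite -[LHS]toimmE sK.
have di : injective d.
  apply: lin_inj0 => x dx; have /immP[z zx] : x \in imm s by rewrite dall.
  have z0 : z = 0 by apply: sincl_inj; rewrite -[z]sK zx toimmE dx linear0.
  by rewrite -zx z0 linear0.
have P1f : fin_gen P1 := fg_mono kfin_op di P0f.
have se : short_exact d e by split.
pose bt (y : Y) (f : {linear P1 -> (S^o : lmodType S)}) := th y (pi f).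
have th0 n : th 0 n = 0.
  have := thD 0 0 n; rewrite addr0 => /(congr1 (fun z => z - th 0 n)).
  by rewrite subrr addrK => <-.
constructor.
apply: (@MkARdata k S X Y J P1 P0 d e bt P0p (fgproj_dual_basis P1p P1f)
  (fgproj_dual_basis P0p P0f) se).
- by move=> y f g h hfg; rewrite /bt (piD f g h hfg) linearD.
- move=> c y f h hf; rewrite /bt.
  rewrite (piS (c%:A) f h); last by move=> x; rewrite hf -scalerAl -scalerAr mul1r mulr1.
  by rewrite -(linearZ_LR (th y)).
- by move=> y y' f; exact: thD.
- by move=> s' y f h hf; rewrite /bt (piS s' f h hf) -thS.
- move=> y f g fg; rewrite /bt (_ : pi f = 0); first exact: (linear0 (th y)).
  by apply/piK; exists g.
- move=> y H; apply: thI => n; rewrite th0.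
  by have [f <-] := pis n; exact: H.
move=> phi phiD phiZ phiK.
have phi_eq f f' : pi f = pi f' -> phi f = phi f'.
  move=> ff'; pose g := f \- f' : {linear P1 -> (S^o : lmodType S)}.
  have gE x : f x = g x + f' x by rewrite /g /= subrK.
  have /piK[h hE] : pi g = 0.
    by have := piD g f' f gE; rewrite ff' => /esym/eqP; rewrite -subr_eq0 addrK => /eqP.
  by rewrite (phiD g f' f gE) (phiK g h hE) add0r.
pose sec n := projT1 (cid (pis n)).
have secK n : pi (sec n) = n by rewrite /sec; case: cid.
have lpsi : linear (fun n : resk N => phi (sec n)).
  move=> c n n'; pose f := sec n; pose f' := sec n'.
  have lh : linear (fun x => (c%:A : S) *: f x : S^o).
    by move=> a x y; rewrite linearP scalerDr scal_comm.
  have hE x : mklin lh x = (c%:A : S) * f x by [].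
  pose g := mklin lh \+ f' : {linear P1 -> (S^o : lmodType S)}.
  have gE x : g x = mklin lh x + f' x by [].
  rewrite -(phiZ c f _ hE) -(phiD _ _ _ gE); apply: phi_eq; rewrite secK.
  rewrite (piD _ _ _ gE) secK (piS (c%:A) f (mklin lh)); last first.
    by move=> x; rewrite hE -scalerAl -scalerAr mul1r mulr1.
  by rewrite secK.
have [y yE] := thF (mklin lpsi); exists y => f.
by rewrite /bt yE mklinE; apply: phi_eq; rewrite secK.
Qed.

Lemma DTr_ARdata X Y : fin_gen X -> is_DTr X Y ->
  exists (J : lmodType k) (D : ARdata X Y J), inj_env_top J.
Proof.
move=> Xf [N [tr [J [th [Jtop thD thS thI thF]]]]].
by have [D] := transpose_ARdata Xf tr thD thS thI thF; exists J, D.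
Qed.

(** The transpose of a projective cover.  A dual basis of [P1] presents
    [Hom(P1, S)] as a quotient of a row space over [R], and the quotient of the
    row space by the elements that extend to [P0] is the required cokernel. *)
Lemma transpose_ex X : fin_gen X -> exists N : lmodType R, is_transpose of_op X N.
Proof.
move=> Xf; have [P0 [e [P0p P0f [es eess]]]] := proj_cover kfin_op heredS Xf.
pose P1 := submod (kerm e); pose d : {linear P1 -> P0} := sincl.
have P1p : projective_mod P1 := submod_proj heredS P0p.
have P1f : fin_gen P1 := fg_submod kfin_op (kerm e) P0f.
have [di _ ex] := kerm_short_exact es.
have [r [p [g pg]]] := fgproj_dual_basis P1p P1f.
pose sm (c : 'rV[R]_r) x : S := \sum_i (g i x : S) * (c 0 i : S).
have lsm c : linear (sm c : P1 -> S^o).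
  move=> a x y; rewrite /sm scaler_sumr -big_split; apply: eq_bigr => i _.
  by rewrite linearP [LHS]mulrDl -[LHS]/(_ + _); congr (_ + _); rewrite -mulrA.
have smD (a : R) c c' x : sm (a *: c + c') x = sm c x * (a : S) + sm c' x.
  rewrite /sm mulr_suml -big_split; apply: eq_bigr => i _.
  rewrite !mxE [LHS](@mulrDr S); congr (_ + _).
  exact: (@mulrA S).
pose A (c : 'rV[R]_r) := exists h : {linear P0 -> (S^o : lmodType S)}, forall x, sm c x = h (d x).
have A0 : A 0.
  exists \0 => x; rewrite /sm big1 // => i _; rewrite mxE; exact: (mulr0 (g i x : S)).
have AL a c c' : A c -> A c' -> A (a *: c + c').
  move=> [h hE] [h' h'E].
  exists (lcomp (mulby ((a : S) : S^o)) h \+ h' : {linear P0 -> (S^o : lmodType S)}) => x.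
  by rewrite smD hE h'E.
pose L : submodClosed ('rV[R]_r : lmodType R) := mksub A0 AL.
pose rw (f : {linear P1 -> (S^o : lmodType S)}) : 'rV[R]_r := \row_i (f (p i) : R).
have smrw f x : sm (rw f) x = f x.
  rewrite {2}(pg x) linear_sum; apply: eq_bigr => i _.
  by rewrite linearZ_LR mxE.
exists (quotm L), P0, P1, e, d, (fun f => pi_lin L (rw f)); split.
- split=> //.
  move=> M HM x; have [y yM dy] := HM x.
  by rewrite -(di _ _ dy) yM.
- move=> f f' h hE; rewrite -linearD; congr (pi_lin L _).
  by apply/rowP => i; rewrite !mxE hE.
- move=> s f h hE; rewrite -linearZ_LR; congr (pi_lin L _).
  by apply/rowP => i; rewrite !mxE hE.
- move=> f; rewrite pi_eq0; split=> [/mksubP[h hE]|[h hE]].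
    by exists h => x; rewrite -hE smrw.
  by apply/mksubP; exists h => x; rewrite smrw hE.
move=> n; have [c <-] := pi_surj n; exists (mklin (lsm c)).
apply/eqP; rewrite -subr_eq0 -linearB; apply/eqP/pi_eq0/mksubP.
exists \0 => x; have -> : rw (mklin (lsm c)) - c = (-1) *: c + rw (mklin (lsm c)).
  by rewrite scaleN1r addrC.
rewrite smD smrw mklinE; rewrite [X in X + _](_ : _ = - sm c x) ?addNr //.
by rewrite mulrN1.
Qed.

Lemma DTr_ex X (J : lmodType k) : fin_gen X -> inj_env_top J ->
  exists (Y : lmodType S) (D : ARdata X Y J), is_DTr X Y.
Proof.
move=> Xf Jtop; have [N tr] := transpose_ex Xf.
have [Y [th [thD thS thI thF]]] := @dual_ex k S R (fun r => r) (fun _ _ => erefl) erefl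
  (fun _ _ => erefl) N J.
have [D] := transpose_ARdata Xf tr thD thS thI thF.
exists Y, D, N; split=> //.
by exists J, th; split.
Qed.

Definition preproj X := exists n Z, iter_rel (@is_DTr k R) n X Z /\ projective_mod Z.

Lemma fg_DTr X Y : fin_gen X -> is_DTr X Y -> fin_gen Y.
Proof.
move=> Xf /(DTr_ARdata Xf)[J [D Jtop]].
exact/kfin_fg/(AR_kfin D Jtop kfin_op).
Qed.

(** Induction on the number of translates from [Y] to a projective module.  If
    [T] is not projective, a nonzero map [T -> Y] induces a map [DTr T -> DTr Y],
    which is nonzero by [stable_zero], and [DTr T] is indecomposable. *)
Lemma preproj_pred n Y Z T (f : {linear T -> Y}) :
  iter_rel (@is_DTr k R) n Y Z -> projective_mod Z -> fin_gen Y ->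
  fg_indec T -> ~ (forall x, f x = 0) -> preproj T.
Proof.
elim: n Y T f => [|n IH] Y T f.
  move=> /= YZ; move: YZ f => <- f Zp _ [_ Ti] f0; exists 0%N, T; split=> //.
  exact: (indec_to_proj heredS Ti Zp f0).
move=> /= [Y1 YY1 Y1Z] Zp Yf [Tf Ti] f0.
have [Tp|Tn] := pselect (projective_mod T); first by exists 0%N, T.
have [J [DY Jtop]] := DTr_ARdata Yf YY1.
have [T1 [DT TT1]] := DTr_ex Tf Jtop.
have T1i : indecomposable_mod T1 := DTr_indec k_art kfin_op heredS DT Jtop Ti Tn.
have [f0' [f1 [f0E f1E]]] := lift_pres f (@ar_proj0 _ _ _ _ _ DT) (ar_se DT) (ar_se DY).
(* the map [DTr T -> DTr Y] induced by [f1] *)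
have /choice[F FE] : forall t, exists y, forall g, @beta _ _ _ _ _ DY y g = @beta _ _ _ _ _ DT t (lcomp g f1).
  move=> t; apply: (beta_full (a := DY)).
  - by move=> g g' h hE; apply: betaD => x; rewrite !lcompE hE.
  - by move=> c g h hE; apply: betaZ => x; rewrite !lcompE hE.
  - move=> g h hE; apply: (beta_ker _ (g := lcomp h f0')) => x.
    by rewrite !lcompE hE f1E.
have FL : linear F.
  move=> s t t'; apply/eqP; rewrite -subr_eq0; apply/eqP; apply: (beta_sep (a := DY)) => g.
  have bN y : @beta _ _ _ _ _ DY (- y) g = - @beta _ _ _ _ _ DY y g.
    by apply/eqP; rewrite -addr_eq0 -betaYD addNr beta_y0.
  rewrite betaYD bN betaYD beta_rmul !FE betaYD beta_rmul.
  by rewrite (beta_ext _ (g := lcomp (rmul g (s : S^o)) f1)) ?subrr.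
have [|m [Z' [T1Z' Z'p]]] := IH Y1 T1 (mklin FL) Y1Z Zp (fg_DTr Yf YY1) (conj (fg_DTr Tf TT1) T1i).
  move=> F0; apply: f0.
  have [|u uE] := beta_zero_factor k_art Jtop (D := DT) (f := f1) (ar_db1 DY).
    by move=> t g; rewrite -FE -[F t]/(mklin FL t) F0 beta_y0.
  exact: (stable_zero heredS (ar_se DT) (ar_se DY) (@ar_proj0 _ _ _ _ _ DY) Ti Tn f0E f1E uE).
by exists m.+1, Z'; split=> //; exists T1.
Qed.
End ArtinHereditary.

(** * The inverse translate *)

Lemma alg_central (k : comNzRingType) (R : algType k) (c : k) (x : R) :
  (c%:A : R) * x = x * c%:A.
Proof. by rewrite -scalerAl mul1r -scalerAr mulr1. Qed.

Section InverseTranslate.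
Variables (k : comNzRingType) (R : algType k).
Hypothesis R_artin : artin_algebra R.
Hypothesis R_hered : hereditary R.
Local Notation S := (R^c).
Implicit Types W X Y T : lmodType S.

Let k_art : artinian_mod (k^o : lmodType k). Proof. by case: R_artin. Qed.
Let heredR : left_hereditary R. Proof. by case: R_hered. Qed.

Variables (W : lmodType S) (J : lmodType k).
Hypothesis Jtop : inj_env_top J.
Hypothesis W_fin : kfin W.
Variables (DW : lmodType R) (th : DW -> {linear resk W -> J}).
Hypothesis thD : forall u v n, th (u + v) n = th u n + th v n.
Hypothesis thS : forall (r : R) u (w : W), th (r *: u) w = th u ((r : S) *: w).
Hypothesis thI : forall u v, (forall w, th u w = th v w) -> u = v.
Hypothesis thF : forall g : {linear resk W -> J}, exists u, forall w, th u w = g w.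

Let th0 w : th 0 w = 0.
Proof.
have := thD 0 0 w; rewrite addr0 => /(congr1 (fun z => z - th 0 w)).
by rewrite subrr addrK => <-.
Qed.

Let thk (c : k) (u : resk DW) (w : resk W) : th (c *: u) w = c *: th u w.
Proof. by rewrite resk_scaleE thS -(linearZ_LR (th u)). Qed.

Let th_sep (w : W) : (forall u, th u w = 0) -> w = 0.
Proof.
move=> H; apply: contrapT => w0.
have [phi] := @cogenerator k k_art J (resk W) w Jtop w0; apply.
by have [u <-] := thF phi.
Qed.

Let th_linl (w : resk W) : linear (fun u : resk DW => th u w).
Proof. by move=> c u v; rewrite thD thk. Qed.

(** A module of finite length is its own bidual. *)
Lemma eval_functional (psi : {linear resk DW -> J}) : exists w : W, forall u, th u w = psi u.
Proof.
apply: (@reflexive k k_art J (resk W) (resk DW) (fun w u => th u w) Jtop W_fin) => //.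
- by move=> u; exact: linearP.
- by move=> u H; apply: thI => w; rewrite th0 H.
Qed.

Lemma dual_kfin n : lenle n (resk W) -> lenle n (resk DW).
Proof.
move=> Wn; have [i ei] := inj_env_top_ess Jtop.
have /choice[h hE] : forall u : resk DW, exists v : kdual (resk W) J, forall w, kdual_fun v w = th u w.
  by move=> u; exact: kdual_fun_ex.
have lh : linear h by move=> c u v; apply: kdual_fun_inj => w; rewrite kdual_fun_linear !hE thD thk.
apply: (@lenle_inj _ n (resk DW) _ (mklin lh) _ (kdual_len ei Wn)).
by apply: lin_inj0 => u hu; apply: thI => w; rewrite th0 -hE -[h u]/(mklin lh u) hu kdual_fun0.
Qed.

Lemma bidual_len n : lenle n (resk DW) -> lenle n (resk W).
Proof.
move=> Dn; have [i ei] := inj_env_top_ess Jtop.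
have /choice[h hE] : forall w : resk W, exists v : kdual (resk DW) J, forall u, kdual_fun v u = th u w.
  by move=> w; have [v vE] := kdual_fun_ex (mklin (th_linl w)); exists v => u; rewrite vE.
have lh : linear h.
  by move=> c u v; apply: kdual_fun_inj => w; rewrite kdual_fun_linear !hE linearP.
apply: (@lenle_inj _ n (resk W) _ (mklin lh) _ (kdual_len ei Dn)).
by apply: lin_inj0 => w hw; apply: th_sep => u; rewrite -hE -[h w]/(mklin lh w) hw kdual_fun0.
Qed.

(** Baer's test for [W].  A dual basis of [DW] reduces a map from an ideal of
    [S] to [W] to finitely many [k]-linear maps from the ideal to [J], which extend
    to [S] because [J] is injective. *)
Lemma proj_dual_ext_injective : projective_mod DW -> ext_injective W.
Proof.
move=> Dp; have Df : fin_gen DW.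
  by apply: kfin_fg; have [n Wn] := W_fin; exists n; exact: dual_kfin.
have [m [om [ps omps]]] := fgproj_dual_basis Dp Df.
apply: baer_criterion => I phi.
have /choice[la laE] : forall j, exists la : {linear resk (S^o : lmodType S) -> J},
    forall s : submod I, la (sincl s) = th (om j) (phi s).
  move=> j; have [Ji _] := Jtop.
  exact: (Ji _ _ (reskl (@sincl _ _ I)) (lcomp (th (om j)) (reskl phi)) (@sincl_inj _ _ I)).
have lpsi : linear (fun u : resk DW => \sum_j la j ((ps j u : S) : resk (S^o : lmodType S))).
  move=> c u v; rewrite scaler_sumr -big_split; apply: eq_bigr => j _.
  apply: etrans (linearP (la j) c _ _); congr (la j _).
  rewrite !resk_scaleE linearP; congr (_ + _).
  exact: (@alg_central k R c (ps j u)).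
have [q qE] := eval_functional (mklin lpsi).
exists q => s; apply/eqP; rewrite -subr_eq0; apply/eqP; apply: th_sep => u.
rewrite (linearB (th u)) -thS qE mklinE; apply/eqP; rewrite subr_eq0; apply/eqP.
rewrite {1}(omps u).
have thsum (F : 'I_m -> DW) w : th (\sum_j F j) w = \sum_j th (F j) w.
  rewrite -(big_morph (fun u => th u w) (fun a b => thD a b w) (th0 w)) //.
rewrite thsum; apply: eq_bigr => j _; rewrite thS -linearZ_LR -laE.
by congr (la j _); rewrite !linearZ_LR.
Qed.

Section Transpose.
Variables (m n : nat) (om : 'I_m -> DW) (f : 'I_n -> 'rV[R]_m).
Hypothesis om_surj : is_surj (comb om).
Hypothesis f_ker : forall c, comb om c = 0 <-> exists b, comb f b = c.

(** The dual [Hom(-, R)] of the presentation of [DW] with generators [om] and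
    relations [f].  Its cokernel is the transpose of [DW], that is [Tr D W]. *)
Let dfun (x : 'rV[S]_m) : 'rV[S]_n := \row_i \sum_j (x 0 j : S) * (f i 0 j : S).
Let dlin : linear dfun.
Proof.
move=> a x y; apply/rowP => i; rewrite !mxE mulr_sumr -big_split; apply: eq_bigr => j _.
by rewrite !mxE [LHS](@mulrDl S) [X in _ = X + _](@mulrA S).
Qed.
Let d : {linear 'rV[S]_m -> 'rV[S]_n} := mklin dlin.

Let rw l (g : {linear 'rV[S]_l -> (S^o : lmodType S)}) : 'rV[R]_l :=
  \row_j (g (delta_mx 0 j) : R).
Let gc l (c : 'rV[R]_l) : {linear 'rV[S]_l -> (S^o : lmodType S)} :=
  comb (fun j => (c 0 j : S) : S^o).
Let gcE l (c : 'rV[R]_l) x : gc c x = \sum_j (x 0 j : S) * (c 0 j : S).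
Proof. by []. Qed.
Let rwK l (c : 'rV[R]_l) : rw (gc c) = c.
Proof. by apply/rowP => j; rewrite !mxE [LHS]comb_delta. Qed.
Let gcK l (g : {linear 'rV[S]_l -> (S^o : lmodType S)}) x : gc (rw g) x = g x.
Proof. by rewrite [RHS]lin_rV gcE; apply: eq_bigr => j _; rewrite mxE. Qed.

Let gcd b x : gc b (d x) = gc (comb f b) x.
Proof.
rewrite !gcE.
have E1 i : (d x 0 i : S) * (b 0 i : S) = \sum_j (x 0 j : S) * ((f i 0 j : S) * (b 0 i : S)).
  by rewrite mklinE mxE mulr_suml; apply: eq_bigr => j _; rewrite mulrA.
rewrite (eq_bigr _ (fun i _ => E1 i)) exchange_big; apply: eq_bigr => j _.
rewrite -mulr_sumr; congr (_ * _); rewrite summxE; apply: eq_bigr => i _.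
by rewrite mxE.
Qed.

Hypothesis d_inj : forall x : 'rV[S]_m,
  (forall i, \sum_j (x 0 j : S) * (f i 0 j : S) = 0) -> x = 0.

(** When the dualised presentation is injective, it presents [Tr D W], and
    dualising it back recovers [DW]; so [W], the dual of [DW], is the translate of
    [Tr D W].  The presentation need not be minimal. *)
Lemma transpose_dual_ARdata : exists N : submodClosed ('rV[S]_n : lmodType S),
  inhabited (ARdata (quotm N) W J).
Proof.
pose bt (w : W) g := th (comb om (rw g)) w.
have d_injective : injective d.
  apply: lin_inj0 => x dx; apply: d_inj => i.
  by have := congr1 (fun v : 'rV[S]_n => v 0 i) dx; rewrite mklinE !mxE.
have se : short_exact d (pi_lin (imm d)).
  split=> //; first exact: pi_surj.
  by move=> z; rewrite pi_eq0; split=> [/immP//|H]; exact/immP.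
have db l : dual_basis ('rV[S]_l : lmodType S).
  apply: fgproj_dual_basis; first exact: rV_proj.
  by apply/fin_gen_surj; exists l, idfun => x; exists x.
exists (imm d); constructor.
apply: (@MkARdata k S (quotm (imm d)) W J 'rV[S]_m 'rV[S]_n d (pi_lin (imm d)) bt
  (@rV_proj S n) (db m) (db n) se).
- move=> w g g' h hE; rewrite /bt -thD -linearD; congr (th (comb om _) w).
  by apply/rowP => j; rewrite !mxE hE.
- move=> c w g h hE; rewrite /bt -(linearZ_LR (th _)) resk_scaleE.
  rewrite -[LHS]/(th (comb om (rw h)) w) -[(c%:A : S) *: w]/((c%:A : S) *: w) -thS -linearZ_LR.
  congr (th (comb om _) w); apply/rowP => j; rewrite !mxE hE.
  by rewrite [RHS]alg_central.
- by move=> w w' g; exact: (linearD (th _)).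
- move=> s w g h hE; rewrite /bt -thS -linearZ_LR; congr (th (comb om _) w).
  by apply/rowP => j; rewrite !mxE hE.
- move=> w g g' gE; rewrite /bt (_ : comb om _ = 0) ?th0 //.
  apply/f_ker; exists (rw g'); rewrite -[LHS]rwK; apply/rowP => j; rewrite !mxE.
  by rewrite -gcd gcK gE.
- move=> w H; apply: th_sep => u; have [c <-] := om_surj u.
  by rewrite -[c]rwK; exact: H.
move=> phi phiD phiZ phiK.
have phi_ext (g g' : {linear 'rV[S]_m -> (S^o : lmodType S)}) : (forall x, g x = g' x) -> phi g = phi g'.
  move=> gg'; pose z : {linear 'rV[S]_m -> (S^o : lmodType S)} := \0.
  rewrite (phiD g' z g); last by move=> x; rewrite gg' addr0.
  by rewrite (phiK z \0) ?addr0.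
have phi_eq c c' : comb om c = comb om c' -> phi (gc c) = phi (gc c').
  move=> cc'; have /f_ker[b bE] : comb om (c - c') = 0 by rewrite linearB cc' subrr.
  rewrite (phiD (gc b \o d : {linear _ -> _}) (gc c') (gc c)).
    by rewrite (phiK _ (gc b)) ?add0r.
  move=> x; rewrite [X in X + _]gcd bE !gcE -big_split; apply: eq_bigr => j _.
  apply: etrans (@mulrDr S _ _ _); congr (_ * _).
  by rewrite !mxE subrK.
pose sec u := projT1 (cid (om_surj u)).
have secK u : comb om (sec u) = u by rewrite /sec; case: cid.
have lpsi : linear (fun u : resk DW => phi (gc (sec u))).
  move=> c u v.
  rewrite -(phiZ c (gc (sec u)) (gc ((c%:A : R) *: sec u))); last first.
    move=> x; rewrite !gcE mulr_sumr; apply: eq_bigr => j _; rewrite mxE.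
    by rewrite [RHS](@alg_central k S) -(@mulrA S).
  rewrite -(phiD _ _ (gc ((c%:A : R) *: sec u + sec v))); last first.
    move=> x; rewrite !gcE -big_split; apply: eq_bigr => j _.
    by rewrite mxE; exact: (@mulrDr S).
  by apply: phi_eq; rewrite secK linearP !secK.
have [w wE] := eval_functional (mklin lpsi); exists w => g.
rewrite /bt wE mklinE -(phi_ext (gc (rw g)) g); last exact: gcK.
by apply: phi_eq; rewrite secK.
Qed.
End Transpose.

(** If the dualised presentation has a nonzero element in its kernel, this is
    a nonzero map [DW -> R].  Its image is projective, so it splits off from [DW].
    As [W] is indecomposable, its dual has no other idempotents than zero and the
    identity, and [DW] is isomorphic to a left ideal of [R]: it is projective, and
    no longer than [R]. *)
Lemma tau_inv_or_injective a : lenle a (resk (R^o : lmodType R)) -> indecomposable_mod W ->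
  (ext_injective W /\ lenle a (resk W)) \/
  exists n (N : submodClosed ('rV[S]_n : lmodType S)), inhabited (ARdata (quotm N) W J).
Proof.
move=> Ra Wi; have Df : fin_gen DW.
  by apply: kfin_fg; have [n Wn] := W_fin; exists n; exact: dual_kfin.
have [m [v vs]] := proj1 (fin_gen_surj DW) Df.
pose om j := v (delta_mx 0 j).
have vE c : v c = comb om c by rewrite lin_rV.
have om_surj : is_surj (comb om) by move=> u; have [c <-] := vs u; exists c; rewrite -vE.
have R_fin : kfin (R^o : lmodType R) := kfin_ring R_artin.
have Kf : fin_gen (submod (kerm (comb om))).
  apply: (fg_submod R_fin); apply/fin_gen_surj.
  by exists m, (idfun : {linear 'rV[R]_m -> 'rV[R]_m}) => x; exists x.
have [n [h hs]] := proj1 (fin_gen_surj _) Kf.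
pose f i : 'rV[R]_m := sincl (h (delta_mx 0 i)).
have fE b : comb f b = sincl (h b).
  by rewrite -[RHS]/(lcomp sincl h b) [RHS]lin_rV.
have f_ker c : comb om c = 0 <-> exists b, comb f b = c.
  split=> [/eqP cK|[b <-]]; last by rewrite fE; apply/eqP; exact: (sinclP (h b)).
  have [u uc] := @sincl_ex _ _ (kerm (comb om)) c cK; have [b bu] := hs u.
  by exists b; rewrite fE bu.
have [d_inj|/existsNP[x /not_implyP[xf x0]]] := pselect (forall x : 'rV[S]_m,
  (forall i, \sum_j (x 0 j : S) * (f i 0 j : S) = 0) -> x = 0).
  by right; exists n; exact: transpose_dual_ARdata d_inj.
left; pose xi j : R^o := x 0 j.
have [ps psE] : exists ps : {linear DW -> R^o}, forall c, ps (comb om c) = comb xi c.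
  apply: factor_surj => // c /f_ker[b <-].
  rewrite [comb f b]combE linear_sum big1 // => i _.
  rewrite linearZ_LR (_ : comb xi (f i) = 0) ?scaler0 //.
  by rewrite combE -[RHS](xf i); apply: eq_bigr.
have ps0 : ~ (forall u, ps u = 0).
  move=> H; apply: x0; apply/rowP => j; rewrite mxE.
  by rewrite -[LHS]/(xi j) -(comb_delta xi) -psE H.
have Rp : projective_mod (R^o : lmodType R).
  have e1 : cancel (mulby (delta_mx 0 0 : 'rV[R]_1)) (coordl R (ord0 : 'I_1)).
    move=> r; rewrite mulbyE -[LHS]/((r *: (delta_mx 0 0 : 'rV[R]_1)) 0 0).
    by rewrite !mxE mulr1.
  exact: proj_retract e1 (@rV_proj R 1).
have ip : projective_mod (submod (imm ps)) := submod_proj heredR Rp.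
have [s sK] := proj_section ip (@toimm_surj _ _ _ ps).
pose ep := lcomp s (toimm ps).
have epE u : ep (ep u) = ep u by rewrite /ep !lcompE sK.
(* the transpose of the idempotent [ep] *)
have /choice[tr trE] : forall w : W, exists w' : W, forall u, th u w' = th (ep u) w.
  move=> w; have lw : linear (fun u : resk DW => th (ep u) w).
    by move=> c u v'; rewrite resk_scaleE linearP thD -resk_scaleE thk.
  by have [w' w'E] := eval_functional (mklin lw); exists w' => u; rewrite w'E.
have th_inj (w w' : W) : (forall u, th u w = th u w') -> w = w'.
  move=> H; apply/eqP; rewrite -subr_eq0; apply/eqP; apply: th_sep => u.
  by rewrite (linearB (th u)) H subrr.
have trl : linear tr.
  move=> r w w'; apply: th_inj => u; rewrite trE.
  rewrite [LHS](linearD (th _)) [RHS](linearD (th _)) trE; congr (_ + _).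
  by rewrite -!thS trE linearZ_LR.
have [|H|H] := indec_idem (a := mklin trl) Wi.
- by move=> w; apply: th_inj => u; rewrite !mklinE !trE epE.
- case: ps0 => u; rewrite -toimmE -[toimm ps u]sK -[s _]/(ep u).
  suff -> : ep u = 0 by rewrite !linear0.
  by apply: thI => w; rewrite th0 -trE -[tr w]/(mklin trl w) H linear0.
have epid u : ep u = u.
  by apply: thI => w; rewrite -trE -[tr w]/(mklin trl w) H.
split.
  apply: proj_dual_ext_injective; apply: (proj_retract (i := toimm ps) (r := s)) ip.
  by move=> u; exact: epid.
apply: bidual_len; apply: (lenle_inj (f := reskl ps)) Ra.
apply: (inj_comp (f := sincl) (h := toimm ps)); first exact: sincl_inj.
by apply: (can_inj (g := s)) => u; exact: epid.
Qed.
End InverseTranslate.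

(** * Torsion-free modules orthogonal to the finitely generated Baer modules *)

Section Torsion.
Variables (S : nzRingType) (p : lmodType S -> Prop).
Implicit Types M N X Y P : lmodType S.

Lemma classL_quot M N (f : {linear M -> N}) : is_surj f -> classL p M -> classL p N.
Proof.
move=> fs ML P pP g y; have [x <-] := fs y.
exact: (ML P pP (lcomp g f) x).
Qed.

Lemma classP_inj M N (f : {linear M -> N}) : injective f -> classP p N -> classP p M.
Proof.
move=> fi NP Y YL g y; apply: fi; rewrite linear0.
exact: (NP Y YL (lcomp f g) y).
Qed.

Lemma classP_torsion_free M : classP p (quotm (l p M)).
Proof.
move=> Y YL f y; pose N := mpreim (pi_lin (l p M)) (imm f).
have [q qE] : exists q : {linear submod N -> submod (imm f)},
    forall u, sincl (q u) = lcomp (pi_lin (l p M)) sincl u.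
  apply: factor_inj; first exact: sincl_inj.
  by move=> u; apply: sincl_ex; rewrite lcompE; have := sinclP u; rewrite mpreimP.
have qs : is_surj q.
  move=> z; have [x xz] := pi_surj (sincl z).
  have [u ux] : exists u : submod N, sincl u = x.
    by apply: sincl_ex; rewrite mpreimP xz sinclP.
  by exists u; apply: sincl_inj; rewrite qE lcompE ux xz.
have NL : classL p (submod N).
  move=> P pP h u.
  have hl v : sincl v \in l p M -> h v = 0.
    apply: (classL_restrict h (@l_torsion _ _ M) pP).
    by move=> x xl; rewrite mpreimP (_ : pi_lin _ x = 0) ?rpred0 //; apply/pi_eq0.
  have [h' h'E] : exists h' : {linear submod (imm f) -> P}, forall v, h' (q v) = h v.
    apply: factor_surj => // v qv; apply: hl; apply/pi_eq0.
    by rewrite -[LHS]/(lcomp (pi_lin (l p M)) sincl v) -qE qv linear0.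
  rewrite -h'E; have [y' <-] := toimm_surj (q u).
  exact: (YL P pP (lcomp h' (toimm f)) y').
have [x xy] := pi_surj (f y); rewrite -xy; apply/pi_eq0.
by apply: (l_largest NL); rewrite mpreimP xy imm_f.
Qed.

(** The kernel is torsion, so it lies in [l(M)], and [l(M)] dies in the
    torsion-free module [P]. *)
Lemma torsion_free_quotient_isom M P (f : {linear M -> P}) :
  is_surj f -> classP p P -> classL p (submod (kerm f)) -> isom (quotm (l p M)) P.
Proof.
move=> fs Pp Kl.
have lK x : x \in l p M -> f x = 0.
  move=> /sincl_ex[u <-]; exact: (Pp _ (@l_torsion _ p M) (lcomp f sincl) u).
have [h hE] : exists h : {linear quotm (l p M) -> P}, forall x, h (pi_lin _ x) = f x.
  by apply: factor_surj; [exact: pi_surj | move=> x /pi_eq0/lK].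
apply: (isom_of (f := h)).
  apply: lin_inj0 => u; have [x <-] := pi_surj u; rewrite hE => fx.
  by apply/pi_eq0; apply: (l_largest Kl); apply/eqP.
by move=> y; have [x <-] := fs y; exists (pi_lin _ x).
Qed.
End Torsion.

Section BaerModules.
Variables (k : comNzRingType) (R : algType k).
Hypothesis R_artin : artin_algebra R.
Hypothesis R_hered : hereditary R.
Local Notation S := (R^c).
Variables p t : lmodType S -> Prop.
Hypothesis p_sub : forall X, p X -> fg_preprojective X.
Hypothesis t_sub : forall X, t X -> fg_regular X.
Implicit Types M N V W X Y T U I : lmodType S.

Let k_art : artinian_mod (k^o : lmodType k). Proof. by case: R_artin. Qed.
Let heredS : left_hereditary S. Proof. by case: R_hered. Qed.
Let S_fin : kfin (S^o : lmodType S). Proof. exact: kfin_op. Qed.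

Lemma rV_fg n : fin_gen ('rV[S]_n : lmodType S).
Proof. by apply/fin_gen_surj; exists n, idfun => x; exists x. Qed.

Lemma regular_not_preproj T : t T -> ~ preproj T.
Proof. by move=> /t_sub[Ti Tp _] H; apply: Tp. Qed.

(** Presentations of the finitely generated Baer modules [S^n / N].  Unlike the
    modules themselves they form a small type, over which the generators of the
    precover can range. *)
Definition baer_rel n (N : submodClosed ('rV[S]_n : lmodType S)) :=
  forall T, t T -> extends (@sincl _ _ N) T.

(** [Ext^1(X, V) = 0] for all finitely generated Baer modules [X]. *)
Definition baer_orth V := forall n (N : submodClosed ('rV[S]_n : lmodType S)),
  baer_rel N -> extends (@sincl _ _ N) V.

Lemma baer_orth_surj V W (f : {linear V -> W}) : is_surj f -> baer_orth V -> baer_orth W.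
Proof.
move=> fs Vs n N Nc; apply: (extends_surj _ fs); last exact: Vs.
apply: (submod_proj heredS); exact: rV_proj.
Qed.

(** By the Auslander-Reiten formula: a nonzero map from a regular module to the
    translate of [X], itself preprojective, would make the regular module
    preprojective. *)
Lemma preproj_ext0 X T : fin_gen X -> preproj X -> t T -> ext0 X T.
Proof.
move=> Xf [[|n] [Z [/= XZ Zp]]] tT; first by rewrite XZ; exact: proj_ext0.
case: XZ => Y XY YZ; have [J [D Jtop]] := DTr_ARdata R_artin R_hered Xf XY.
apply: (AR_ext0 D k_art Jtop) => f x; apply: contrapT => fx.
apply: (regular_not_preproj tT).
apply: (preproj_pred R_artin R_hered (f := f) YZ Zp (fg_DTr R_artin R_hered Xf XY)).
  by case: (t_sub tT).
by move=> f0; apply: fx.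
Qed.

Lemma preproj_ext0_orth X V : fin_gen X -> preproj X -> baer_orth V -> ext0 X V.
Proof.
move=> Xf Xp Vs; have [n [f fs]] := proj1 (fin_gen_surj X) Xf.
have ses := kerm_short_exact fs.
apply: (extends_ext0 (@rV_proj S n) ses); apply: Vs => T tT.
exact: ext0_extends ses (preproj_ext0 Xf Xp tT).
Qed.

(** All indecomposable predecessors are preprojective.  This describes the
    finitely generated preprojective modules, decomposable or not, in a way that
    is visibly closed under submodules and extensions. *)
Definition pred_preproj W := fin_gen W /\
  forall U (f : {linear U -> W}), fg_indec U -> ~ (forall x, f x = 0) -> preproj U.

Lemma pred_preproj_inj W W' (j : {linear W' -> W}) : injective j -> pred_preproj W -> pred_preproj W'.
Proof.
move=> ji [Wf Wp]; split; first exact: (fg_mono S_fin ji Wf).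
move=> U f Ui f0; apply: (Wp U (lcomp j f) Ui) => H; apply: f0 => x.
by apply: ji; rewrite linear0; exact: H.
Qed.

Lemma pred_preproj_exact W' W W'' (j : {linear W' -> W}) (g : {linear W -> W''}) :
  short_exact j g -> pred_preproj W' -> pred_preproj W'' -> pred_preproj W.
Proof.
move=> [ji gs ex] [W'f W'p] [W''f W''p]; split.
  by apply: (fin_gen_ext (f := j) (g := g)) => // x /ex.
move=> U f Ui f0; have [H|H] := pselect (forall x, lcomp g f x = 0); last exact: W''p H.
have [h hE] : exists h : {linear U -> W'}, forall x, j (h x) = f x.
  by apply: factor_inj => // x; apply/ex; exact: H.
by apply: (W'p U h Ui) => h0; apply: f0 => x; rewrite -hE h0 linear0.
Qed.

Lemma pred_preproj_Hom_regular W T : pred_preproj W -> t T -> Hom_zero T W.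
Proof.
move=> [_ Wp] tT f x; apply: contrapT => fx; apply: (regular_not_preproj tT).
by apply: (Wp T f); [case: (t_sub tT)|move=> f0; apply: fx].
Qed.

Lemma preproj_pred_preproj n Y Z : iter_rel (@is_DTr k R) n Y Z -> projective_mod Z ->
  fin_gen Y -> pred_preproj Y.
Proof. by move=> YZ Zp Yf; split=> // U f; exact: preproj_pred YZ Zp Yf. Qed.

Lemma indec_summand M : fin_gen M -> ~ trivialm M -> exists I (q : {linear M -> I}) (j : {linear I -> M}),
  [/\ indecomposable_mod I, is_surj q & injective j].
Proof.
move=> Mf; have Mfin := kfin_finlen (fg_kfin S_fin Mf).
move: M Mfin {Mf}; apply: decomp_ind => [M M0 []//|M Mi _|M A B [f fb] IA IB Mt].
  by exists M, idfun, idfun; split=> // x; exists x.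
have [g [fK gK]] := bij_inv (bij_inj fb) (bij_surj fb).
have [A0|At] := pselect (trivialm A).
  have [|I [q [j [Ii qs ji]]]] := IB.
    move=> B0; apply: Mt => x; rewrite -(fK x) (_ : f x = 0) ?linear0 //.
    by apply: injective_projections; [exact: A0|exact: B0].
  exists I, (lcomp q (lcomp (snd_lin A B) f)), (lcomp g (lcomp (inr_lin A B) j)); split=> //.
    by move=> y; have [b <-] := qs y; exists (g (0, b)); rewrite !lcompE gK.
  by move=> x y; rewrite !lcompE => /(can_inj gK)/(congr1 snd)/ji.
have [I [q [j [Ii qs ji]]]] := IA At.
exists I, (lcomp q (lcomp (fst_lin A B) f)), (lcomp g (lcomp (inl_lin A B) j)); split=> //.
  by move=> y; have [b <-] := qs y; exists (g (b, 0)); rewrite !lcompE gK.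
by move=> x y; rewrite !lcompE => /(can_inj gK)/(congr1 fst)/ji.
Qed.

(** Otherwise [W = DTr X] with [X = S^n / N].  There are no nonzero maps from
    regular modules to [W], so [X] is Baer; then [Ext^1(X, W) = 0], so there are
    no nonzero maps from [W] to [W]. *)
Lemma baer_orth_indec_injective W a : lenle a (resk (R^o : lmodType R)) ->
  pred_preproj W -> baer_orth W -> indecomposable_mod W -> ext_injective W /\ lenle a (resk W).
Proof.
move=> Ra Wp Ws Wi; have [J Jtop] := inj_env_top_ex k_art.
have Wk : kfin W := fg_kfin S_fin (proj1 Wp).
have [DW [th [thD thS thI thF]]] := @dual_ex k R S (fun r => r) (fun _ _ => erefl) erefl
  (fun _ _ => erefl) W J.
have [//|[n [N [D]]]] := tau_inv_or_injective R_artin R_hered Jtop Wk thD thS thI thF Ra Wi.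
case: Wi => Wt _; case: Wt.
have Nc : baer_rel N.
  move=> T tT; apply: (ext0_extends (quotm_short_exact N)).
  apply: (AR_ext0 D k_art Jtop); exact: pred_preproj_Hom_regular.
have NW : ext0 (quotm N) W.
  exact: extends_ext0 (@rV_proj S n) (quotm_short_exact N) (Ws n N Nc).
exact: (AR_hom_zero D NW (idfun : {linear W -> W})).
Qed.

(** A quotient [I] of [V] of maximal length among the indecomposable modules
    with preprojective predecessors is injective, and [V -> I] splits. *)
Lemma baer_orth_injective_sub V : baer_orth V -> classP p V -> ~ trivialm V ->
  exists I (j : {linear I -> V}), [/\ ext_injective I, injective j & ~ trivialm I].
Proof.
move=> Vs VP Vt.
have [P pP [f f0]] : exists2 P, p P & exists f : {linear V -> P}, ~ (forall x, f x = 0).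
  apply: contrapT => H; apply: Vt; apply: (VP V _ idfun) => P pP f x.
  apply: contrapT => fx; apply: H; exists P => //; exists f => f0; exact: fx.
have [[Pf Pi] [n0 [Z0 [PZ0 Z0p]]]] := p_sub pP.
have [a Ra] := kfin_ring R_artin.
pose QI I := [/\ indecomposable_mod I, pred_preproj I & exists q : {linear V -> I}, is_surj q].
have QI_inj I : QI I -> ext_injective I /\ lenle a (resk I).
  by move=> [Ii Ip [q qs]]; apply: baer_orth_indec_injective => //; exact: baer_orth_surj qs Vs.
pose Q n := `[< exists I, QI I /\ (lenle n (resk I) /\ forall m, lenle m (resk I) -> (n <= m)%N) >].
have exQ : exists n, Q n.
  have Pp := preproj_pred_preproj PZ0 Z0p Pf.
  have ip : pred_preproj (submod (imm f)) := pred_preproj_inj (@sincl_inj _ _ _) Pp.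
  have [I [q [j [Ii qs ji]]]] := indec_summand (proj1 ip) (not_Hom_zero f0).
  have QII : QI I.
    split=> //; first exact: pred_preproj_inj ji ip.
    exists (lcomp q (toimm f)) => y; have [z <-] := qs y; have [x <-] := toimm_surj z.
    by exists x.
  have [n In nmin] := finlen_min (ex_intro _ a (proj2 (QI_inj I QII))).
  by exists n; apply/asboolP; exists I.
have ubQ n : Q n -> (n <= a)%N.
  by move=> /asboolP[I [/QI_inj[_ Ia] [_ H]]]; exact: H.
have [n /asboolP[I [QII [In nmin]]] nmax] := ex_maxnP exQ ubQ.
have [Ii Ip [q qs]] := QII; have [Iinj _] := QI_inj I QII.
have It : ~ trivialm I by case: Ii.
have If : fin_gen I := proj1 Ip.
have Ipre : preproj I.
  by apply: (proj2 Ip I idfun) => // H; apply: It.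
suff IV : ext0 I (submod (kerm q)).
  have [s sK] := ext0_split (kerm_short_exact qs) IV.
  by exists I, s; split=> //; exact: can_inj sK.
have [[|m] [Z [/= IZ Zp]]] := Ipre; first by apply: proj_ext0; rewrite IZ.
case: IZ => Y IY YZ; have [J [D Jtop]] := DTr_ARdata R_artin R_hered If IY.
apply: (AR_ext0 D k_art Jtop) => f' x; apply: contrapT => f'x.
have Yp : pred_preproj Y := preproj_pred_preproj YZ Zp (fg_DTr R_artin R_hered If IY).
(* A nonzero map [f'] from the kernel of [q] to [DTr I]; the quotient of [V] by
its kernel is an extension of [I] by the image of [f']. *)
pose V2 := pushm sincl (kerm f'); pose pV := pi_lin V2.
have [g gE] : exists g : {linear quotm V2 -> I}, forall v, g (pV v) = q v.
  apply: factor_surj; first exact: pi_surj.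
  by move=> v /pi_eq0/pushmP[u _ <-]; apply/eqP; exact: (sinclP u).
have gs : is_surj g by move=> y; have [v <-] := qs y; exists (pV v).
have [ka kaE] : exists ka : {linear submod (imm f') -> quotm V2},
    forall v, ka (toimm f' v) = pV (sincl v).
  apply: (factor_surj (f := lcomp pV sincl)); first exact: toimm_surj.
  move=> v /(congr1 sincl); rewrite toimmE linear0 => fv.
  by apply/pi_eq0/pushmP; exists v => //; apply/eqP.
have kai : injective ka.
  apply: lin_inj0 => y; have [v <-] := toimm_surj y; rewrite kaE => /pi_eq0/pushmP[u /eqP fu].
  by move=> /sincl_inj <-; apply: sincl_inj; rewrite toimmE linear0.
have se : short_exact ka g.
  split=> // z; split=> [|[y <-]]; last first.
    have [v <-] := toimm_surj y; rewrite kaE gE; apply/eqP; exact: (sinclP v).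
  have [v <-] := pi_surj z; rewrite -/pV gE => /eqP qv.
  have [u <-] := @sincl_ex _ _ (kerm q) v qv.
  by exists (toimm f' u); rewrite kaE.
have Wp : pred_preproj (quotm V2).
  by apply: pred_preproj_exact se _ Ip; exact: pred_preproj_inj (@sincl_inj _ _ _) Yp.
(* Nonzero maps to [I] from quotients of [V] split.  On an indecomposable
quotient the map is surjective, because its image is an injective submodule of
[I], and injective by maximality of the length of [I]. *)
have sec M : finlen M -> pred_preproj M -> (exists r : {linear V -> M}, is_surj r) ->
    forall h : {linear M -> I}, ~ (forall x, h x = 0) ->
    exists s : {linear I -> M}, cancel s h.
  move: M; apply: decomp_ind.
  - by move=> M M0 _ _ h h0; case: h0 => y; rewrite (M0 y) linear0.
  - move=> M Mi Mp Vr h h0; have QIM : QI M by split.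
    have [Minj Ma] := QI_inj M QIM.
    have hi : ext_injective (submod (imm h)).
      move=> X; exact: (ext0_surj heredS (@toimm_surj _ _ _ h) (Minj X)).
    have [s sK] := ext0_split (quotm_short_exact (imm h)) (hi _).
    have hs : is_surj h.
      have [qt|qt] := pselect (trivialm (quotm (imm h))).
        by move=> y; have /pi_eq0/immP := qt (pi_lin (imm h) y).
      have pK := indec_split_epi Ii sK qt; case: h0 => y.
      rewrite -[LHS]pK (_ : pi_lin _ _ = 0) ?linear0 //.
      by apply/pi_eq0; exact: imm_f.
    have [e Me emin] := finlen_min (ex_intro _ a Ma).
    have en : (e <= n)%N by apply: nmax; apply/asboolP; exists M.
    have hinj : injective h.
      apply: lin_inj0 => y hy; apply: contrapT => y0.
      have [e0 Ie] := @lenle_quot_proper _ e _ _ (reskl h) y y0 hy hs Me.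
      by have := leq_trans en (nmin _ Ie); rewrite leqNgt ltn_predL e0.
    by have [s' [_ s'K]] := bij_inv hinj hs; exists s'.
  move=> M A B [u ub] IA IB Mp [r rs] h h0.
  have [w [uK wK]] := bij_inv (bij_inj ub) (bij_surj ub).
  have [HA|HA] := pselect (forall y, lcomp h (lcomp w (inl_lin A B)) y = 0); last first.
    have [||s sK] := IA _ _ _ HA.
    - apply: (pred_preproj_inj (j := lcomp w (inl_lin A B))) Mp.
      by move=> y y'; rewrite !lcompE => /(can_inj wK)/(congr1 fst).
    - exists (lcomp (fst_lin A B) (lcomp u r)) => y.
      have [v vE] := rs (w (y, 0)); exists v; by rewrite !lcompE vE wK.
    by exists (lcomp w (lcomp (inl_lin A B) s)) => y; rewrite !lcompE; exact: sK.
  have HB : ~ (forall y, lcomp h (lcomp w (inr_lin A B)) y = 0).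
    move=> HB; apply: h0 => z; rewrite -(uK z).
    have -> : u z = inl_lin A B (u z).1 + inr_lin A B (u z).2.
      by apply: injective_projections; rewrite /= ?addr0 ?add0r.
    rewrite !linearD -[X in X + _]/(lcomp h (lcomp w (inl_lin A B)) _) HA add0r.
    exact: HB.
  have [||s sK] := IB _ _ _ HB.
  - apply: (pred_preproj_inj (j := lcomp w (inr_lin A B))) Mp.
    by move=> y y'; rewrite !lcompE => /(can_inj wK)/(congr1 snd).
  - exists (lcomp (snd_lin A B) (lcomp u r)) => y.
    have [v vE] := rs (w (0, y)); exists v; by rewrite !lcompE vE wK.
  by exists (lcomp w (lcomp (inr_lin A B) s)) => y; rewrite !lcompE; exact: sK.
have [||s sK] := sec (quotm V2) (kfin_finlen (fg_kfin S_fin (proj1 Wp))) Wp _ g.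
- by exists pV; exact: pi_surj.
- by move=> g0; apply: It => y; have [z <-] := gs y.
(* the projection of the split extension onto the image of [f'] *)
have [h hE] : exists h : {linear quotm V2 -> submod (imm f')},
    forall w, ka (h w) = ((idfun : {linear quotm V2 -> quotm V2}) \- lcomp s g) w.
  have [_ _ ex] := se.
  by apply: factor_inj => // w; apply/ex; rewrite /= linearB sK subrr.
have hs : is_surj h.
  move=> y; exists (ka y); apply: kai; rewrite hE /=.
  have -> : g (ka y) = 0 by have [_ _ ex] := se; apply/ex; exists y.
  by rewrite linear0 subr0.
have fs : baer_orth (submod (imm f')).
  apply: (baer_orth_surj (f := lcomp h pV)) Vs => y; have [w <-] := hs y.
  by have [v <-] := pi_surj w; exists v.
apply: f'x; rewrite -toimmE.
exact: (AR_hom_zero D (preproj_ext0_orth If Ipre fs) sincl).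
Qed.
End BaerModules.

(** * Baer modules over a given preprojective module *)

(** Componentwise extensions assemble to a map to the direct sum: [P1] is
    finitely generated, so only finitely many components of a map [P1 -> dsum F]
    are nonzero, and the zero components are extended by zero. *)
Lemma extends_dsum (S : nzRingType) (P1 P0 : lmodType S) (d : {linear P1 -> P0}) (A : Type)
    (F : A -> lmodType S) :
  fin_gen P1 -> (forall a, extends d (F a)) -> extends d (dsum F).
Proof.
move=> [m [z zE]] FN w.
pose comp (a : A) (x : dsum F) : F a := (\val x : dprod F) a.
have compL a : linear (comp a).
  move=> c x y; rewrite /comp.
  have -> : \val (c *: x + y) = c *: (\val x : dprod F) + \val y by exact: linearP.
  by [].
have uex : forall a, exists u : {linear P0 -> F a},
    (forall x, u (d x) = comp a (w x)) /\ ((forall x, comp a (w x) = 0) -> forall y, u y = 0).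
  move=> a; have [H|H] := pselect (forall x, comp a (w x) = 0).
    by exists \0; split=> // x; rewrite H.
  have [u uE] := FN a (lcomp (mklin (compL a)) w).
  by exists u; split=> // x; rewrite uE.
pose u a := projT1 (cid (uex a)).
have uE a : (forall x, u a (d x) = comp a (w x)) /\
    ((forall x, comp a (w x) = 0) -> forall y, u a y = 0) := projT2 (cid (uex a)).
have ufin (y : P0) : (fun a => u a y : F a) \in @dsumb S A F.
  apply/asboolP.
  have fU : finite_set (\bigcup_(i in [set: 'I_m]) [set a | comp a (w (z i)) != 0])%classic.
    by apply: bigcup_finite => // i _; have /asboolP := valP (w (z i)).
  apply: sub_finite_set fU => a /= ua; apply: contrapT => H.
  case/negP: ua; apply/eqP; apply: (proj2 (uE a)) => x.
  have [c ->] := zE x.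
  rewrite (linear_sum w) -[LHS]/(mklin (compL a) _) linear_sum big1 // => i _.
  rewrite !linearZ_LR (_ : mklin (compL a) _ = 0) ?scaler0 //.
  by apply: contrapT => /eqP H2; apply: H; exists i.
pose ud (y : P0) : dsum F := Sub (fun a => u a y : F a) (ufin y).
have lud : linear ud.
  move=> c x y; apply: val_inj.
  have -> : \val (c *: ud x + ud y) = c *: (\val (ud x) : dprod F) + \val (ud y) by exact: linearP.
  by apply: functional_extensionality_dep => a; rewrite /= linearP.
exists (mklin lud) => x.
by apply: val_inj; apply: functional_extensionality_dep => a; exact: (proj1 (uE a)).
Qed.

Section InjectiveSubmodules.
Variables (S : nzRingType) (V : lmodType S).

Lemma ext_injective_prod (I I' : lmodType S) : ext_injective I -> ext_injective I' -> ext_injective (I * I')%type.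
Proof.
move=> Ii I'i; apply: baer_criterion => a f.
have [q qE] := ext_injective_ideal_test Ii (lcomp (fst_lin I I') f).
have [q' q'E] := ext_injective_ideal_test I'i (lcomp (snd_lin I I') f).
exists (q, q') => s; apply: injective_projections; [exact: qE|exact: q'E].
Qed.

(** A map from a finitely generated ideal to the union has its image in one
    member of the chain. *)
Lemma ext_injective_union (F : submodClosed V -> Prop) (U : submodClosed V) :
  (forall a : submodClosed (S^o : lmodType S), fin_gen (submod a)) ->
  (exists N, F N) -> (forall N, F N -> ext_injective (submod N)) ->
  (forall N N', F N -> F N' -> {subset N <= N'} \/ {subset N' <= N}) ->
  (forall x, x \in U <-> exists2 N, F N & x \in N) -> ext_injective (submod U).
Proof.
move=> I_fg [N0 FN0] FP Ftot UP; apply: baer_criterion => a f.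
have [m [z zE]] := I_fg a.
have [N FN Nz] : exists2 N, F N & forall i, sincl (f (z i)) \in N.
  have zN i : exists2 N, F N & sincl (f (z i)) \in N by apply/UP; exact: sinclP.
  suff : forall s : seq 'I_m, exists2 N, F N & forall i, i \in s -> sincl (f (z i)) \in N.
    by move=> /(_ (enum 'I_m))[N FN NP]; exists N => // i; apply: NP; rewrite mem_enum.
  elim=> [|i s [N FN Ns]]; first by exists N0.
  have [N' FN' N'i] := zN i; have [H|H] := Ftot _ _ FN FN'.
    by exists N' => // j; rewrite inE => /orP[/eqP->//|/Ns/H].
  by exists N => // j; rewrite inE => /orP[/eqP->|/Ns//]; exact: H.
have fN s : sincl (f s) \in N.
  have [c ->] := zE s; rewrite !linear_sum; elim/big_ind: _ => [|x y xN yN|i _].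
  - exact: rpred0.
  - exact: rpredD.
  by rewrite !linearZ_LR rpredZ.
have [f' f'E] : exists f' : {linear submod a -> submod N}, forall s, sincl (f' s) = lcomp sincl f s.
  by apply: factor_inj; [exact: sincl_inj|move=> s; apply: sincl_ex; exact: fN].
have [q qE] := ext_injective_ideal_test (FP _ FN) f'.
have [u uq] : exists u : submod U, sincl u = sincl q.
  by apply: sincl_ex; apply/UP; exists N => //; exact: sinclP.
exists u => s; apply: sincl_inj; rewrite linearZ_LR uq -linearZ_LR -qE f'E.
by rewrite lcompE.
Qed.
End InjectiveSubmodules.

Section Precovers.
Variables (k : comNzRingType) (R : algType k).
Hypothesis R_artin : artin_algebra R.
Hypothesis R_hered : hereditary R.
Local Notation S := (R^c).
Variables p t : lmodType S -> Prop.
Hypothesis p_sub : forall X, p X -> fg_preprojective X.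
Hypothesis t_sub : forall X, t X -> fg_regular X.
Implicit Types M N V W X Y T U I : lmodType S.

Let k_art : artinian_mod (k^o : lmodType k). Proof. by case: R_artin. Qed.
Let heredS : left_hereditary S. Proof. by case: R_hered. Qed.
Let S_fin : kfin (S^o : lmodType S). Proof. exact: kfin_op. Qed.

(** Let [Q] be a maximal injective submodule.  The quotient [V / Q] is again
    orthogonal and, as a direct summand of [V], torsion free.  If it is nonzero,
    it has a nonzero injective submodule, which together with [Q] gives a larger
    injective submodule of [V]. *)
Lemma baer_orth_injective V : baer_orth t V -> classP p V -> ext_injective V.
Proof.
move=> Vs VP; pose P (N : submodClosed V) := ext_injective (submod N).
have I_fg (a : submodClosed (S^o : lmodType S)) : fin_gen (submod a).
  by apply: (fg_submod S_fin); exact: kfin_fg.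
have [||Q [QP Qmax]] := @zorn_submod _ _ P (zerom V).
- apply: baer_criterion => a f; exists 0 => s.
  by apply: sincl_inj; rewrite scaler0 linear0; apply/eqP; exact: (sinclP (f s)).
- move=> F U F0 FP Ftot UP; exact: (ext_injective_union I_fg F0 FP Ftot UP).
have [s sK] := ext0_split (quotm_short_exact Q) (QP _).
have V't : trivialm (quotm Q).
  apply: contrapT => V'n.
  have [|||I [j [Ii ji It]]] := @baer_orth_injective_sub _ _ R_artin R_hered p t p_sub t_sub (quotm Q).
  - exact: (baer_orth_surj R_hered (@pi_surj _ _ Q) Vs).
  - exact: (classP_inj (can_inj sK) VP).
  - exact: V'n.
  pose h := linr (@sincl _ _ Q) (lcomp s j).
  have hi : injective h.
    apply: lin_inj0 => -[x y] hxy; have xy : sincl x + s (j y) = 0 := hxy.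
    have jy : j y = 0.
      have := congr1 (pi_lin Q) xy; rewrite linearD sK linear0.
      by rewrite (proj2 (pi_eq0 _ _) (sinclP x)) add0r.
    have y0 : y = 0 by apply: ji; rewrite jy linear0.
    move: xy; rewrite jy (linear0 s) addr0 => x0.
    by rewrite y0 (_ : x = 0) //; apply: sincl_inj; rewrite x0 linear0.
  have hI : ext_injective (submod (imm h)).
    apply: ext_injective_isom (ext_injective_prod QP Ii).
    apply: (isom_of (f := toimm h)); last exact: toimm_surj.
    by move=> u v /(congr1 sincl); rewrite !toimmE => /hi.
  have Qh : {subset Q <= imm h}.
    move=> x /sincl_ex[u <-]; apply/immP; exists (u, 0).
    have -> : h (u, 0) = sincl u + s (j 0) by [].
    by rewrite (linear0 j) (linear0 s) addr0.
  apply: It => y; apply: ji; rewrite linear0 -[LHS]sK; apply/pi_eq0.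
  apply: (Qmax _ hI Qh); apply/immP; exists (0, y).
  have -> : h (0, y) = sincl (0 : submod Q) + s (j y) by [].
  by rewrite linear0 add0r.
apply: ext_injective_isom QP; apply: (isom_of (f := @sincl _ _ Q)); first exact: sincl_inj.
by move=> x; apply: sincl_ex; have /pi_eq0 := V't (pi_lin Q x).
Qed.

Lemma baer_rel_Gen n (N : submodClosed ('rV[S]_n : lmodType S)) T :
  baer_rel t N -> Gen t T -> extends (@sincl _ _ N) T.
Proof.
move=> Nc [A [F [Ft [f fs]]]].
have Np : projective_mod (submod N) by apply: (submod_proj heredS); exact: rV_proj.
apply: (extends_surj Np fs); apply: extends_dsum => [|a]; last exact: Nc.
by apply: (fg_submod S_fin); exact: rV_fg.
Qed.

(** Split [C / l(C) -> P] for the precover [C] of [P] and take the preimage in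
    [C] of the complement of the kernel. *)
Lemma baer_preimage P : classP p P ->
  exists2 B, Baer t B & isom (torsion_free_quotient p B) P.
Proof.
move=> Pp.
pose C := @precov S P (baer_rel t); pose pi : {linear C -> P} := @precov_to_P S P (baer_rel t).
have CE T : Gen t T -> ext0 C T.
  by move=> tT; apply: precov_ext0 => n N Nc; exact: baer_rel_Gen.
have kS : baer_orth t (submod (kerm pi)).
  move=> n N Nc; apply: precov_ker_extends => //.
    by apply: (submod_proj heredS); exact: rV_proj.
  by apply: (fg_submod S_fin); exact: rV_fg.
have [g gE] : exists g : {linear quotm (l p C) -> P}, forall x, g (pi_lin _ x) = pi x.
  apply: factor_surj; first exact: pi_surj.
  move=> x /pi_eq0/sincl_ex[u <-].
  exact: (Pp _ (@l_torsion _ p C) (lcomp pi sincl) u).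
have gs : is_surj g by move=> y; have [x <-] := @precov_surj _ P (baer_rel t) y; exists (pi_lin _ x).
have Kinj : ext_injective (submod (kerm g)).
  apply: baer_orth_injective; last exact: (classP_inj (@sincl_inj _ _ _) (@classP_torsion_free _ p C)).
  have [q qE] : exists q : {linear submod (kerm pi) -> submod (kerm g)},
      forall x, sincl (q x) = lcomp (pi_lin (l p C)) sincl x.
    apply: factor_inj; first exact: sincl_inj.
    by move=> x; apply: sincl_ex; apply/eqP; rewrite lcompE gE; apply/eqP; exact: (sinclP x).
  apply: (baer_orth_surj R_hered (f := q)) kS => y.
  have [x xy] := pi_surj (sincl y).
  have [|u ux] := @sincl_ex _ _ (kerm pi) x.
    by apply/eqP; rewrite -gE xy; apply/eqP; exact: (sinclP y).
  by exists u; apply: sincl_inj; rewrite qE lcompE ux.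
have [s sK] := ext0_split (kerm_short_exact gs) (Kinj _).
pose B := mpreim (pi_lin (l p C)) (imm s).
exists (submod B).
  apply/BaerP => T tT; exact: (ext0_sub heredS (@sincl_inj _ _ B) (CE T tT)).
pose h := lcomp pi (@sincl _ _ B).
have lB x : x \in l p C -> x \in B.
  by move=> /pi_eq0 x0; rewrite mpreimP x0 rpred0.
apply: (torsion_free_quotient_isom (f := h)) => //.
  move=> y; have [x xy] := pi_surj (s y).
  have [u ux] : exists u : submod B, sincl u = x.
    by apply: sincl_ex; rewrite mpreimP xy imm_f.
  by exists u; rewrite lcompE ux -gE xy sK.
have hl u : h u = 0 -> sincl u \in l p C.
  rewrite lcompE -gE => gu; apply/pi_eq0.
  have := sinclP u; rewrite mpreimP => /immP[y yu].
  by move: gu; rewrite -yu sK => ->; rewrite linear0.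
have [r rE] : exists r : {linear submod (l p C) -> submod (kerm h)},
    forall x, sincl (sincl (r x)) = sincl x.
  have [r0 r0E] : exists r0 : {linear submod (l p C) -> submod B}, forall x, sincl (r0 x) = sincl x.
    by apply: factor_inj; [exact: sincl_inj|move=> x; apply: sincl_ex; apply: lB; exact: sinclP].
  have [r rE] : exists r : {linear submod (l p C) -> submod (kerm h)}, forall x, sincl (r x) = r0 x.
    apply: factor_inj; first exact: sincl_inj.
    move=> x; apply: sincl_ex; apply/eqP; rewrite lcompE r0E.
    exact: (Pp _ (@l_torsion _ p C) (lcomp pi sincl) x).
  by exists r => x; rewrite rE r0E.
apply: (classL_quot (f := r)) (@l_torsion _ p C) => y.
have /sincl_ex[x xy] : sincl (sincl y) \in l p C by apply: hl; apply/eqP; exact: (sinclP y).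
by exists x; do 2!apply: sincl_inj; rewrite rE.
Qed.

End Precovers.

(** * The correspondence *)

Theorem corollary18 (k : comNzRingType) (R : algType k)
    (R_artin : artin_algebra R)
    (R_indec : indecomposable_ring R)
    (R_hered : hereditary R)
    (R_tame : tame (R^c : algType k))
    (p t : lmodType R^c -> Prop)
    (p_rep : representative_set (@fg_preprojective k R) p)
    (t_rep : representative_set (@fg_regular k R) t) :
  exists Phi : (lmodType R^c -> Prop) -> (lmodType R^c -> Prop),
    class_bij
      (fun C => exists2 B, Baer t B & C = Baer_eq_class p t B)
      (fun D => exists2 P, classP p P & D = preproj_iso_class p P)
      Phi /\
    forall B, Baer t B ->
      Phi (Baer_eq_class p t B) =
      preproj_iso_class p (torsion_free_quotient p B).
Proof.
have p_sub X : p X -> fg_preprojective X by case: p_rep => H _ _; exact: H.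
have t_sub X : t X -> fg_regular X by case: t_rep => H _ _; exact: H.
pose Phi (C : lmodType R^c -> Prop) (X : lmodType R^c) :=
  exists2 B, C B & preproj_iso_class p (torsion_free_quotient p B) X.
have PhiE B : Baer t B ->
    Phi (Baer_eq_class p t B) = preproj_iso_class p (torsion_free_quotient p B).
  move=> Bt; apply: funext => X; apply: propext; split.
    by move=> [B' [_ BB'] [XP B'X]]; split=> //; exact: isom_trans BB' B'X.
  by move=> BX; exists B => //; split=> //; exact: isom_refl.
exists Phi; split=> //; split.
- move=> _ [B Bt ->]; exists (torsion_free_quotient p B); last exact: PhiE.
  exact: classP_torsion_free.
- move=> _ _ [B Bt ->] [B' B't ->]; rewrite !PhiE // => BB'.
  have iso : Baer_equiv p B B'.
    have : preproj_iso_class p (torsion_free_quotient p B') (torsion_free_quotient p B').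
      by split; [exact: classP_torsion_free | exact: isom_refl].
    by rewrite -BB' => -[].
  apply: funext => X; apply: propext; split=> -[Xt eX]; split=> //.
    by apply: isom_trans eX; exact: isom_sym.
  exact: isom_trans iso eX.
move=> _ [P Pp ->].
have [B Bt BP] := baer_preimage R_artin R_hered p_sub t_sub Pp.
exists (Baer_eq_class p t B); first by exists B.
rewrite PhiE //; apply: funext => X; apply: propext; split=> -[XP eX]; split=> //.
  by apply: isom_trans eX; exact: isom_sym.
exact: isom_trans BP eX.
Qed.
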